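(* Let $\epsilon>0$ and let $\mathcal{P}=\sum_{\mathcal{I}\neq\mathcal{J}}\mathcal{P}_{\rm BSH}^{\mathcal{I}\cup\mathcal{J}}$, where the sum is over pairs of root nodes $\mathcal{I},\mathcal{J}$ of the bounding sphere hierarchies of different rigid bodies. Then $\mathcal{P}$ has the log-barrier property, the smoothness property, and the non-prehensile and non-vanishing property.
   Context: Setting. There are $V$ vertices $x_1,\dots,x_V\in\mathbb{R}^3$, concatenated as $x\in\mathbb{R}^{3V}$, and finitely many triangles $t_i=\{i(1),i(2),i(3)\}\subset\{1,\dots,V\}$. The vertices are partitioned among finitely many rigid bodies and each triangle has all its vertices on one body. $\mathcal{C}\subset\mathbb{R}^{3V}$ is the set of configurations; each body moves rigidly on $\mathcal{C}$ (distances between vertices of one body are constant on $\mathcal{C}$). $\mathrm{CH}$ denotes the closed convex hull; $\mathrm{CH}(x_{\mathcal{I}})=\mathrm{CH}(\{x_i:i\in\mathcal{I}\})$. $\mathcal{C}_{\rm obs}=\{x\in\mathcal{C}:\exists\, t_k\neq t_l \text{ on different rigid bodies with } \mathrm{CH}(x_{t_k})\cap\mathrm{CH}(x_{t_l})\neq\emptyset\}$ and $\mathcal{C}_{\rm free}=\mathcal{C}\setminus\mathcal{C}_{\rm obs}$. Bounding sphere hierarchy (BSH). For an index set $\mathcal{I}$ put $x_{\mathcal{I}}=\frac{1}{|\mathcal{I}|}\sum_{i\in\mathcal{I}}x_i$. Each rigid body has a BSH: a binary tree in which each leaf stores a single triangle $t_i$ (all triangles of the body occur as leaves, each once), and each internal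 node is the index set $\mathcal{I}=\mathcal{I}_l\cup\mathcal{I}_r$, the union of its two children. The sphere of node $\mathcal{I}$ has center $x_{\mathcal{I}}$ and radius $R_{\mathcal{I}}$: for a leaf, $R_{t_i}>0$ satisfies $R_{t_i}\ge\max_{k\in t_i}\|x_{t_i}-x_k\|$; for an internal node, $R_{\mathcal{I}}$ is the smallest radius such that the ball centered at $x_{\mathcal{I}}$ contains the balls of both children. By rigidity the radii are constants. $C(\mathcal{I})=\{\mathcal{I}_l,\mathcal{I}_r\}$ for an internal node and $C(\mathcal{I})=\{\mathcal{I}\}$ for a leaf. Potentials. $1/(s)^+=1/\max(s,0)$, equal to $+\infty$ for $s\le0$. For triangles on different bodies, $$\mathcal{P}^{t_i\cup t_j}=\min_{(n,d)\in\mathbb{R}^3\times\mathbb{R}}\Big[\tfrac{12}{(1-\|n\|)^+}+\sum_{k=1}^3\tfrac{1}{(\langle x_{i(k)},n\rangle+d)^+}+\sum_{k=1}^3\tfrac{1}{(\langle x_{j(k)},-n\rangle-d)^+}\Big].$$ The centered potential is $\mathcal{P}_c^{\mathcal{I}\cup\mathcal{J}}=12\big[1+1/\sqrt{\|x_{\mathcal{I}}-x_{\mathcal{J}}\|}\big]^2$. Given potentials $\mathcal{P}_{d_1}^{\mathcal{I}\cup\mathcal{J}},\mathcal{P}_{d_2}^{\mathcal{I}\cup\mathcal{J}}$ and $d_1<d_2$, the blended potential is $$\mathcal{P}_{d_1\to d_2}^{\mathcal{I}\cup\mathcal{J}}=(1-\phi)\mathcal{P}_{d_1}^{\mathcal{I}\cup\mathcal{J}}+\phi\,\mathcal{P}_{d_2}^{\mathcal{I}\cup\mathcal{J}},\quad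 \phi=\Phi\Big(\frac{\|x_{\mathcal{I}}-x_{\mathcal{J}}\|-d_1}{d_2-d_1}\Big),$$ where $\Phi(s)=0$ for $s\le0$, $\Phi(s)=6s^5-15s^4+10s^3$ for $0\le s\le1$, $\Phi(s)=1$ for $s\ge1$, with the convention $0\cdot\infty=0$ (so it equals $\mathcal{P}_{d_1}$ where $\phi=0$ and $\mathcal{P}_{d_2}$ where $\phi=1$). For nodes $\mathcal{I},\mathcal{J}$ of the hierarchies of two different rigid bodies, set $d_1=R_{\mathcal{I}}+R_{\mathcal{J}}$, $d_2=(1+\epsilon)d_1$, and define recursively $\mathcal{P}_{\rm BSH}^{\mathcal{I}\cup\mathcal{J}}=\mathcal{P}_{d_1\to d_2}^{\mathcal{I}\cup\mathcal{J}}$ with $\mathcal{P}_{d_2}^{\mathcal{I}\cup\mathcal{J}}=\mathcal{P}_c^{\mathcal{I}\cup\mathcal{J}}$ and: if both nodes are leaves $t_i,t_j$, $\mathcal{P}_{d_1}^{t_i\cup t_j}=\mathcal{P}^{t_i\cup t_j}$; otherwise $\mathcal{P}_{d_1}^{\mathcal{I}\cup\mathcal{J}}=\sum_{\mathcal{I}_c\in C(\mathcal{I})}\sum_{\mathcal{J}_c\in C(\mathcal{J})}\mathcal{P}_{\rm BSH}^{\mathcal{I}_c\cup\mathcal{J}_c}$. All potentials are given by these formulas on $\mathbb{R}^{3V}$ with the radii held constant, and derivatives are taken in $\mathbb{R}^{3V}$. Properties. A potential $\mathcal{P}^{\mathcal{I}\cup\mathcal{J}}$ is non-prehensile at $x$,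 where $\mathrm{CH}(x_{\mathcal{I}})\cap\mathrm{CH}(x_{\mathcal{J}})=\emptyset$, if $-\partial\mathcal{P}^{\mathcal{I}\cup\mathcal{J}}/\partial x_i\in\mathcal{F}_{\mathcal{J}\to\mathcal{I}}$ for all $i\in\mathcal{I}$ and $-\partial\mathcal{P}^{\mathcal{I}\cup\mathcal{J}}/\partial x_j\in\mathcal{F}_{\mathcal{I}\to\mathcal{J}}$ for all $j\in\mathcal{J}$, where $\mathcal{F}_{\mathcal{J}\to\mathcal{I}}=\{\alpha(a-b):\alpha>0,\ a\in\mathrm{CH}(x_{\mathcal{I}}),\ b\in\mathrm{CH}(x_{\mathcal{J}})\}$ (and $\mathcal{F}_{\mathcal{I}\to\mathcal{J}}$ symmetrically). A total potential $\mathcal{P}$ has: - the log-barrier property if $\mathcal{P}\ge0$ is continuous on $\mathcal{C}$ (as a $[0,\infty]$-valued function) and $\mathcal{P}(x)=\infty$ iff $x\in\mathcal{C}_{\rm obs}$; - the smoothness property if it is twice differentiable at every $x\in\mathcal{C}_{\rm free}$; - the non-prehensile and non-vanishing property if at every $x\in\mathcal{C}_{\rm free}$ there is a finite family $\mathcal{A}(x)$ of pairs $\langle\mathcal{I},\mathcal{J}\rangle$ with $\mathcal{I}\cap\mathcal{J}=\emptyset$, $\mathcal{I}\cup\mathcal{J}\subseteq\{1,\dots,V\}$, $\mathrm{CH}(x_{\mathcal{I}})\cap\mathrm{CH}(x_{\mathcal{J}})=\emptyset$, such that $\mathcal{P}=\sum_{\langle\mathcal{I},\mathcal{J}\rangle\in\mathcal{A}(x)}\mathcal{P}^{\mathcal{I}\cup\mathcal{J}}$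 with every term (a pairwise potential depending only on $x_i$, $i\in\mathcal{I}\cup\mathcal{J}$) non-prehensile at $x$, and for every pair of triangles $\langle t_i,t_j\rangle$ on different rigid bodies, $t_i\cup t_j\subseteq\mathcal{I}\cup\mathcal{J}$ for at least one $\langle\mathcal{I},\mathcal{J}\rangle\in\mathcal{A}(x)$. *)

(* Defs.v *)
From HB Require Import structures.
From mathcomp Require Import all_boot all_order all_algebra.
From mathcomp Require Import all_classical all_reals all_analysis.

Set Implicit Arguments.
Unset Strict Implicit.
Unset Printing Implicit Defensive.

Import Order.TTheory GRing.Theory Num.Theory.
Import numFieldTopology.Exports numFieldNormedType.Exports.

Local Open Scope classical_set_scope.
Local Open Scope ring_scope.

(* A configuration is a matrix x : 'M[R]_(V, 3) whose i-th row is the position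
   of vertex i. The library norm on matrices is the sup norm: it is used only
   through its topology and through differentiability, which do not depend on
   the norm in finite dimension. Metric notions use [enorm]. *)

Section euclidean_space.
Variable R : realType.

Definition dot (u v : 'rV[R]_3) : R := \sum_(k < 3) u ord0 k * v ord0 k.

Definition enorm (u : 'rV[R]_3) : R := Num.sqrt (dot u u).

Definition closed_eball (c : 'rV[R]_3) (r : R) : set 'rV[R]_3 :=
  [set p | enorm (p - c) <= r].

Definition closed_convex_hull (A : set 'rV[R]_3) : set 'rV[R]_3 :=
  smallest (fun K : set 'rV[R]_3 => closed K /\ convex_set K) A.

Definition is_smallest_radius (c : 'rV[R]_3) (A : set 'rV[R]_3) (r : R) : Prop :=
  A `<=` closed_eball c r /\ forall s, A `<=` closed_eball c s -> r <= s.

End euclidean_space.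

Section vertices.
Variables (R : realType) (V : nat).
Implicit Types (x : 'M[R]_(V, 3)) (I J : {set 'I_V}).

Definition CH x I : set 'rV[R]_3 :=
  closed_convex_hull [set row i x | i in [set` I]].

Definition centroid x I : 'rV[R]_3 := #|I|%:R^-1 *: \sum_(i in I) row i x.

Definition center_dist x I J : R := enorm (centroid x I - centroid x J).

(* [force_cone x J I] is F_(J -> I), the forces pushing I away from J. *)
Definition force_cone x J I : set 'rV[R]_3 :=
  [set f | exists alpha a b,
     [/\ 0 < alpha, CH x I a, CH x J b & f = alpha *: (a - b)]].

End vertices.

Section bounding_sphere_hierarchy.
Variables (R : realType) (V : nat).

(* The radii are stored in the tree, as constants independent of the
   configuration. *)
Inductive bsh : Type :=
| Leaf (t : {set 'I_V}) (r : R)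
| Node (hl hr : bsh) (r : R).

Definition radius (h : bsh) : R :=
  match h with Leaf _ r => r | Node _ _ r => r end.

Fixpoint vertices (h : bsh) : {set 'I_V} :=
  match h with
  | Leaf t _ => t
  | Node hl hr _ => vertices hl :|: vertices hr
  end.

Fixpoint leaves (h : bsh) : seq {set 'I_V} :=
  match h with
  | Leaf t _ => [:: t]
  | Node hl hr _ => leaves hl ++ leaves hr
  end.

Definition is_leaf (h : bsh) : bool := if h is Leaf _ _ then true else false.

Definition children (h : bsh) : seq bsh :=
  match h with Leaf _ _ => [:: h] | Node hl hr _ => [:: hl; hr] end.

Definition node_ball (x : 'M[R]_(V, 3)) (h : bsh) : set 'rV[R]_3 :=
  closed_eball (centroid x (vertices h)) (radius h).

Fixpoint valid_radii (C : set 'M[R]_(V, 3)) (h : bsh) : Prop :=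
  match h with
  | Leaf t r =>
      0 < r /\
      forall x, C x -> forall k, k \in t -> enorm (centroid x t - row k x) <= r
  | Node hl hr r =>
      [/\ valid_radii C hl, valid_radii C hr &
       forall x, C x ->
         is_smallest_radius (centroid x (vertices hl :|: vertices hr))
           (node_ball x hl `|` node_ball x hr) r]
  end.

Definition is_bsh (C : set 'M[R]_(V, 3)) (T : {set {set 'I_V}}) (h : bsh) :=
  perm_eq (leaves h) (enum T) /\ valid_radii C h.

End bounding_sphere_hierarchy.

Arguments bsh : clear implicits.
Arguments Leaf {R V}.
Arguments Node {R V}.

Section potentials.
Variables (R : realType) (V : nat).
Implicit Types (x : 'M[R]_(V, 3)) (I J : {set 'I_V}).
Implicit Types (P : 'M[R]_(V, 3) -> \bar R).

(* 1/(s)^+ *)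
Definition inv_pos (s : R) : \bar R := if 0 < s then (s^-1)%:E else +oo%E.

Definition separation_energy (t t' : {set 'I_V}) x (nd : 'rV[R]_3 * R) : \bar R :=
  (12%:E * inv_pos (1 - enorm nd.1)%R
   + \sum_(k in t) inv_pos (dot (row k x) nd.1 + nd.2)%R
   + \sum_(k in t') inv_pos (dot (row k x) (- nd.1) - nd.2)%R)%E.

(* The infimum is always attained, so this is the minimum. *)
Definition triangle_potential (t t' : {set 'I_V}) x : \bar R :=
  ereal_inf (range (separation_energy t t' x)).

(* Equal to +oo when the two centers coincide. *)
Definition centered_potential I J x : \bar R :=
  (12%:E * (1 + inv_pos (Num.sqrt (center_dist x I J))) ^+ 2)%E.

Definition smoothstep (s : R) : R :=
  if s <= 0 then 0
  else if s <= 1 then 6 * s ^+ 5 - 15 * s ^+ 4 + 10 * s ^+ 3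
  else 1.

(* In [\bar R], 0 * +oo = 0. *)
Definition blended_potential I J (d1 d2 : R) P1 P2 x : \bar R :=
  let phi := smoothstep ((center_dist x I J - d1) / (d2 - d1)) in
  ((1 - phi)%:E * P1 x + phi%:E * P2 x)%E.

Definition node_blend (eps : R) (h h' : bsh R V) P1 : 'M[R]_(V, 3) -> \bar R :=
  let d1 := radius h + radius h' in
  blended_potential (vertices h) (vertices h') d1 ((1 + eps) * d1)
    P1 (centered_potential (vertices h) (vertices h')).

(* The double sum over the children is spelled out so that the recursion is
   structural; [bsh_potentialE] below is the uniform recursive equation. *)
Fixpoint bsh_potential (eps : R) (h : bsh R V) :
    bsh R V -> 'M[R]_(V, 3) -> \bar R :=
  fix bsh_potential_h (h' : bsh R V) : 'M[R]_(V, 3) -> \bar R :=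
    node_blend eps h h'
      match h, h' with
      | Leaf t _, Leaf t' _ => triangle_potential t t'
      | Leaf _ _, Node hl' hr' _ => fun x =>
          (bsh_potential_h hl' x + bsh_potential_h hr' x)%E
      | Node hl hr _, Leaf _ _ => fun x =>
          (bsh_potential eps hl h' x + bsh_potential eps hr h' x)%E
      | Node hl hr _, Node hl' hr' _ => fun x =>
          ((bsh_potential eps hl hl' x + bsh_potential eps hl hr' x)
           + (bsh_potential eps hr hl' x + bsh_potential eps hr hr' x))%E
      end.

Lemma bsh_potentialE eps (h h' : bsh R V) :
  bsh_potential eps h h' =
  node_blend eps h h'
    (if is_leaf h && is_leaf h' then
       triangle_potential (vertices h) (vertices h')
     else fun x =>
       (\sum_(hc <- children h) \sum_(hc' <- children h')
          bsh_potential eps hc hc' x)%E).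
Proof.
by case: h h' => [t r|hl hr r] [t' r'|hl' hr' r'] //;
  congr node_blend; apply/funext => x; rewrite /= !big_cons !big_nil !adde0.
Qed.

(* Each unordered pair of bodies is counted once. *)
Definition total_potential (eps : R) (B : nat) (h : 'I_B -> bsh R V) x : \bar R :=
  (\sum_(b < B) \sum_(b' < B | (b < b')%N) bsh_potential eps (h b) (h b') x)%E.

End potentials.

Section rigid_bodies.
Variables (R : realType) (V B : nat) (body : 'I_V -> 'I_B).
Implicit Types (T : {set {set 'I_V}}) (C : set 'M[R]_(V, 3)).

Definition on_body (b : 'I_B) (t : {set 'I_V}) : bool :=
  [forall i in t, body i == b].

Definition body_triangles T (b : 'I_B) : {set {set 'I_V}} :=
  [set t in T | on_body b t].

Definition triangulation T : Prop :=
  forall t, t \in T -> #|t| = 3%N /\ exists b, on_body b t.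

Definition moves_rigidly C : Prop :=
  forall x y, C x -> C y -> forall i j, body i = body j ->
    enorm (row i x - row j x) = enorm (row i y - row j y).

Definition on_different_bodies (t t' : {set 'I_V}) : Prop :=
  exists b b', [/\ b != b', on_body b t & on_body b' t'].

Definition C_obs T C : set 'M[R]_(V, 3) :=
  [set x | C x /\ exists t t',
     [/\ t \in T, t' \in T, t != t', on_different_bodies t t' &
      CH x t `&` CH x t' !=set0]].

Definition C_free T C : set 'M[R]_(V, 3) := C `\` C_obs T C.

End rigid_bodies.

Section properties.
Variables (R : realType) (V : nat).
Implicit Types (P : 'M[R]_(V, 3) -> \bar R) (x : 'M[R]_(V, 3)).
Implicit Types (I J : {set 'I_V}).

(* The i-th row is the partial derivative of f with respect to vertex i. *)
Definition grad (f : 'M[R]_(V, 3) -> R) x : 'M[R]_(V, 3) :=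
  \matrix_(i, k) 'D_(delta_mx i k) f x.

Definition finite_near P x : Prop := \forall y \near x, P y \is a fin_num.

Definition twice_differentiable P x : Prop :=
  [/\ finite_near P x,
      \forall y \near x, differentiable (fine \o P) y &
      differentiable (grad (fine \o P)) x].

Definition nonprehensile P I J x : Prop :=
  [/\ finite_near P x, differentiable (fine \o P) x,
      forall i, i \in I -> force_cone x J I (- row i (grad (fine \o P) x)) &
      forall j, j \in J -> force_cone x I J (- row j (grad (fine \o P) x))].

Definition depends_only_on P I : Prop :=
  forall y z, (forall i, i \in I -> row i y = row i z) -> P y = P z.

Definition log_barrier (C obs : set 'M[R]_(V, 3)) P : Prop :=
  [/\ forall x, C x -> (0 <= P x)%E,
      {within C, continuous P} &
      forall x, C x -> (P x = +oo%E <-> obs x)].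

Definition smooth_on (free : set 'M[R]_(V, 3)) P : Prop :=
  forall x, free x -> twice_differentiable P x.

(* The decomposition of P holds near x, as its terms are compared through
   their derivatives at x. *)
Definition nonprehensile_nonvanishing (B : nat) (body : 'I_V -> 'I_B)
    (T : {set {set 'I_V}}) (free : set 'M[R]_(V, 3)) P : Prop :=
  forall x, free x ->
  exists (A : {set {set 'I_V} * {set 'I_V}})
         (Q : {set 'I_V} -> {set 'I_V} -> 'M[R]_(V, 3) -> \bar R),
  [/\ forall I J, (I, J) \in A ->
        [/\ I :&: J = finset.set0, CH x I `&` CH x J = set0,
            depends_only_on (Q I J) (I :|: J) & nonprehensile (Q I J) I J x],
      \forall y \near x, P y = (\sum_(p in A) Q p.1 p.2 y)%E &
      forall t t', t \in T -> t' \in T -> on_different_bodies body t t' ->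
        exists I J, (I, J) \in A /\ t :|: t' \subset I :|: J].

End properties.

(* Main.v *)
(* Two triangles are separated by a plane (n, d) with |n| < 1, and the barrier energy
   is strongly convex in (n, d) on the separating planes. Its minimizer is therefore
   unique, and since the stationarity equation has a coercive Jacobian it is a
   differentiable function of the configuration. By the envelope identity the
   gradient of the minimum in a vertex is n / s^2 up to sign, with s the value of the
   affine form at the vertex; stationarity in (n, d) makes n a positive multiple of a
   difference of points of the two hulls. Hence triangle potentials are twice
   differentiable and non-prehensile.

   In a blend with weight phi, the term phi' (P_c - P_d1) grad |x_I - x_J| pushes the
   bodies apart as soon as P_c <= P_d1. For leaves this is Jensen's inequality. For
   other nodes at distance D >= R_I + R_J, the balls of the children are again
   disjoint, so the bound holds for the children by induction; their centers are at
   distance at most 2 D, and two terms 12 (1 + 1 / sqrt (2 D))^2 dominate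
   12 (1 + 1 / sqrt D)^2.

   The family A(x) is obtained by stopping the recursion at the first pairs with
   |x_I - x_J| >= R_I + R_J, or at leaves. If the balls are tangent the hulls are
   still disjoint, since a common point would be a common vertex. *)

From HB Require Import structures.
Require Import Defs.
From mathcomp Require Import all_boot all_order all_algebra.
From mathcomp Require Import all_classical all_reals all_analysis.
From mathcomp Require Import ring lra.

Set Implicit Arguments.
Unset Strict Implicit.
Unset Printing Implicit Defensive.

Import Order.TTheory GRing.Theory Num.Theory.
Import numFieldTopology.Exports numFieldNormedType.Exports.

Local Open Scope classical_set_scope.
Local Open Scope ring_scope.

(** * Differentiability and implicit functions *)

(** The first gives stationarity and the envelope identity. The second, with one constant near a
    configuration, gives continuity of the minimizer and injectivity of the partial differential, so
    no Hessian is computed.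

    The force cone of disjoint hulls does not contain 0, so a vanishing gradient is a failure. A sum
    is therefore non-prehensile only if every vertex is reached by some term, and a blend of weight
    1 must take its push from the slope of the centered potential, which never vanishes.

    The centered potential is the optimal energy of two triangles collapsed to their centroids; this
    explains its factor 12 and its square root.

    The potentials take the value +oo. Near a free configuration each one equals a real function, on
    which the calculus is done; at obstacles continuity is a blow-up estimate, which must survive
    blend weights that vanish at the point but perhaps not near it. *)

Section differentiability.
Context {R : realType}.

(* Stated for normed modules: on a matrix type, unification unfolds [nbhs] and the
   [Filter] instance is no longer found. *)
Lemma near_all (V : normedModType R) (P : V -> Prop) (x : V) :
  (forall y, P y) -> \forall y \near x, P y.
Proof. by move=> H; exact: nearW. Qed.

Lemma nearS (V : normedModType R) (P Q : V -> Prop) (x : V) :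
  (forall y, P y -> Q y) -> (\forall y \near x, P y) -> \forall y \near x, Q y.
Proof. by move=> H; exact: filterS. Qed.

Lemma nearS2 (V : normedModType R) (P Q T : V -> Prop) (x : V) :
  (forall y, P y -> Q y -> T y) ->
  (\forall y \near x, P y) -> (\forall y \near x, Q y) -> \forall y \near x, T y.
Proof. by move=> H; exact: filterS2. Qed.

Lemma near_forall (V : normedModType R) (I : finType) (P : I -> V -> Prop) (x : V) :
  (forall i, \forall y \near x, P i y) -> \forall y \near x, forall i, P i y.
Proof. by move=> H; exact: filter_forall. Qed.

Lemma continuous_near_dist (V W : normedModType R) (f : V -> W) (x : V) :
  {for x, continuous f} <->
  forall e : R, 0 < e -> \forall y \near x, `|f x - f y| <= e.
Proof. exact: cvgrPdist_le. Qed.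

Lemma near0_pos (P : R -> Prop) :
  (\forall h \near (0 : R), P h) -> exists2 h : R, 0 < h & P h.
Proof.
move=> H.
have H' : \forall h \near (0 : R)^'+, P h by exact: cvg_within.
have [h [h0 Ph]] := filter_ex (filterI (nbhs_right_gt (0 : R)) H').
by exists h.
Qed.

Lemma differentiable_near_bound (V W : normedModType R) (f : V -> W) x :
  differentiable f x -> forall e : R, 0 < e ->
  \forall h \near 0, `|f (h + x) - f x - 'd f x h| <= e * `|h|.
Proof.
move=> /diff_locally /eqaddoP + e e0 => /(_ e e0).
apply: filterS => h /=; by rewrite !fctE /= opprD addrA.
Qed.

(** Serves where the differential is known beforehand and only the first-order estimate has to be
    checked, as for implicit functions and the envelope identity. *)
Lemma near_bound_diff (V W : normedModType R) (f : V -> W) x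
    (df : {linear V -> W}) : continuous df ->
  (forall e : R, 0 < e ->
    \forall h \near 0, `|f (h + x) - f x - df h| <= e * `|h|) ->
  is_diff x f df.
Proof.
move=> dfc H.
have L : f \o shift x = cst (f x) + df +o_ 0 id.
  apply/eqaddoP => e e0; have := H e e0.
  by apply: filterS => h /=; rewrite !fctE /= opprD addrA.
have E := diff_unique dfc L.
apply: DiffDef => //; apply/diff_locallyP; rewrite E; split => //.
Qed.

Lemma near_eq_is_diff (V W : normedModType R) (f g : V -> W) x :
  (\forall y \near x, f y = g y) -> differentiable f x -> 
  is_diff x g ('d f x).
Proof.
move=> fg df.
have [dc _] := (diff_locallyP _ _).1 df.
apply: near_bound_diff => // e e0.
have fgx := nbhs_singleton fg.
have H1 := differentiable_near_bound df e0.
near=> h.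
have -> : g (h + x) = f (h + x).
  apply/esym; near: h.
  have : \forall h \near 0, f (h + x) = g (h + x).
    by move: fg; rewrite (near_shift 0) subr0.
  by [].
by rewrite -fgx; near: h.
Unshelve. all: by end_near. Qed.

Lemma near_eq_differentiable (V W : normedModType R) (f g : V -> W) x :
  (\forall y \near x, f y = g y) -> differentiable f x -> differentiable g x.
Proof. by move=> fg df; have [] := near_eq_is_diff fg df. Qed.

Lemma differentiable_big (V W : normedModType R) (I : Type) (r : seq I) (P : pred I)
  (F : I -> V -> W) x :
  (forall i, P i -> differentiable (F i) x) ->
  differentiable (fun y => \sum_(i <- r | P i) F i y) x.
Proof.
move=> H; elim: r => [|i r IH].
  apply: (near_eq_differentiable (f := cst 0)); last exact: differentiable_cst.
  by apply: nearW => y; rewrite big_nil.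
have E : (fun y => \sum_(i <- i :: r | P i) F i y) =
   if P i then F i + (fun y => \sum_(i <- r | P i) F i y) else (fun y => \sum_(i <- r | P i) F i y).
  by case: ifP => Pi; apply/funext => y; rewrite big_cons Pi.
rewrite E; case: ifP => Pi => //; apply: differentiableD => //; exact: H.
Qed.

Lemma differentiable_mx_linear m n (W : normedModType R)
  (f : {linear 'M[R]_(m, n) -> W}) x : differentiable f x.
Proof.
have -> : (f : _ -> _) = fun x => \sum_i \sum_j x i j *: f (delta_mx i j).
  apply/funext => y; rewrite {1}[y]matrix_sum_delta linear_sum.
  by apply: eq_bigr => i _; rewrite linear_sum; apply: eq_bigr => j _; rewrite linearZ.
apply: differentiable_big => i _; apply: differentiable_big => j _.
by apply: differentiableZl; exact: differentiable_coord.
Qed.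

Lemma mx_linear_continuous m n (W : normedModType R)
  (f : {linear 'M[R]_(m, n) -> W}) : continuous f.
Proof. by move=> x; exact/differentiable_continuous/differentiable_mx_linear. Qed.

Lemma differentiable_mx m n (V : normedModType R) (F : V -> 'M[R]_(m, n)) x :
  (forall i j, differentiable (fun y => F y i j) x) -> differentiable F x.
Proof.
move=> H.
apply: (near_eq_differentiable (f := fun y => \sum_i \sum_j F y i j *: delta_mx i j)).
  by apply: nearW => y; rewrite -matrix_sum_delta.
apply: differentiable_big => i _; apply: differentiable_big => j _.
by apply: differentiableZl.
Qed.

Lemma differentiable_entry m n (V : normedModType R) (F : V -> 'M[R]_(m, n)) x i j :
  differentiable F x -> differentiable (fun y => F y i j) x.
Proof.
move=> dF; exact: (@differentiable_comp _ _ _ _ F (fun A : 'M[R]_(m, n) => A i j) x dF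
  (differentiable_coord _ _ _)).
Qed.

Lemma differentiable_scalemx m n (V : normedModType R) (k : V -> R)
    (F : V -> 'M[R]_(m, n)) x :
  differentiable k x -> differentiable F x -> differentiable (fun y => k y *: F y) x.
Proof.
move=> dk dF; apply: differentiable_mx => i j.
apply: (near_eq_differentiable (f := k * (fun y => F y i j))).
  by apply: near_all => y; rewrite mxE.
exact: differentiableM (differentiable_entry i j dF).
Qed.

(** The branch [z] and its continuity are given, so the expansion of [G] at one point suffices: the
    partial differential in [w] is injective, hence invertible in finite dimension, and the
    expansion along the branch is solved for the increment of [z]. *)
Lemma implicit_function_differentiable (X : normedModType R) m
    (G : X * 'rV[R]_m -> 'rV[R]_m) (z : X -> 'rV[R]_m) x0 :
  differentiable G (x0, z x0) -> {for x0, continuous z} ->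
  (\forall x \near x0, G (x, z x) = 0) ->
  (forall w, 'd G (x0, z x0) (0, w) = 0 -> w = 0) ->
  differentiable z x0.
Proof.
move=> dG zc Gz injG; set p := (x0, z x0).
pose A w := 'd G p (0, w).
have Alin : linear A.
  by move=> a u v; rewrite /A -linearP; congr ('d G p _); rewrite /GRing.scale /GRing.add/= /scale_pair /add_pair/= scaler0 addr0.
pose AL : {linear 'rV[R]_m -> 'rV[R]_m} := HB.pack A (GRing.isLinear.Build _ _ _ _ A Alin).
pose B w := 'd G p (w, 0).
have Blin : linear B.
  by move=> a u v; rewrite /B -linearP; congr ('d G p _); rewrite /GRing.scale /GRing.add/= /scale_pair /add_pair/= scaler0 addr0.
pose M := lin1_mx AL.
have AM w : A w = w *m M by rewrite mul_rV_lin1.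
have Mu : M \in unitmx.
  rewrite -row_free_unit -kermx_eq0; apply/rowV0P => w /sub_kermxP wM.
  by apply: injG; rewrite -/(A w) AM.
have dGc : continuous ('d G p) by exact: diff_continuous.
pose N := mulmxr (invmx M) : {linear 'rV[R]_m -> 'rV[R]_m}.
pose df w := - N (B w).
have dflin : linear df.
  by move=> a u v; rewrite /df Blin linearP opprD scalerN.
pose dfL : {linear X -> 'rV[R]_m} := HB.pack df (GRing.isLinear.Build _ _ _ _ df dflin).
have Bc : continuous B.
  move=> u; apply: (@continuous_comp _ _ _ (fun w : X => (w, 0 : 'rV[R]_m)) ('d G p)); last exact: dGc.
  by apply: (@cvg_pair _ _ _ (nbhs u) (nbhs u) (nbhs (0 : 'rV[R]_m))); [exact: cvg_id | exact: cvg_cst].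
have dfc : continuous df.
  move=> u; apply: (@continuousN _ _ _ (N \o B)).
  exact: (@continuous_comp _ _ _ B N u (Bc u) (@mx_linear_continuous _ _ _ N (B u))).
have [kN /= kN0 kNP] : exists2 k, 0 < k & forall w, `|N w| <= k * `|w|.
  have /linear_lipschitz := @mx_linear_continuous _ _ _ N.
  by case=> k k0 H; exists k.
have [kd /= kd0 kdP] : exists2 k, 0 < k & forall w, `|df w| <= k * `|w|.
  have /(@linear_lipschitz _ _ _ dfL) := dfc.
  by case=> k k0 H; exists k.
(* The linear part of G at p, normalised by N, is z - z0 - df (x - x0). *)
have key e : 0 < e -> \forall h \near 0,
    `|z (h + x0) - z x0 - df h| <= e * (`|h| + `|z (h + x0) - z x0|).
  move=> e0.
  have ek : 0 < e / kN by rewrite divr_gt0.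
  have H1 := differentiable_near_bound dG ek.
  have H2 : \forall h \near (0 : X),
      `|G ((h, z (h + x0) - z x0) + p) - G p - 'd G p (h, z (h + x0) - z x0)|
       <= e / kN * `|(h, z (h + x0) - z x0)|.
    have C1 : z (h + x0) @[h --> 0] --> z x0.
      move=> U /zc zU.
      have {}zU : \forall x \near x0, U (z x) by [].
      by rewrite (near_shift 0) subr0 in zU.
    have C2 : z (h + x0) - z x0 @[h --> 0] --> (0 : 'rV[R]_m).
      by rewrite -[X in _ --> X](subrr (z x0)); apply: cvgB => //; exact: cvg_cst.
    have C : (h, z (h + x0) - z x0) @[h --> 0] --> ((0, 0) : X * 'rV[R]_m)%type.
      by apply: (@cvg_pair _ _ _ _ (nbhs (0 : X)) (nbhs (0 : 'rV[R]_m))) => //; exact: cvg_id.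
    exact: C H1.
  have H3 : \forall h \near 0, G (h + x0, z (h + x0)) = 0.
    by move: Gz; rewrite (near_shift 0) subr0.
  have G0 : G p = 0 by exact: nbhs_singleton Gz.
  apply: filterS2 H2 H3 => h; set w := z (h + x0) - z x0.
  have -> : (h, w) + p = (h + x0, z (h + x0)).
    by rewrite /GRing.add/= /add_pair/= /w subrK.
  move=> + Gh; rewrite Gh G0 subrr sub0r normrN => H.
  have E : N ('d G p (h, w)) = w - df h.
    have -> : (h, w) = (h, 0) + (0, w) :> X * _.
      by rewrite /GRing.add/= /add_pair/= addr0 add0r.
    rewrite linearD linearD /df opprK addrC -/(A w) AM /N /= mulmxK //.
  rewrite -E; apply: (le_trans (kNP _)).
  rewrite -ler_pdivlMl // mulrA [_^-1 * _]mulrC; apply: (le_trans H).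
  by rewrite ler_pM2l // prod_normE ge_max lerDl lerDr !normr_ge0.
(* With error factor 1/2 the increment of [z] on the right is absorbed on the left, so it is at most
   (1 + 2 kd) |h|. Adding |h| gives the constant [c] by which [e] is divided. *)
have /key Hlip : 0 < (2^-1 : R) by rewrite invr_gt0.
suff : is_diff x0 z dfL by case.
apply: (@near_bound_diff _ _ z x0 dfL dfc) => e e0.
pose c : R := (1 + (1 + 2 * kd)).
have c0 : 0 < c by rewrite /c; lra.
have /key Hk : 0 < e / c by rewrite divr_gt0.
apply: filterS2 Hlip Hk => h h1 h2.
apply: le_trans h2 _.
rewrite -mulrA ler_pM2l // ler_pdivrMl // /c.
have h3 := kdP h.
have h4 := ler_normD (z (h + x0) - z x0 - df h) (df h).
rewrite subrK in h4.
have h5 := normr_ge0 h.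
nra.
Qed.

End differentiability.

(** * Twice differentiable real functions and their gradients *)

Section twice_differentiable_functions.
Context {R : realType} {V : nat}.
Implicit Types (f g : 'M[R]_(V, 3) -> R) (x y : 'M[R]_(V, 3)).

Definition smooth2 f x :=
  (\forall y \near x, differentiable f y) /\ differentiable (grad f) x.

Lemma smooth2_differentiable f x : smooth2 f x -> differentiable f x.
Proof. by case=> /nbhs_singleton. Qed.

Lemma smooth2_continuous f x : smooth2 f x -> {for x, continuous f}.
Proof. by move=> /smooth2_differentiable/differentiable_continuous. Qed.

Lemma near_eq_grad f g x : (\forall y \near x, f y = g y) -> grad f x = grad g x.
Proof. by move=> fg; apply/matrixP => i k; rewrite !mxE; exact: near_eq_derive. Qed.

Lemma near_eq_grad_near f g x : (\forall y \near x, f y = g y) ->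
  \forall y \near x, grad f y = grad g y.
Proof. by move=> /nbhs_interior; apply: nearS => y; exact: near_eq_grad. Qed.

Lemma near_eq_smooth2 f g x :
  (\forall y \near x, f y = g y) -> smooth2 f x -> smooth2 g x.
Proof.
move=> fg [df dgf]; split; last first.
  exact: near_eq_differentiable (near_eq_grad_near fg) dgf.
move/nbhs_interior: fg => fg; near=> y.
apply: (@near_eq_differentiable _ _ _ f); near: y => //.
Unshelve. all: by end_near. Qed.

Lemma grad_cst (c : R) x : grad (cst c) x = 0.
Proof. by apply/matrixP => i k; rewrite !mxE derive_cst. Qed.

Lemma smooth2_cst (c : R) x : smooth2 (cst c) x.
Proof.
rewrite /smooth2; split; first by near=> y; exact: differentiable_cst.
apply: (near_eq_differentiable (f := cst 0)); last exact: differentiable_cst.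
by apply: near_all => y; rewrite grad_cst.
Unshelve. all: by end_near. Qed.

Lemma gradD f g x : differentiable f x -> differentiable g x ->
  grad (fun y => f y + g y) x = grad f x + grad g x.
Proof.
move=> df dg; apply/matrixP => i k; rewrite !mxE.
by rewrite (@deriveD _ _ _ f g); [|exact: diff_derivable..].
Qed.

Lemma smooth2D f g x : smooth2 f x -> smooth2 g x -> smooth2 (fun y => f y + g y) x.
Proof.
move=> [df ddf] [dg ddg]; split.
  by apply: nearS2 df dg => y; exact: differentiableD.
apply: (near_eq_differentiable (f := fun y => grad f y + grad g y)); last exact: differentiableD.
by apply: nearS2 df dg => y dfy dgy; rewrite gradD.
Qed.

Lemma gradM f g x : differentiable f x -> differentiable g x ->
  grad (fun y => f y * g y) x = f x *: grad g x + g x *: grad f x.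
Proof.
move=> df dg; apply/matrixP => i k; rewrite !mxE.
by rewrite (@deriveM _ _ f g); [|exact: diff_derivable..].
Qed.

Lemma smooth2M f g x : smooth2 f x -> smooth2 g x -> smooth2 (fun y => f y * g y) x.
Proof.
move=> sf sg; have [df ddf] := sf; have [dg ddg] := sg.
have dfx := smooth2_differentiable sf; have dgx := smooth2_differentiable sg; split.
  by apply: nearS2 df dg => y; exact: differentiableM.
apply: (near_eq_differentiable (f := fun y => f y *: grad g y + g y *: grad f y)).
  by apply: nearS2 df dg => y dfy dgy; rewrite gradM.
apply: differentiableD; apply: differentiable_scalemx => //.
Qed.

Lemma grad_comp (g : R -> R) (dg : R) f x : differentiable f x ->
  is_derive (f x) 1 g dg -> 
  differentiable (g \o f) x /\ grad (g \o f) x = dg *: grad f x.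
Proof.
move=> df [dgx dge].
have dgf : differentiable g (f x) by apply/derivable1_diffP.
have dgof := differentiable_comp df dgf.
split=> //.
apply/matrixP => i k; rewrite !mxE.
rewrite !deriveE // diff_comp //= deriv1E // derive1E dge.
by rewrite /GRing.scale /= mulrC.
Qed.

Lemma smooth2_comp (g dg : R -> R) f x : smooth2 f x ->
  (\forall r \near f x, is_derive (r : R) (1 : R) g (dg r)) -> differentiable dg (f x) ->
  smooth2 (g \o f) x.
Proof.
move=> sf dgP ddg; have [df ddf] := sf.
have sfx := smooth2_differentiable sf.
have H : \forall y \near x, is_derive (f y) 1 g (dg (f y)).
  exact: (differentiable_continuous sfx) dgP.
split.
  by apply: nearS2 df H => y dfy Hy; have [] := grad_comp dfy Hy.
apply: (near_eq_differentiable (f := fun y => (dg \o f) y *: grad f y)).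
  by apply: nearS2 df H => y dfy Hy; have [] := grad_comp dfy Hy.
by apply: differentiable_scalemx => //; apply: differentiable_comp.
Qed.

Lemma smooth2_sum (I : Type) (r : seq I) (P : pred I) (F : I -> 'M[R]_(V, 3) -> R) x :
  (forall i, P i -> smooth2 (F i) x) ->
  smooth2 (fun y => \sum_(i <- r | P i) F i y) x.
Proof.
move=> H; elim: r => [|i r IH].
  by apply: (near_eq_smooth2 (f := cst 0)); [apply: near_all => y; rewrite big_nil|exact: smooth2_cst].
have [Pi|Pi] := boolP (P i); last first.
  by apply: near_eq_smooth2 IH; apply: near_all => y; rewrite big_cons (negPf Pi).
apply: near_eq_smooth2 (smooth2D (H i Pi) IH).
by apply: near_all => y; rewrite big_cons Pi.
Qed.

Lemma grad_sum (I : Type) (r : seq I) (P : pred I) (F : I -> 'M[R]_(V, 3) -> R) x :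
  (forall i, P i -> differentiable (F i) x) ->
  grad (fun y => \sum_(i <- r | P i) F i y) x = \sum_(i <- r | P i) grad (F i) x.
Proof.
move=> H; elim: r => [|i r IH].
  rewrite big_nil -(grad_cst 0 x); apply: near_eq_grad.
  by apply: near_all => y; rewrite big_nil.
rewrite big_cons; have [Pi|Pi] := boolP (P i); last first.
  by rewrite -IH; apply: near_eq_grad; apply: near_all => y; rewrite big_cons (negPf Pi).
rewrite -IH -gradD; first last.
- exact: differentiable_big.
- exact: H.
by apply: near_eq_grad; apply: near_all => y; rewrite big_cons Pi.
Qed.

Lemma smooth2_linear (f : {linear 'M[R]_(V, 3) -> R}) x : smooth2 f x.
Proof.
have dfl y : differentiable f y by exact: differentiable_mx_linear.
rewrite /smooth2; split; first by near=> y.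
apply: (near_eq_differentiable (f := cst (\matrix_(i, k) f (delta_mx i k)))).
  apply: near_all => y; apply/matrixP => i k.
  by rewrite !mxE deriveE // diff_lin //; exact: mx_linear_continuous.
exact: differentiable_cst.
Unshelve. all: by end_near. Qed.

Lemma grad_linear (f : {linear 'M[R]_(V, 3) -> R}) x :
  grad f x = \matrix_(i, k) f (delta_mx i k).
Proof.
apply/matrixP => i k; rewrite !mxE deriveE ?diff_lin //.
- exact: mx_linear_continuous.
- exact: differentiable_mx_linear.
Qed.

End twice_differentiable_functions.

(** * Smoothstep and scalar compositions *)

Section scalar_functions.
Context {R : realType}.
Implicit Types (f g h : R -> R) (r s a : R).

Lemma is_derive1P f s d :
  is_derive s 1 f d <->
  forall e : R, 0 < e -> \forall t \near (0 : R), `|f (t + s) - f s - t * d| <= e * `|t|.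
Proof.
split=> [[df de] e e0|H].
  have {}df : differentiable f s by apply/derivable1_diffP.
  have := differentiable_near_bound df e0.
  by apply: filterS => t; rewrite deriv1E ?derive1E ?de //; apply/derivable1_diffP.
pose l (t : R) : R := t * d.
have lin : linear (l : R^o -> R^o) by move=> u v w; rewrite /l mulrDl -scalerAl.
pose L : {linear R^o -> R^o} := HB.pack l (GRing.isLinear.Build _ _ _ _ l lin).
have : is_diff (s : R^o) (f : R^o -> R^o) L.
  apply: (@near_bound_diff _ _ _ f s L) => // t.
  by apply: cvgMr_tmp; exact: cvg_id.
case=> df de.
split; first exact/derivable1_diffP.
by rewrite deriveE // de /= /l mul1r.
Qed.

(** At the junction both branches satisfy the same first-order estimate, so it holds whichever side
    [t + s] falls on. It is used at 0 and 1 for the smoothstep and again for its derivative: the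
    quintic meets the constants to second order, which makes the blend weight twice
    differentiable. *)
Lemma is_derive_piecewise g h (dg dh : R -> R) a s :
  g a = h a -> dg a = dh a ->
  is_derive s 1 g (dg s) -> is_derive s 1 h (dh s) ->
  is_derive s 1 (fun r => if r <= a then g r else h r)
    (if s <= a then dg s else dh s).
Proof.
move=> gha dgha /is_derive1P Hg /is_derive1P Hh; apply/is_derive1P => e e0.
have {}Hg := Hg e e0; have {}Hh := Hh e e0.
have [sa|sa|sa] := ltgtP s a; last subst s.
- have : \forall t \near (0 : R), t < a - s.
    by apply: lt_nbhsl; rewrite subr_gt0.
  apply: filterS2 Hg => t Hg ta.
  by rewrite ifT // ltW // -ltrBrDr.
- have : \forall t \near (0 : R), a - s < t.
    by apply: lt_nbhsr; rewrite subr_lt0.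
  apply: filterS2 Hh => t Hh ta.
  by rewrite ifF //; apply/negP; rewrite -lerBrDr => H; have := le_lt_trans H ta; rewrite ltxx.
- apply: filterS2 Hg Hh => t Hg Hh.
  by case: ifP => // _; rewrite gha dgha.
Qed.

Let p5 : {poly R} := 6 *: 'X^5 - 15 *: 'X^4 + 10 *: 'X^3.
Let p4 : {poly R} := 30 *: 'X^4 - 60 *: 'X^3 + 30 *: 'X^2.

Definition dsmoothstep s : R :=
  if s <= 0 then 0
  else if s <= 1 then 30 * s ^+ 4 - 60 * s ^+ 3 + 30 * s ^+ 2
  else 0.

Lemma smoothstep_is_derive s : is_derive s 1 (@smoothstep R) (dsmoothstep s).
Proof.
pose q r : R := 6 * r ^+ 5 - 15 * r ^+ 4 + 10 * r ^+ 3.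
pose dq r : R := 30 * r ^+ 4 - 60 * r ^+ 3 + 30 * r ^+ 2.
have dP r : is_derive r 1 q (dq r).
  have -> : q = horner p5 by apply/funext => t; rewrite /q /p5 !hornerE.
  have -> : dq r = p5^`().[r] by rewrite /p5 /dq !poly.derivE !hornerE /=; ring.
  exact: is_derive_poly.
have d1 r : is_derive r 1 (fun t => if t <= 1 then q t else 1) (if r <= 1 then dq r else 0).
  apply: (@is_derive_piecewise q (cst 1) dq (cst 0)) => //.
  - by rewrite /q /cst; ring.
  - by rewrite /dq /cst; ring.
apply: (@is_derive_piecewise (cst 0) (fun t => if t <= 1 then q t else 1) (cst 0)
  (fun t => if t <= 1 then dq t else 0)) => //.
- by rewrite ler01 /q /cst; ring.
- by rewrite ler01 /dq /cst; ring.
Qed.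

Lemma differentiable_dsmoothstep s : differentiable dsmoothstep s.
Proof.
pose q r : R := 30 * r ^+ 4 - 60 * r ^+ 3 + 30 * r ^+ 2.
pose dq r : R := 120 * r ^+ 3 - 180 * r ^+ 2 + 60 * r.
have dP r : is_derive r 1 q (dq r).
  have -> : q = horner p4 by apply/funext => t; rewrite /q /p4 !hornerE.
  have -> : dq r = p4^`().[r] by rewrite /p4 /dq !poly.derivE !hornerE /=; ring.
  exact: is_derive_poly.
have d1 r : is_derive r 1 (fun t => if t <= 1 then q t else 0) (if r <= 1 then dq r else 0).
  apply: (@is_derive_piecewise q (cst 0) dq (cst 0)) => //.
  - by rewrite /q /cst; ring.
  - by rewrite /dq /cst; ring.
suff [] : is_derive s 1 dsmoothstep (if s <= 0 then 0 else if s <= 1 then dq s else 0).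
  by move=> /derivable1_diffP.
apply: (@is_derive_piecewise (cst 0) (fun t => if t <= 1 then q t else 0) (cst 0)
  (fun t => if t <= 1 then dq t else 0)) => //.
- by rewrite ler01 /q /cst; ring.
- by rewrite ler01 /dq /cst; ring.
Qed.

Lemma smoothstep_le0 s : s <= 0 -> smoothstep s = 0.
Proof. by rewrite /smoothstep => ->. Qed.

Lemma dsmoothstep_ge0 s : 0 <= dsmoothstep s.
Proof.
rewrite /dsmoothstep; case: ifP => // _; case: ifP => // _.
have -> : 30 * s ^+ 4 - 60 * s ^+ 3 + 30 * s ^+ 2 = 30 * (s * (1 - s)) ^+ 2 by ring.
by rewrite mulr_ge0 // sqr_ge0.
Qed.

Lemma smoothstep_ge0 s : 0 <= smoothstep s.
Proof.
rewrite /smoothstep; case: (leP s 0) => // s0; case: (leP s 1) => // s1.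
have -> : 6 * s ^+ 5 - 15 * s ^+ 4 + 10 * s ^+ 3 = s ^+ 3 * (6 * s ^+ 2 - 15 * s + 10) by ring.
by apply: mulr_ge0; [rewrite exprn_ge0 // ltW|nra].
Qed.

Lemma smoothstep_le1 s : smoothstep s <= 1.
Proof.
rewrite /smoothstep; case: (leP s 0) => // s0; case: (leP s 1) => // s1.
rewrite -subr_ge0.
have -> : 1 - (6 * s ^+ 5 - 15 * s ^+ 4 + 10 * s ^+ 3) = (1 - s) ^+ 3 * (6 * s ^+ 2 + 3 * s + 1) by ring.
by apply: mulr_ge0; [rewrite exprn_ge0 // subr_ge0|nra].
Qed.

Lemma smoothstep_smooth2 (V : nat) (f : 'M[R]_(V, 3) -> R) x :
  smooth2 f x -> smooth2 (@smoothstep R \o f) x.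
Proof.
move=> fx; apply: (@smooth2_comp _ _ _ dsmoothstep) => //.
- by apply: near_all => r; exact: smoothstep_is_derive.
- exact: differentiable_dsmoothstep.
Qed.

Lemma sqrt_smooth2 (V : nat) (f : 'M[R]_(V, 3) -> R) x :
  smooth2 f x -> 0 < f x -> smooth2 (Num.sqrt \o f) x.
Proof.
move=> fx fx0; apply: (@smooth2_comp _ _ _ (fun r => (2 * Num.sqrt r)^-1)) => //.
- by have := lt_nbhsr fx0; apply: filterS => r; exact: is_derive1_sqrt.
- apply: differentiableV; last by rewrite mulf_neq0 // gt_eqF // sqrtr_gt0.
  apply: differentiableM => //; apply/derivable1_diffP.
  by have [] := is_derive1_sqrt fx0.
Qed.

Lemma inv_smooth2 (V : nat) (f : 'M[R]_(V, 3) -> R) x :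
  smooth2 f x -> f x != 0 -> smooth2 (fun y => (f y)^-1) x.
Proof.
move=> fx fx0; apply: (@smooth2_comp _ _ GRing.inv (fun r => - r ^- 2)) => //.
- have : \forall r \near f x, r != 0 :> R by exact: cvgr_neq0 (@cvg_id _ _) fx0.
  apply: filterS => r r0; have := @is_deriveV _ id r 1 1 r0 (is_derive_id _ _).
  by rewrite /GRing.scale/= mulr1.
- apply: differentiableN; apply: differentiableV; last by rewrite expf_neq0.
  exact: (@differentiableM _ _ id id).
Qed.

End scalar_functions.

(** * Euclidean geometry and convex hulls *)

Section dot_product.
Context {R : realType}.
Implicit Types (u v w : 'rV[R]_3) (a : R).

Lemma dotE u v : dot u v = u 0 0 * v 0 0 + u 0 1 * v 0 1 + u 0 2 * v 0 2.
Proof.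
rewrite /dot !big_ord_recl big_ord0 addr0 addrA.
by congr (_ * _ + _ * _ + _ * _); congr (_ _ _); apply: val_inj.
Qed.

Lemma dotC u v : dot u v = dot v u.
Proof. by apply: eq_bigr => k _; rewrite mulrC. Qed.

Lemma dotDl u v w : dot (u + v) w = dot u w + dot v w.
Proof. by rewrite -big_split; apply: eq_bigr => k _; rewrite mxE mulrDl. Qed.

Lemma dotDr u v w : dot w (u + v) = dot w u + dot w v.
Proof. by rewrite dotC dotDl ![dot _ w]dotC. Qed.

Lemma dotZl a u w : dot (a *: u) w = a * dot u w.
Proof. by rewrite mulr_sumr; apply: eq_bigr => k _; rewrite mxE mulrA. Qed.

Lemma dotZr a u w : dot w (a *: u) = a * dot w u.
Proof. by rewrite dotC dotZl dotC. Qed.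

Lemma dotNl u w : dot (- u) w = - dot u w.
Proof. by rewrite -scaleN1r dotZl mulN1r. Qed.

Lemma dotNr u w : dot w (- u) = - dot w u.
Proof. by rewrite dotC dotNl dotC. Qed.

Lemma dotBl u v w : dot (u - v) w = dot u w - dot v w.
Proof. by rewrite dotDl dotNl. Qed.

Lemma dotBr u v w : dot w (u - v) = dot w u - dot w v.
Proof. by rewrite dotDr dotNr. Qed.

Lemma dot0l u : dot 0 u = 0.
Proof. by rewrite -(scale0r u) dotZl mul0r. Qed.

Lemma dot0r u : dot u 0 = 0.
Proof. by rewrite dotC dot0l. Qed.

Lemma dot_suml (I : Type) (r : seq I) (P : pred I) (F : I -> 'rV[R]_3) w :
  dot (\sum_(i <- r | P i) F i) w = \sum_(i <- r | P i) dot (F i) w.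
Proof. by elim/big_rec2: _ => [|i y z _ <-]; rewrite ?dot0l ?dotDl. Qed.

Lemma dot_ge0 u : 0 <= dot u u.
Proof. by apply: sumr_ge0 => k _; rewrite -expr2 sqr_ge0. Qed.

Lemma dot_eq0 u : (dot u u == 0) = (u == 0).
Proof.
apply/eqP/eqP => [u0|->]; last exact: dot0l.
apply/rowP => k; rewrite mxE; apply/eqP; rewrite -sqrf_eq0 expr2; apply/eqP.
by apply: (psumr_eq0P _ u0) => // i _; rewrite -expr2 sqr_ge0.
Qed.

Lemma enorm_ge0 u : 0 <= enorm u.
Proof. exact: sqrtr_ge0. Qed.

Lemma sqr_enorm u : enorm u ^+ 2 = dot u u.
Proof. by rewrite sqr_sqrtr // dot_ge0. Qed.

Lemma enorm_eq0 u : (enorm u == 0) = (u == 0).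
Proof. by rewrite -dot_eq0 -sqr_enorm sqrf_eq0. Qed.

Lemma enorm_gt0 u : (0 < enorm u) = (u != 0).
Proof. by rewrite lt0r enorm_eq0 enorm_ge0 andbT. Qed.

Lemma enorm0 : enorm (0 : 'rV[R]_3) = 0.
Proof. by apply/eqP; rewrite enorm_eq0. Qed.

Lemma enormN u : enorm (- u) = enorm u.
Proof. by rewrite /enorm dotNl dotNr opprK. Qed.

Lemma enormB u v : enorm (u - v) = enorm (v - u).
Proof. by rewrite -enormN opprB. Qed.

Lemma enormZ a u : enorm (a *: u) = `|a| * enorm u.
Proof. by rewrite /enorm dotZl dotZr mulrA -expr2 sqrtrM ?sqr_ge0 // sqrtr_sqr. Qed.

Lemma cauchy_schwarz u v : dot u v <= enorm u * enorm v.
Proof.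
have [uv|uv] := leP (dot u v) 0.
  by apply: le_trans uv _; rewrite mulr_ge0 ?enorm_ge0.
rewrite -(@ler_pXn2r _ 2) ?nnegrE ?mulr_ge0 ?enorm_ge0 ?(ltW uv) //.
rewrite exprMn !sqr_enorm !dotE -subr_ge0.
set a := u 0 0; set b := u 0 1; set c := u 0 2.
set x := v 0 0; set y := v 0 1; set z := v 0 2.
(* Lagrange's identity: the defect is the squared norm of the cross product. *)
have -> : (a * a + b * b + c * c) * (x * x + y * y + z * z) - (a * x + b * y + c * z) ^+ 2
  = (a * y - b * x) ^+ 2 + (a * z - c * x) ^+ 2 + (b * z - c * y) ^+ 2 by ring.
by rewrite !addr_ge0 // sqr_ge0.
Qed.

Lemma cauchy_schwarz_abs u v : `|dot u v| <= enorm u * enorm v.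
Proof.
rewrite ler_norml cauchy_schwarz andbT lerNl -dotNl -(enormN u).
exact: cauchy_schwarz.
Qed.

Lemma enormD u v : enorm (u + v) <= enorm u + enorm v.
Proof.
rewrite -(@ler_pXn2r _ 2) ?nnegrE ?addr_ge0 ?enorm_ge0 //.
rewrite sqr_enorm sqrrD !sqr_enorm dotDl !dotDr (dotC v u).
have := cauchy_schwarz u v; lra.
Qed.

Lemma enorm_triangle u v w : enorm (u - w) <= enorm (u - v) + enorm (v - w).
Proof. by rewrite -[u - w](subrKA v) enormD. Qed.

Lemma coord_le_enorm u k : `|u 0 k| <= enorm u.
Proof.
rewrite -(@ler_pXn2r _ 2) ?nnegrE ?enorm_ge0 // sqr_enorm real_normK ?num_real //.
rewrite /dot (bigD1 k) //= expr2 lerDl sumr_ge0 // => i _.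
by rewrite -expr2 sqr_ge0.
Qed.

Lemma dot_continuous (T : topologicalType) (f g : T -> 'rV[R]_3) x :
  {for x, continuous f} -> {for x, continuous g} ->
  {for x, continuous (fun y => dot (f y) (g y))}.
Proof.
move=> fc gc.
have H (h : T -> 'rV[R]_3) (k : 'I_3) : {for x, continuous h} -> (h y 0 k) @[y --> x] --> h x 0 k.
  move=> hc; exact: (@continuous_comp _ _ _ h (fun A : 'rV[R]_3 => A 0 k) x hc (@coord_continuous _ _ _ _ _ _)).
rewrite /prop_for /continuous_at dotE; under eq_fun do rewrite dotE.
by apply: cvgD; [apply: cvgD|]; apply: cvgM; exact: H.
Qed.

Lemma enorm_continuous : continuous (@enorm R).
Proof.
move=> u; apply: continuous_comp; last exact: sqrt_continuous.
by apply: dot_continuous => //; exact: cvg_id.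
Qed.

End dot_product.

(** * Convex sets and separation by a plane *)

Section convexity.
Context {R : realType}.
Implicit Types (K : set 'rV[R]_3).

Lemma convex_setP K : convex_set K <->
  forall x y (t : R), K x -> K y -> 0 <= t -> t <= 1 -> K (t *: x + (1 - t) *: y).
Proof.
split=> [cK x y t Kx Ky t0 t1|H x y t].
  have := cK x y (Itv01 t0 t1); rewrite !inE; exact.
by rewrite !inE => Kx Ky; apply: H.
Qed.

Lemma has_sumr_gt0 (I : Type) (r : seq I) (P : pred I) (a : I -> R) :
  (forall i, P i -> 0 < a i) -> has P r -> 0 < \sum_(i <- r | P i) a i.
Proof.
move=> a0; elim: r => // i r IH; rewrite /= big_cons.
have [Pi _|_ /=] := boolP (P i); last exact: IH.
by rewrite ltr_wpDr ?a0 //; apply: sumr_ge0 => j Pj; rewrite ltW ?a0.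
Qed.

Lemma weighted_mean_in (I : Type) (r : seq I) (P : pred I) (a : I -> R) (p : I -> 'rV[R]_3) K :
  convex_set K -> (forall i, P i -> 0 < a i) -> (forall i, P i -> K (p i)) ->
  has P r ->
  K ((\sum_(i <- r | P i) a i)^-1 *: \sum_(i <- r | P i) a i *: p i).
Proof.
move=> /convex_setP cK a0 Kp; elim: r => // i r IH /=.
rewrite !big_cons; have [Pi _|Pi /=] := boolP (P i); last exact: IH.
have [Pr|Nr] := boolP (has P r); last first.
  rewrite !big_hasC // !addr0 scalerA mulVf ?scale1r ?gt_eqF ?a0 //.
  exact: Kp.
have Kr := IH Pr.
have S0 := has_sumr_gt0 a0 Pr; have ai := a0 _ Pi.
set S := \sum_(j <- r | P j) a j in Kr S0 *; set T := \sum_(j <- r | P j) _ in Kr *.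
(* The head is weighed against the normalised mean of the tail, so that two-point convexity
   suffices. *)
have := cK _ _ (a i / (a i + S)) (Kp _ Pi) Kr.
have aS : a i + S != 0 by rewrite gt_eqF ?addr_gt0.
have -> : a i / (a i + S) *: p i + (1 - a i / (a i + S)) *: (S^-1 *: T) =
   (a i + S)^-1 *: (a i *: p i + T).
  rewrite scalerDr !scalerA [a i / _]mulrC; congr (_ + _ *: _).
  have S0' : S != 0 by rewrite gt_eqF.
  by field; rewrite aS S0'.
apply; first by rewrite divr_ge0 ?addr_ge0 // ltW.
by rewrite ler_pdivrMr ?addr_gt0 // mul1r lerDl ltW.
Qed.

Lemma segment_dist2 (a b c : 'rV[R]_3) t :
  dot (t *: c + (1 - t) *: a - b) (t *: c + (1 - t) *: a - b) =
  dot (a - b) (a - b) + 2 * t * dot (c - a) (a - b) + t ^+ 2 * dot (c - a) (c - a).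
Proof.
have -> : t *: c + (1 - t) *: a - b = (a - b) + t *: (c - a).
  by apply/rowP => k; rewrite !mxE; ring.
move: (a - b) (c - a) => u v; rewrite dotDl !dotDr !dotZl !dotZr (dotC u v); ring.
Qed.

Lemma min_dist_dot (a b c : 'rV[R]_3) K : convex_set K -> K a -> K c ->
  (forall d, K d -> dot (a - b) (a - b) <= dot (d - b) (d - b)) ->
  0 <= dot (c - a) (a - b).
Proof.
move=> /convex_setP cK Ka Kc mina; rewrite leNgt; apply/negP => neg.
set p := dot (c - a) (a - b) in neg.
set q := dot (c - a) (c - a).
have q0 : 0 <= q by exact: dot_ge0.
(* Along the segment the squared distance changes by [2 * t * p + t ^+ 2 * q]. The optimal [- p / q]
   may exceed 1; the enlarged denominator keeps [t] in the unit interval and still gives the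
   negative value [t * p * (1 + t)]. *)
pose t := - p / (q - p).
have qp : 0 < q - p by lra.
have t0 : 0 < t by rewrite divr_gt0 // oppr_gt0.
have t1 : t <= 1 by rewrite ler_pdivrMr // mul1r; lra.
have tE : t * (q - p) = - p by rewrite mulrVK // unitfE gt_eqF.
have := mina _ (cK _ _ _ Kc Ka (ltW t0) t1).
rewrite segment_dist2 -/p -/q => H.
nra.
Qed.

(** A closest pair [a], [b] exists by compactness of the product. Each point is closest to the other
    within its own set, so the sets lie beyond the two planes through [a] and [b] orthogonal to
    [a - b]. *)
Lemma closed_convex_separation K L :
  closed K -> convex_set K -> bounded_set K -> K !=set0 ->
  closed L -> convex_set L -> bounded_set L -> L !=set0 ->
  K `&` L = set0 ->
  exists (n : 'rV[R]_3) (d : R), (forall x, K x -> 0 < dot x n + d) /\ (forall y, L y -> dot y n + d < 0).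
Proof.
move=> Kcl Kc Kb [k0 Kk0] Lcl Lc Lb [l0 Ll0] KL.
have KLc : compact (K `*` L) by apply: compact_setX; exact: bounded_closed_compact.
pose f (p : 'rV[R]_3 * 'rV[R]_3) := dot (p.1 - p.2) (p.1 - p.2).
have fc : {within K `*` L, continuous f}.
  apply: continuous_subspaceT => p.
  have pc : {for p, continuous (fun q : 'rV[R]_3 * 'rV[R]_3 => q.1 - q.2)}.
    by apply: cvgB; [exact: cvg_fst|exact: cvg_snd].
  exact: (dot_continuous pc pc).
have [|[a b] + fmin] := compact_EVT_min _ KLc fc; first by exists (k0, l0).
rewrite inE => -[/= Ka Lb'].
have ab : a - b != 0.
  rewrite subr_eq0; apply/eqP => ab; have : (K `&` L) a by split => //; rewrite ab.
  by rewrite KL.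
have w0 : 0 < dot (a - b) (a - b) by rewrite lt0r dot_eq0 ab dot_ge0.
have HK x : K x -> 0 <= dot (x - a) (a - b).
  move=> Kx; apply: (min_dist_dot Kc) => // d Kd.
  by have := fmin (d, b); rewrite inE; apply.
have HL y : L y -> dot (y - b) (a - b) <= 0.
  move=> Ly; rewrite -oppr_ge0 -dotNr opprB; apply: (min_dist_dot Lc) => // d Ld.
  have := fmin (a, d); rewrite inE /f /= => /(_ (conj Ka Ld)).
  by rewrite -(opprB a d) -(opprB a b) !dotNl !dotNr !opprK.
(* The plane through the midpoint of [a] and [b], orthogonal to [a - b]. *)
exists (a - b), (- (dot (a + b) (a - b)) / 2); split=> [x /HK|y /HL];
  rewrite dotBl dotDl; move: w0; rewrite dotBl; lra.
Qed.

Lemma enorm_le_bounded K (c : R) : (forall x, K x -> enorm x <= c) -> bounded_set K.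
Proof.
move=> H; exists c; split; first exact: num_real.
move=> M cM x /H xc.
rewrite /= [leLHS]/Num.Def.normr /= mx_normrE; apply: bigmax_le.
  by apply: le_trans (ltW cM); exact: le_trans (enorm_ge0 x) xc.
move=> [i k] _ /=; rewrite ord1; apply: le_trans (coord_le_enorm _ _) _.
by apply: le_trans xc (ltW cM).
Qed.

Lemma closed_eball_closed (c : 'rV[R]_3) r : closed (closed_eball c r).
Proof.
apply: (@closed_comp _ _ (fun p : 'rV[R]_3 => enorm (p - c)) [set t | t <= r]); last exact: closed_le.
move=> p _; have pc : {for p, continuous (fun q : 'rV[R]_3 => q - c)}.
  by apply: (@continuousB _ _ _ id (cst c)); [exact: (@cvg_id _ (nbhs p))|exact: cst_continuous].
exact: (@continuous_comp _ _ _ _ (@enorm R) p pc (@enorm_continuous _ _)).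
Qed.

Lemma closed_eball_convex (c : 'rV[R]_3) r : convex_set (closed_eball c r).
Proof.
apply/convex_setP => x y t xr yr t0 t1; rewrite /closed_eball /=.
have -> : t *: x + (1 - t) *: y - c = t *: (x - c) + (1 - t) *: (y - c).
  by apply/rowP => k; rewrite !mxE; ring.
apply: le_trans (enormD _ _) _; rewrite !enormZ !ger0_norm ?subr_ge0 //.
have -> : r = t * r + (1 - t) * r by ring.
by apply: lerD; apply: ler_wpM2l => //; rewrite subr_ge0.
Qed.

Lemma halfspace_closed (n : 'rV[R]_3) m : closed [set p | m <= dot p n].
Proof.
apply: (@closed_comp _ _ (fun p : 'rV[R]_3 => dot p n) [set t | m <= t]); last exact: closed_ge.
by move=> p _; apply: (@dot_continuous _ _ id (cst n)); [exact: (@cvg_id _ (nbhs p))|exact: cst_continuous].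
Qed.

Lemma halfspace_convex (n : 'rV[R]_3) m : convex_set [set p | m <= dot p n].
Proof.
apply/convex_setP => x y t /= xr yr t0 t1.
rewrite dotDl !dotZl; have : 0 <= 1 - t by lra.
by move=> t2; nra.
Qed.

End convexity.

(** * Hulls of vertices and enclosing balls *)

Section hulls.
Context {R : realType} {V : nat}.
Implicit Types (x : 'M[R]_(V, 3)) (I J : {set 'I_V}) (n p : 'rV[R]_3).

Lemma CH_sub x I (K : set 'rV[R]_3) : closed K -> convex_set K ->
  (forall i, i \in I -> K (row i x)) -> CH x I `<=` K.
Proof. by move=> Kcl Kc H; apply: smallest_sub => // _ [i /= iI <-]; exact: H. Qed.

Lemma CH_row x I i : i \in I -> CH x I (row i x).
Proof. by move=> iI; apply: sub_gen_smallest; exists i. Qed.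

Lemma CH_closed x I : closed (CH x I).
Proof. by apply: closed_bigI => K [[Kcl _] _]. Qed.

Lemma CH_convex x I : convex_set (CH x I).
Proof.
apply/convex_setP => a b t aI bI t0 t1 K [[Kcl Kc] KI].
by apply: ((convex_setP K).1 Kc) => //; [apply: aI|apply: bI].
Qed.

Lemma CH_mono x I J : I \subset J -> CH x I `<=` CH x J.
Proof.
move=> /fintype.subsetP IJ; apply: CH_sub; [exact: CH_closed|exact: CH_convex|].
by move=> i /IJ; exact: CH_row.
Qed.

Lemma has_in_set I : I != finset.set0 -> has (mem I) (index_enum 'I_V).
Proof. by case/finset.set0Pn => i iI; apply/hasP; exists i => //; exact: mem_index_enum. Qed.

Lemma CH_mean x I (a : 'I_V -> R) : I != finset.set0 -> (forall i, i \in I -> 0 < a i) ->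
  CH x I ((\sum_(i in I) a i)^-1 *: \sum_(i in I) a i *: row i x).
Proof.
move=> I0 a0; apply: weighted_mean_in => //.
- exact: CH_convex.
- by move=> i iI; exact: CH_row.
- exact: has_in_set.
Qed.

Lemma centroid_CH x I : I != finset.set0 -> CH x I (centroid x I).
Proof.
move=> I0; have := @CH_mean x I (fun=> 1) I0 (fun _ _ => ltr01).
by rewrite sumr_const (eq_bigr _ (fun i _ => scale1r _)).
Qed.

Lemma CH_eball x I c r : (forall i, i \in I -> enorm (row i x - c) <= r) ->
  CH x I `<=` closed_eball c r.
Proof.
by move=> H; apply: CH_sub; [exact: closed_eball_closed|exact: closed_eball_convex|].
Qed.

Lemma CH_bounded x I : bounded_set (CH x I).
Proof.
apply: (@enorm_le_bounded _ _ (\sum_(i in I) enorm (row i x))) => p.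
have /CH_eball H : forall i, i \in I -> enorm (row i x - 0) <= \sum_(i in I) enorm (row i x).
  move=> i iI; rewrite subr0 (bigD1 i) //= lerDl sumr_ge0 // => j _.
  exact: enorm_ge0.
by move=> /H; rewrite /closed_eball /= subr0.
Qed.

(** The half-space that ends at the farthest vertex in direction [n] is closed, convex and contains
    all vertices, hence the hull. This brings points of the hull back to vertices without writing
    them as convex combinations. *)
Lemma CH_support x I n p : CH x I p ->
  exists2 i, i \in I & dot p n <= dot (row i x) n.
Proof.
move=> pI; have [I0|[i0 i0I]] := set_0Vmem I.
  have : CH x I `<=` set0.
    apply: CH_sub; [exact: closed0| |by move=> i; rewrite I0 inE].
    by apply/convex_setP.
  by move=> /(_ p pI).
have [i iI imax] := @Order.TotalTheory.arg_maxP _ _ _ i0 (mem I) (fun i => dot (row i x) n) i0I.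
exists i => //.
have : CH x I `<=` [set q | - dot (row i x) n <= dot q (- n)].
  apply: CH_sub; [exact: halfspace_closed|exact: halfspace_convex|].
  by move=> j jI /=; rewrite dotNr lerN2; exact: imax.
by move=> /(_ p pI) /=; rewrite dotNr lerN2.
Qed.

Lemma CH_separation x I J : I != finset.set0 -> J != finset.set0 ->
  CH x I `&` CH x J = set0 ->
  exists (n : 'rV[R]_3) (d : R), (forall i, i \in I -> 0 < dot (row i x) n + d) /\
    (forall j, j \in J -> dot (row j x) n + d < 0).
Proof.
move=> /finset.set0Pn[i iI] /finset.set0Pn[j jJ] IJ.
have [n [d [HI HJ]]] := closed_convex_separation (@CH_closed x I) (@CH_convex x I) (@CH_bounded x I)
  (ex_intro _ _ (CH_row iI)) (@CH_closed x J) (@CH_convex x J) (@CH_bounded x J)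
  (ex_intro _ _ (CH_row jJ)) IJ.
by exists n, d; split=> k kI; [apply: HI|apply: HJ]; exact: CH_row.
Qed.

Lemma separated_CH x I J n (d : R) :
  (forall i, i \in I -> 0 < dot (row i x) n + d) ->
  (forall j, j \in J -> dot (row j x) n + d < 0) ->
  CH x I `&` CH x J = set0.
Proof.
move=> HI HJ; apply/seteqP; split=> // p [pI pJ].
have [i /HI + Hi] := CH_support (- n) pI; have [j /HJ + Hj] := CH_support n pJ.
by rewrite !dotNr in Hi; move: Hi Hj; lra.
Qed.

Lemma far_balls_CH x I J c c' (r r' : R) :
  (forall i, i \in I -> enorm (row i x - c) <= r) ->
  (forall j, j \in J -> enorm (row j x - c') <= r') ->
  r + r' < enorm (c - c') -> CH x I `&` CH x J = set0.
Proof.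
move=> /CH_eball HI /CH_eball HJ far; apply/seteqP; split=> // p [/HI pc /HJ pc'].
have := enorm_triangle c p c'; rewrite (enormB c p).
by rewrite /closed_eball /= in pc pc'; lra.
Qed.

(** Equality case of Cauchy-Schwarz: the squared norm of q - c - (r / |u|) u expands to a
    nonpositive quantity. *)
Lemma ball_extremal (c u q : 'rV[R]_3) (r : R) : 0 < enorm u -> 0 <= r ->
  enorm (q - c) <= r -> r * enorm u <= dot (q - c) u ->
  q = c + (r / enorm u) *: u.
Proof.
move=> u0 r0 qr qu; set v := q - c in qr qu *.
suff : v - (r / enorm u) *: u == 0.
  by rewrite subr_eq0 => /eqP <-; rewrite /v addrC subrK.
move: v qr qu => v qr qu; rewrite -dot_eq0 eq_le dot_ge0 andbT.
rewrite dotBl !dotBr !dotZl !dotZr -!sqr_enorm (dotC u v).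
have -> : enorm v ^+ 2 - r / enorm u * dot v u -
    (r / enorm u * dot v u - r / enorm u * (r / enorm u * enorm u ^+ 2)) =
    enorm v ^+ 2 + r ^+ 2 - 2 * (r / enorm u * dot v u).
  by field; rewrite gt_eqF.
have h1 : r ^+ 2 <= r / enorm u * dot v u.
  by rewrite expr2 -mulrA ler_wpM2l // ler_pdivlMl // mulrC.
have h2 : enorm v ^+ 2 <= r ^+ 2 by rewrite ler_pXn2r // nnegrE ?enorm_ge0.
lra.
Qed.

(** A point of both balls is the contact point, extreme in each ball towards the other center.
    [CH_support] gives in each set a vertex at least as far in that direction, and by
    [ball_extremal] this vertex is the contact point itself. *)
Lemma touching_balls_CH x I J c c' (r r' : R) : 0 <= r -> 0 <= r' -> 0 < r + r' ->
  (forall i, i \in I -> enorm (row i x - c) <= r) ->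
  (forall j, j \in J -> enorm (row j x - c') <= r') ->
  enorm (c - c') = r + r' -> CH x I `&` CH x J !=set0 ->
  exists i j, [/\ i \in I, j \in J & row i x = row j x].
Proof.
move=> r0 r0' rr HI HJ dist [p [pI pJ]].
set u := c' - c.
have du : enorm u = r + r' by rewrite enormB.
have du2 : dot u u = (r + r') ^+ 2 by rewrite -sqr_enorm du.
have u0 : 0 < enorm u by rewrite du.
have [/CH_eball HI' /CH_eball HJ'] := conj HI HJ.
have pc := HI' _ pI; have pc' := HJ' _ pJ; rewrite /closed_eball /= in pc pc'.
have cs1 := cauchy_schwarz (p - c) u; have cs2 := cauchy_schwarz (- (p - c')) u.
rewrite enormN in cs2.
have e1 : dot (p - c) u = dot (p - c') u + dot u u.
  by rewrite -dotDl /u addrA subrK.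
have [i iI Hi] := CH_support u pI; have [j jJ Hj] := CH_support (- u) pJ.
exists i, j; split=> //.
have cs3 : dot (p - c) u <= r * (r + r').
  by apply: le_trans cs1 _; rewrite du ler_wpM2r // ltW.
have cs4 : - dot (p - c') u <= r' * (r + r').
  by rewrite -dotNl; apply: le_trans cs2 _; rewrite du ler_wpM2r // ltW.
rewrite (@ball_extremal c u (row i x) r u0 r0 (HI _ iI)); last first.
  apply: (@le_trans _ _ (dot (p - c) u)); last by rewrite !dotBl lerD2r.
  by rewrite e1 du2 du; lra.
rewrite (@ball_extremal c' (- u) (row j x) r' _ r0' (HJ _ jJ)) ?enormN //; last first.
  apply: (@le_trans _ _ (dot (p - c') (- u))); last by rewrite !dotBl lerD2r.
  by rewrite dotNr; move: e1; rewrite du2 du; lra.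
apply/rowP => k; rewrite !mxE du.
have : r + r' != 0 by rewrite gt_eqF.
by move=> ?; field.
Qed.

End hulls.

(** * Centered potentials and force cones *)

Section center_distance.
Context {R : realType} {V : nat}.
Implicit Types (x : 'M[R]_(V, 3)) (I J : {set 'I_V}).

(** Coefficient of vertex [i] in the difference of the centroids. For disjoint sets it is positive
    on [I] and negative on [J], which gives the two bodies opposite pushes. *)
Definition center_weight I J (i : 'I_V) : R :=
  #|I|%:R^-1 * (i \in I)%:R - #|J|%:R^-1 * (i \in J)%:R.

Lemma center_coordE I J x k :
  (centroid x I - centroid x J) 0 k = \sum_i center_weight I J i * x i k.
Proof.
rewrite !mxE !summxE !mulr_sumr [X in X - _]big_mkcond [X in _ - X]big_mkcond /=.
rewrite -sumrB; apply: eq_bigr => i _; rewrite /center_weight mulrBl !mxE.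
by congr (_ - _); case: ifP => _; rewrite ?mulr1 ?mulr0 ?mul0r.
Qed.

Let coord I J k x : R := (centroid x I - centroid x J) 0 k.

Let coord_linear I J k : linear (coord I J k : _ -> R^o).
Proof.
move=> a u v; rewrite /coord !center_coordE scaler_sumr -big_split.
by apply: eq_bigr => i _; rewrite !mxE /GRing.scale /=; ring.
Qed.

Let coordL I J k : {linear 'M[R]_(V, 3) -> R^o} :=
  HB.pack (coord I J k) (GRing.isLinear.Build _ _ _ _ (coord I J k) (coord_linear I J k)).

Let grad_coord I J k x i l :
  grad (coord I J k) x i l = center_weight I J i * (k == l)%:R.
Proof.
have -> : grad (coord I J k) x = \matrix_(i, l) coord I J k (delta_mx i l).
  exact: (@grad_linear _ _ (coordL I J k)).
rewrite mxE /coord center_coordE (bigD1 i) //= big1 => [|j ji].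
  by rewrite mxE eqxx addr0.
by rewrite mxE (negPf ji) mulr0.
Qed.

Let coord_smooth2 I J k x : smooth2 (coord I J k) x.
Proof. exact: (@smooth2_linear _ _ (coordL I J k)). Qed.

Let center_dist2 I J x := \sum_k coord I J k x * coord I J k x.

Let center_distE I J x : center_dist x I J = Num.sqrt (center_dist2 I J x).
Proof. by []. Qed.

Lemma center_dist_smooth2 I J x : center_dist x I J != 0 ->
  smooth2 (fun y => center_dist y I J) x.
Proof.
move=> D0; apply: (@sqrt_smooth2 _ _ (center_dist2 I J)).
  by apply: smooth2_sum => k _; apply: smooth2M; exact: coord_smooth2.
by rewrite -sqrtr_gt0 -center_distE lt0r D0 sqrtr_ge0.
Qed.

Lemma grad_center_dist I J x i : center_dist x I J != 0 ->
  row i (grad (fun y => center_dist y I J) x) =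
  (center_weight I J i / center_dist x I J) *: (centroid x I - centroid x J).
Proof.
move=> D0.
have d2 : 0 < center_dist2 I J x.
  by rewrite -sqrtr_gt0 -center_distE lt0r D0 sqrtr_ge0.
have df k : differentiable (fun y => coord I J k y * coord I J k y) x.
  exact/smooth2_differentiable/smooth2M.
have [_ ->] := @grad_comp _ _ Num.sqrt _ (center_dist2 I J) x
  (differentiable_big _ (fun k _ => df k)) (is_derive1_sqrt d2).
rewrite (grad_sum _ (fun k _ => df k)).
have E k l : grad (fun y => coord I J k y * coord I J k y) x i l =
    2 * coord I J k x * (center_weight I J i * (k == l)%:R).
  rewrite gradM; [|exact/smooth2_differentiable/coord_smooth2..].
  by rewrite mxE ![(_ *: grad _ _) _ _]mxE grad_coord; ring.
apply/rowP => l; rewrite mxE [LHS]mxE summxE (bigD1 l) //= big1 => [|k kl]; last first.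
  by rewrite E (negPf kl) !mulr0.
rewrite E eqxx -center_distE.
rewrite [RHS]mxE -/(coord I J l x) /=.
by field.
Qed.

Lemma center_dist_ge0 x I J : 0 <= center_dist x I J.
Proof. exact: enorm_ge0. Qed.

Lemma center_dist_continuous I J : continuous (fun y : 'M[R]_(V, 3) => center_dist y I J).
Proof.
move=> x.
have c2 : {for x, continuous (center_dist2 I J)}.
  by apply/smooth2_continuous/smooth2_sum => k _; apply: smooth2M; exact: coord_smooth2.
exact: (@continuous_comp _ _ _ _ Num.sqrt x c2 (@sqrt_continuous _ _)).
Qed.

Definition centered_profile (r : R) : R := 12 * (1 + (Num.sqrt r)^-1) ^+ 2.

Lemma centered_potentialE I J x : 0 < center_dist x I J ->
  centered_potential I J x = (centered_profile (center_dist x I J))%:E.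
Proof. by move=> D0; rewrite /centered_potential /inv_pos sqrtr_gt0 D0. Qed.

Lemma centered_potential_pinfty I J x : center_dist x I J = 0 ->
  centered_potential I J x = +oo%E.
Proof.
move=> D0; rewrite /centered_potential D0 /inv_pos sqrtr0 ltxx.
by rewrite addey // expe2 mulyy mulry gtr0_sg // mul1e.
Qed.

Definition centered_profile_derive (r : R) : R :=
  - 12 * ((1 + (Num.sqrt r)^-1) * (Num.sqrt r)^-1 ^+ 3).

Lemma is_derive_centered_profile (r : R) : 0 < r ->
  is_derive r 1 centered_profile (centered_profile_derive r).
Proof.
move=> r0; have sr := is_derive1_sqrt r0.
have q0 : Num.sqrt r != 0 by rewrite gt_eqF // sqrtr_gt0.
have iv := is_deriveV q0 sr.
have d1 := is_deriveD (is_derive_cst (1 : R) r 1) iv.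
have d2 := is_deriveZ 12 (is_deriveX 2 d1).
have -> : centered_profile = 12 *: ((cst 1 + (fun y => (Num.sqrt y)^-1)) ^+ 2).
  by apply/funext => y; rewrite !fctE.
apply: (is_derive_eq d2).
rewrite /centered_profile_derive !fctE /GRing.scale /= expr1.
by field.
Qed.

Lemma centered_profile_derive_lt0 (r : R) : 0 < r -> centered_profile_derive r < 0.
Proof.
move=> r0; have q0 : 0 < (Num.sqrt r)^-1 by rewrite invr_gt0 sqrtr_gt0.
by rewrite /centered_profile_derive mulNr oppr_lt0 !mulr_gt0 ?exprn_gt0 ?addr_gt0.
Qed.

Lemma centered_profile_smooth2 I J x : 0 < center_dist x I J ->
  smooth2 (fun y => centered_profile (center_dist y I J)) x.
Proof.
move=> D0; have Dn0 : center_dist x I J != 0 by rewrite gt_eqF.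
have si : smooth2 (fun y => (Num.sqrt (center_dist y I J))^-1) x.
  apply: inv_smooth2; last by rewrite gt_eqF // sqrtr_gt0.
  by apply: sqrt_smooth2 => //; exact: center_dist_smooth2.
have s1 : smooth2 (fun y => 1 + (Num.sqrt (center_dist y I J))^-1) x.
  by apply: smooth2D => //; exact: (smooth2_cst 1).
apply: smooth2M; first exact: (smooth2_cst 12).
exact: smooth2M.
Qed.

Lemma centered_profile_ge0 (r : R) : 0 <= centered_profile r.
Proof. by rewrite mulr_ge0 // sqr_ge0. Qed.

Lemma centered_profile_le (r s : R) : 0 < r -> r <= s ->
  centered_profile s <= centered_profile r.
Proof.
move=> r0 rs; rewrite ler_pM2l // ler_pXn2r ?nnegrE ?addr_ge0 ?invr_ge0 ?sqrtr_ge0 //.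
rewrite lerD2l lef_pV2 ?posrE ?sqrtr_gt0 ?(lt_le_trans r0) //.
by rewrite ler_sqrt // (le_trans (ltW r0)).
Qed.

(* As sqrt 2 > 1, two terms at distance 2 r outweigh one at distance r. *)
Lemma centered_profile_double (r : R) : 0 < r ->
  centered_profile r <= 2 * centered_profile (2 * r).
Proof.
move=> r0; rewrite /centered_profile sqrtrM //.
set q := Num.sqrt r; set w := Num.sqrt 2.
have q0 : 0 < q by rewrite sqrtr_gt0.
have w2 : w ^+ 2 = 2 by rewrite sqr_sqrtr.
have w0 : 0 < w by rewrite sqrtr_gt0.
rewrite invfM; set p := q^-1; set v := w^-1.
have p0 : 0 < p by rewrite invr_gt0.
have vw : v * w = 1 by rewrite mulVf // gt_eqF.
have v2 : v ^+ 2 = 2^-1 by rewrite exprVn w2.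
have v1 : 2^-1 <= v.
  rewrite -(@ler_pXn2r _ 2) ?nnegrE ?invr_ge0 ?ltW //.
  by rewrite v2; lra.
have -> : (1 + v * p) ^+ 2 = 1 + 2 * (v * p) + v ^+ 2 * p ^+ 2 by ring.
rewrite v2.
have h : 2^-1 * p <= v * p by rewrite ler_pM2r.
nra.
Qed.

End center_distance.

Section force_cones.
Context {R : realType} {V : nat}.
Implicit Types (x : 'M[R]_(V, 3)) (I J : {set 'I_V}).

(** The points of both hulls are averaged with the same weights, proportional to [al] and [be]. A
    force cone is thus closed under sums, though it need not contain 0. *)
Lemma force_coneD x I J f g :
  force_cone x J I f -> force_cone x J I g -> force_cone x J I (f + g).
Proof.
move=> [al [a [b [al0 aI bJ ->]]]] [be [c [d [be0 cI dJ ->]]]].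
have s0 : 0 < al + be by rewrite addr_gt0.
have sn0 : al + be != 0 by rewrite gt_eqF.
have t0 : 0 <= al / (al + be) by rewrite divr_ge0 ?ltW.
have t1 : al / (al + be) <= 1 by rewrite ler_pdivrMr // mul1r lerDl ltW.
exists (al + be), ((al / (al + be)) *: a + (1 - al / (al + be)) *: c),
  ((al / (al + be)) *: b + (1 - al / (al + be)) *: d); split => //.
- by apply: ((convex_setP _).1 (@CH_convex _ _ x I)).
- by apply: ((convex_setP _).1 (@CH_convex _ _ x J)).
- by apply/rowP => k; rewrite !mxE; field.
Qed.

Lemma force_coneZ x I J f a : 0 < a -> force_cone x J I f -> force_cone x J I (a *: f).
Proof.
move=> a0 [al [p [q [al0 pI qJ ->]]]]; exists (a * al), p, q.
by rewrite mulr_gt0 // scalerA.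
Qed.

Lemma force_cone_mono x I J I' J' : I \subset I' -> J \subset J' ->
  force_cone x J I `<=` force_cone x J' I'.
Proof.
move=> II' JJ' f [al [p [q [al0 pI qJ ->]]]]; exists al, p, q.
by split=> //; [exact: CH_mono pI|exact: CH_mono qJ].
Qed.

Lemma centroid_force_cone x I J a : 0 < a -> I != finset.set0 -> J != finset.set0 ->
  force_cone x J I (a *: (centroid x I - centroid x J)).
Proof.
by move=> a0 I0 J0; exists a, (centroid x I), (centroid x J); split => //; exact: centroid_CH.
Qed.

End force_cones.

(** * The separating plane problem *)

Section inner_product.
Context {R : realType} {m : nat}.
Implicit Types (u v w : 'rV[R]_m) (a : R).

Definition inner u v : R := \sum_k u 0 k * v 0 k.

Lemma innerC u v : inner u v = inner v u.
Proof. by apply: eq_bigr => k _; rewrite mulrC. Qed.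

Lemma innerDl u v w : inner (u + v) w = inner u w + inner v w.
Proof. by rewrite -big_split; apply: eq_bigr => k _; rewrite mxE mulrDl. Qed.

Lemma innerZl a u w : inner (a *: u) w = a * inner u w.
Proof. by rewrite mulr_sumr; apply: eq_bigr => k _; rewrite mxE mulrA. Qed.

Lemma innerZr a u w : inner w (a *: u) = a * inner w u.
Proof. by rewrite innerC innerZl innerC. Qed.

Lemma innerNl u w : inner (- u) w = - inner u w.
Proof. by rewrite -scaleN1r innerZl mulN1r. Qed.

Lemma innerBl u v w : inner (u - v) w = inner u w - inner v w.
Proof. by rewrite innerDl innerNl. Qed.

Lemma innerBr u v w : inner w (u - v) = inner w u - inner w v.
Proof. by rewrite innerC innerBl ![inner _ w]innerC. Qed.

Lemma inner0l w : inner 0 w = 0.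
Proof. by rewrite -(scale0r 0) innerZl mul0r. Qed.

Lemma inner_suml (I : Type) (r : seq I) (P : pred I) (F : I -> 'rV[R]_m) w :
  inner (\sum_(i <- r | P i) F i) w = \sum_(i <- r | P i) inner (F i) w.
Proof. by elim/big_rec2: _ => [|i y z _ <-]; rewrite ?inner0l ?innerDl. Qed.

Lemma coord_le_norm u k : `|u 0 k| <= `|u|.
Proof.
rewrite [leRHS]/Num.Def.normr /= mx_normrE.
by apply/bigmax_geP; right => /=; exists (0, k).
Qed.

(** The norm of row vectors is the sup norm, whence the factor [m]; for planes [m] is 4. *)
Lemma inner_le_norm u v : `|inner u v| <= m%:R * (`|u| * `|v|).
Proof.
apply: le_trans (ler_norm_sum _ _ _) _.
have -> : m%:R * (`|u| * `|v|) = \sum_(k < m) `|u| * `|v|.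
  by rewrite sumr_const card_ord mulr_natl.
apply: ler_sum => k _; rewrite normrM.
by apply: ler_pM; rewrite ?normr_ge0 ?coord_le_norm.
Qed.

Lemma inner_ge0 u : 0 <= inner u u.
Proof. by apply: sumr_ge0 => k _; rewrite -expr2 sqr_ge0. Qed.

Lemma sqr_norm_le_inner u : `|u| ^+ 2 <= inner u u.
Proof.
rewrite -[leRHS]sqr_sqrtr ?inner_ge0 // ler_pXn2r ?nnegrE ?sqrtr_ge0 //.
rewrite [leLHS]/Num.Def.normr /= mx_normrE; apply: bigmax_le; first exact: sqrtr_ge0.
move=> [i k] _ /=; rewrite ord1 -sqrtr_sqr ler_wsqrtr //.
rewrite /inner (bigD1 k) //= expr2 lerDl sumr_ge0 // => j _.
by rewrite -expr2 sqr_ge0.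
Qed.

Lemma inner_eq0 u : inner u u = 0 -> u = 0.
Proof.
move=> u0; apply/eqP; rewrite -normr_eq0 -sqrf_eq0 eq_le sqr_ge0 andbT -u0.
exact: sqr_norm_le_inner.
Qed.

End inner_product.

(** * Convexity estimates for the scalar barriers *)

Section scalar_inequalities.
Context {R : realType}.
Implicit Types (a b r s : R).

(** The graph of 1/s lies above its tangent at [b]. The same inequality serves the convexity of the
    energy and Jensen's inequality for the vertices. *)
Lemma inv_tangent_le a b : 0 < a -> 0 < b -> b^-1 - (a - b) / b ^+ 2 <= a^-1.
Proof.
move=> a0 b0; rewrite -subr_ge0.
have -> : a^-1 - (b^-1 - (a - b) / b ^+ 2) = (a - b) ^+ 2 / (a * b ^+ 2).
  by field; rewrite !gt_eqF.
by rewrite divr_ge0 ?sqr_ge0 // mulr_ge0 ?sqr_ge0 // ltW.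
Qed.

Lemma invsqr_monotone a b : 0 < a -> 0 < b -> 0 <= (b ^- 2 - a ^- 2) * (a - b).
Proof.
move=> a0 b0.
have -> : (b ^- 2 - a ^- 2) * (a - b) = (a - b) ^+ 2 * (a + b) / (a ^+ 2 * b ^+ 2).
  by field; rewrite !gt_eqF.
have ab : 0 <= a + b by rewrite addr_ge0 // ltW.
by apply: divr_ge0; apply: mulr_ge0; rewrite ?sqr_ge0.
Qed.

(** The slope of 1/s has the decreasing derivative 2 / s^3, smallest at the right end of the
    interval; half of that value is kept. *)
Lemma invsqr_strongly_monotone a b s : 0 < a -> 0 < b -> a <= s -> b <= s ->
  (a - b) ^+ 2 / s ^+ 3 <= (b ^- 2 - a ^- 2) * (a - b).
Proof.
move=> a0 b0 as_ bs; have s0 : 0 < s by exact: lt_le_trans as_.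
have -> : (b ^- 2 - a ^- 2) * (a - b) = (a - b) ^+ 2 * ((a + b) / (a ^+ 2 * b ^+ 2)).
  by field; rewrite !gt_eqF.
apply: ler_wpM2l; first exact: sqr_ge0.
rewrite ler_pdivlMr ?mulr_gt0 ?exprn_gt0 // ler_pdivrMl ?exprn_gt0 //.
have h1 : a ^+ 2 <= s ^+ 2 by rewrite ler_pXn2r // nnegrE ltW.
have h2 : b * (a ^+ 2) <= s * s ^+ 2.
  by apply: ler_pM => //; [exact: ltW|exact: sqr_ge0].
have h3 : b * (b * (a ^+ 2)) <= b * (s * s ^+ 2) by rewrite ler_pM2l.
have h4 : 0 <= s ^+ 3 * a by rewrite mulr_ge0 ?exprn_ge0 // ltW.
have -> : a ^+ 2 * b ^+ 2 = b * (b * a ^+ 2) by ring.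
have -> : s ^+ 3 * (a + b) = s ^+ 3 * a + b * (s * s ^+ 2) by ring.
lra.
Qed.

(* [r (1 - r)^2 <= 4/27] on the unit interval. *)
Lemma barrier_coef_ge2 r : 0 < r -> r < 1 -> 2 <= (r * (1 - r) ^+ 2)^-1.
Proof.
move=> r0 r1; have s0 : 0 < 1 - r by lra.
rewrite -[2]invrK lef_pV2 ?posrE ?invr_gt0 ?mulr_gt0 ?exprn_gt0 //.
nra.
Qed.

(** This concerns the slope of 1 / (1 - r), whose derivative 2 / (1 - r)^3 is at least 2 on the unit
    interval. *)
Lemma barrier_slope_monotone r s : 0 < r -> r < 1 -> 0 < s -> s < 1 ->
  2 * (r - s) ^+ 2 <= ((1 - r) ^- 2 - (1 - s) ^- 2) * (r - s).
Proof.
move=> r0 r1 s0 s1.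
have := @invsqr_monotone.
set a := 1 - r; set b := 1 - s.
have a0 : 0 < a by rewrite subr_gt0.
have b0 : 0 < b by rewrite subr_gt0.
have a1 : a <= 1 by rewrite /a; lra.
have b1 : b <= 1 by rewrite /b; lra.
have -> : r - s = - (a - b) by rewrite /a /b; ring.
move=> _; rewrite sqrrN.
have -> : (a ^- 2 - b ^- 2) * - (a - b) = (a - b) ^+ 2 * ((a + b) / (a ^+ 2 * b ^+ 2)).
  by field; rewrite !gt_eqF.
rewrite [leLHS]mulrC; apply: ler_wpM2l; first exact: sqr_ge0.
rewrite ler_pdivlMr ?mulr_gt0 ?exprn_gt0 //.
have aa : a ^+ 2 <= a by rewrite expr2 ler_piMl // ltW.
have bb : b ^+ 2 <= b by rewrite expr2 ler_piMl // ltW.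
have a2 : a ^+ 2 <= 1 by exact: le_trans a1.
have b2 : b ^+ 2 <= 1 by exact: le_trans b1.
have h1 : a ^+ 2 * b ^+ 2 <= a ^+ 2 by rewrite ler_piMr // sqr_ge0.
have h2 : a ^+ 2 * b ^+ 2 <= b ^+ 2 by rewrite ler_piMl // sqr_ge0.
lra.
Qed.

End scalar_inequalities.

(** * The energy of a plane: convexity and strong monotonicity *)

Section separation_problem.
Context {R : realType} {V : nat}.
Variables (t t' : {set 'I_V}).
Implicit Types (x : 'M[R]_(V, 3)) (z w : 'rV[R]_(3 + 1)) (k : 'I_V).

(** A plane is packed into one row vector of length 4, so that compactness, coercivity and the
    implicit function theorem apply to it as a single variable. *)
Definition normal_of z : 'rV[R]_3 := lsubmx z.
Definition offset_of z : R := z 0 (rshift 3 ord0).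

Definition plane_value x z k : R := dot (row k x) (normal_of z) + offset_of z.

Definition homogeneous_row x k : 'rV[R]_(3 + 1) := row_mx (row k x) (const_mx 1).

Lemma innerE z w : inner z w = dot (normal_of z) (normal_of w) + offset_of z * offset_of w.
Proof.
rewrite /inner big_split_ord /= big_ord1; congr (_ + _).
by apply: eq_bigr => k _; rewrite !mxE.
Qed.

Lemma normal_row_mx (n : 'rV[R]_3) (d : 'rV[R]_1) : normal_of (row_mx n d) = n.
Proof. exact: row_mxKl. Qed.

Lemma offset_row_mx (n : 'rV[R]_3) (d : 'rV[R]_1) : offset_of (row_mx n d) = d 0 0.
Proof. by rewrite /offset_of row_mxEr. Qed.

Lemma inner_homogeneous_row x k z : inner (homogeneous_row x k) z = plane_value x z k.
Proof. by rewrite innerE normal_row_mx offset_row_mx mxE mul1r. Qed.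

Lemma normalB z w : normal_of (z - w) = normal_of z - normal_of w.
Proof. exact: linearB. Qed.

Lemma plane_valueB x z w k : plane_value x (z - w) k = plane_value x z k - plane_value x w k.
Proof. by rewrite -!inner_homogeneous_row innerBr. Qed.

Definition separating x z : Prop :=
  [/\ enorm (normal_of z) < 1, forall k, k \in t -> 0 < plane_value x z k &
      forall k, k \in t' -> plane_value x z k < 0].

Definition barrier_energy x z : R :=
  12 / (1 - enorm (normal_of z)) + \sum_(k in t) (plane_value x z k)^-1
  + \sum_(k in t') (- plane_value x z k)^-1.

(** The gradient of 1 / (1 - |n|) is [n] times this factor, singular at the origin;
    [separating_normal_gt0] keeps separating planes away from it. *)
Definition barrier_coef z : R :=
  (enorm (normal_of z) * (1 - enorm (normal_of z)) ^+ 2)^-1.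

(* The gradient of [barrier_energy x] in [z]. *)
Definition barrier_grad (p : 'M[R]_(V, 3) * 'rV[R]_(3 + 1)) : 'rV[R]_(3 + 1) :=
  (12 * barrier_coef p.2) *: row_mx (normal_of p.2) (const_mx 0)
  - \sum_(k in t) plane_value p.1 p.2 k ^- 2 *: homogeneous_row p.1 k
  + \sum_(k in t') plane_value p.1 p.2 k ^- 2 *: homogeneous_row p.1 k.

Lemma inner_barrier_grad x z w : inner (barrier_grad (x, z)) w =
  12 * (barrier_coef z * dot (normal_of z) (normal_of w))
  - \sum_(k in t) plane_value x z k ^- 2 * plane_value x w k
  + \sum_(k in t') plane_value x z k ^- 2 * plane_value x w k.
Proof.
rewrite /barrier_grad /= innerDl innerBl innerZl innerE normal_row_mx offset_row_mx.
rewrite mxE mul0r addr0 !inner_suml -!mulrA; congr (_ - _ + _).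
all: by apply: eq_bigr => k _; rewrite innerZl inner_homogeneous_row.
Qed.

Hypotheses (t0 : t != finset.set0) (t0' : t' != finset.set0).

(** With the signs of the two values it bounds each of them by the distance of the two vertices.
    This bound does not depend on the plane and feeds [invsqr_strongly_monotone]. *)
Lemma separating_sum_bound x z i j : separating x z -> i \in t -> j \in t' ->
  plane_value x z i - plane_value x z j <= enorm (row i x - row j x).
Proof.
move=> [n1 _ _] it jt'; rewrite /plane_value opprD addrACA subrr addr0 -dotBl.
apply: le_trans (cauchy_schwarz _ _) _.
by rewrite ler_piMr ?enorm_ge0 // ltW.
Qed.

(** With zero normal the affine form is constant, yet it must be positive on [t] and negative on
    [t']. *)
Lemma separating_normal_gt0 x z : separating x z -> 0 < enorm (normal_of z).
Proof.
move=> [_ Ht Ht']; rewrite lt0r enorm_ge0 andbT enorm_eq0; apply/eqP => n0.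
have /finset.set0Pn[i it] := t0; have /finset.set0Pn[j jt'] := t0'.
have := Ht i it; have := Ht' j jt'.
by rewrite /plane_value n0 !dot0r !add0r; lra.
Qed.

(** Each term is convex and lies above its tangent; for the norm term Cauchy-Schwarz replaces the
    inner product of the normals by the product of their norms. This inequality stands in for the
    derivative of the energy in the plane. *)
Lemma barrier_energy_ge x z w : separating x z -> separating x w ->
  barrier_energy x z + inner (barrier_grad (x, z)) (w - z) <= barrier_energy x w.
Proof.
move=> sz sw.
have rz := separating_normal_gt0 sz.
have [z1 zt zt'] := sz; have [w1 wt wt'] := sw.
rewrite inner_barrier_grad /barrier_energy.
set r := enorm (normal_of z) in rz z1 *; set q := enorm (normal_of w) in w1 *.
have hn : 12 / (1 - r) + 12 * (barrier_coef z * dot (normal_of z) (normal_of (w - z))) <= 12 / (1 - q).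
  rewrite -mulrDr ler_pM2l // normalB dotBr -sqr_enorm -/r.
  have cs := cauchy_schwarz (normal_of z) (normal_of w); rewrite -/r -/q in cs.
  have s1 : 0 < 1 - r by lra.
  have s2 : 0 < 1 - q by lra.
  apply: le_trans (inv_tangent_le s2 s1).
  rewrite lerD2l /barrier_coef -/r ler_pdivrMl ?mulr_gt0 ?exprn_gt0 //.
  have -> : r * (1 - r) ^+ 2 * - ((1 - q - (1 - r)) / (1 - r) ^+ 2) = r * (q - r).
    by field; rewrite gt_eqF.
  by rewrite mulrBr -expr2 lerD2r.
have ht : \sum_(k in t) (plane_value x z k)^-1 - \sum_(k in t) plane_value x z k ^- 2 * plane_value x (w - z) k
    <= \sum_(k in t) (plane_value x w k)^-1.
  rewrite -sumrB; apply: ler_sum => k kt; rewrite plane_valueB.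
  by apply: le_trans (inv_tangent_le (wt _ kt) (zt _ kt)); rewrite mulrC.
have ht' : \sum_(k in t') (- plane_value x z k)^-1 + \sum_(k in t') plane_value x z k ^- 2 * plane_value x (w - z) k
    <= \sum_(k in t') (- plane_value x w k)^-1.
  rewrite -big_split; apply: ler_sum => k kt /=; rewrite plane_valueB.
  have zk : 0 < - plane_value x z k by rewrite oppr_gt0 zt'.
  have wk : 0 < - plane_value x w k by rewrite oppr_gt0 wt'.
  apply: le_trans (inv_tangent_le wk zk); rewrite sqrrN lerD2l -mulNr.
  by rewrite mulrC; apply: ler_wpM2r; [rewrite invr_ge0 sqr_ge0|lra].
move: hn ht ht'.
set a := \sum_(k in t) _; set b := \sum_(k in t) _; set c := \sum_(k in t) _.
set a' := \sum_(k in t') _; set b' := \sum_(k in t') _; set c' := \sum_(k in t') _.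
set p1 := 12 / (1 - r); set p2 := 12 / (1 - q); set p := 12 * (barrier_coef z * _).
lra.
Qed.

(** With r, q the norms and c the inner product of the normals, their squared distance is (r - q)^2
    + 2 (r q - c). The radial part is [barrier_slope_monotone]; the angular part r q - c,
    nonnegative, carries the factor [barrier_coef z + barrier_coef w], which is at least 4. *)
Lemma barrier_coef_monotone x z w : separating x z -> separating x w ->
  2 * enorm (normal_of (z - w)) ^+ 2 <=
  barrier_coef z * dot (normal_of z) (normal_of (z - w))
  - barrier_coef w * dot (normal_of w) (normal_of (z - w)).
Proof.
move=> sz sw.
have r0 := separating_normal_gt0 sz; have q0 := separating_normal_gt0 sw.
have [r1 _ _] := sz; have [q1 _ _] := sw.
have kr := barrier_coef_ge2 r0 r1; have kq := barrier_coef_ge2 q0 q1.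
have mono := barrier_slope_monotone r0 r1 q0 q1.
rewrite sqr_enorm normalB /barrier_coef; move: r0 q0 r1 q1 kr kq mono.
have := cauchy_schwarz (normal_of z) (normal_of w).
have := sqr_enorm (normal_of z); have := sqr_enorm (normal_of w).
move: (normal_of z) (normal_of w) => n n'.
rewrite !dotBr !dotBl (dotC n' n) => <- <-.
move: (enorm n) (enorm n') (dot n n') => r q c crq r0 q0 r1 q1.
have -> : (1 - r) ^- 2 = (r * (1 - r) ^+ 2)^-1 * r.
  by field; rewrite !gt_eqF // subr_gt0.
have -> : (1 - q) ^- 2 = (q * (1 - q) ^+ 2)^-1 * q.
  by field; rewrite !gt_eqF // subr_gt0.
move: (_^-1) (_^-1) => kr kq kr2 kq2 mono.
have : 0 <= (kr + kq - 4) * (r * q - c) by apply: mulr_ge0; lra.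
nra.
Qed.

(** The norm term is strongly monotone in the normal only. The offset is controlled through the
    single vertex [i], whose value stays below the distance to [j]; the other vertex terms are
    merely monotone and are dropped. *)
Lemma barrier_grad_monotone x z w i j : separating x z -> separating x w ->
  i \in t -> j \in t' ->
  24 * enorm (normal_of (z - w)) ^+ 2 +
    plane_value x (z - w) i ^+ 2 / enorm (row i x - row j x) ^+ 3 <=
  inner (barrier_grad (x, z) - barrier_grad (x, w)) (z - w).
Proof.
move=> sz sw it jt'; have hn := barrier_coef_monotone sz sw.
have [z1 zt zt'] := sz; have [w1 wt wt'] := sw.
have bz := separating_sum_bound sz it jt'; have bw := separating_sum_bound sw it jt'.
rewrite innerBl !inner_barrier_grad.
have ht : plane_value x (z - w) i ^+ 2 / enorm (row i x - row j x) ^+ 3 <=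
    \sum_(k in t) plane_value x w k ^- 2 * plane_value x (z - w) k
    - \sum_(k in t) plane_value x z k ^- 2 * plane_value x (z - w) k.
  rewrite -sumrB (bigD1 i) //= -[leLHS]addr0; apply: lerD.
    rewrite -mulrBl plane_valueB; apply: invsqr_strongly_monotone => //; try exact: zt; try exact: wt.
      by have := zt' _ jt'; lra.
    by have := wt' _ jt'; lra.
  apply: sumr_ge0 => k /andP[kt _]; rewrite -mulrBl plane_valueB.
  by apply: invsqr_monotone; [exact: zt|exact: wt].
have ht' : 0 <= \sum_(k in t') plane_value x z k ^- 2 * plane_value x (z - w) k
    - \sum_(k in t') plane_value x w k ^- 2 * plane_value x (z - w) k.
  rewrite -sumrB; apply: sumr_ge0 => k kt; rewrite -mulrBl plane_valueB.
  have zk : 0 < - plane_value x z k by rewrite oppr_gt0 zt'.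
  have wk : 0 < - plane_value x w k by rewrite oppr_gt0 wt'.
  have := invsqr_monotone wk zk; rewrite !sqrrN.
  by rewrite opprK [- _ + _]addrC.
move: hn ht ht'.
set a := \sum_(k in t) _; set b := \sum_(k in t) _.
set a' := \sum_(k in t') _; set b' := \sum_(k in t') _.
set p := _ / _; set e := enorm _ ^+ 2; set c := barrier_coef z * _; set d := barrier_coef w * _.
lra.
Qed.

End separation_problem.

(** * Smoothness of the energy in the vertices and the plane *)

Section separation_differentiability.
Context {R : realType} {V : nat}.
Variables (t t' : {set 'I_V}).
Implicit Types (x : 'M[R]_(V, 3)) (z w : 'rV[R]_(3 + 1)) (k : 'I_V).
Local Notation pairT := ('M[R]_(V, 3) * 'rV[R]_(3 + 1))%type.
Implicit Types (p : pairT).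

Lemma differentiable_fst_mx p : differentiable (fun q : pairT => q.1) p.
Proof.
have lin : linear (fun q : pairT => q.1) by [].
pose L : {linear pairT -> 'M[R]_(V, 3)} := HB.pack (fun q : pairT => q.1)
  (GRing.isLinear.Build _ _ _ _ (fun q : pairT => q.1) lin).
by apply: (@linear_differentiable _ _ _ L) => q; exact: cvg_fst.
Qed.

Lemma differentiable_snd_mx p : differentiable (fun q : pairT => q.2) p.
Proof.
have lin : linear (fun q : pairT => q.2) by [].
pose L : {linear pairT -> 'rV[R]_(3 + 1)} := HB.pack (fun q : pairT => q.2)
  (GRing.isLinear.Build _ _ _ _ (fun q : pairT => q.2) lin).
by apply: (@linear_differentiable _ _ _ L) => q; exact: cvg_snd.
Qed.

Lemma differentiable_normal_coord p l :
  differentiable (fun q : pairT => normal_of q.2 0 l) p.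
Proof.
have := differentiable_entry 0 (lshift 1 l) (differentiable_snd_mx p).
by apply: near_eq_differentiable; apply: near_all => q; rewrite mxE.
Qed.

Lemma differentiable_plane_value p k :
  differentiable (fun q : pairT => plane_value q.1 q.2 k) p.
Proof.
apply: differentiableD; last exact: differentiable_entry (differentiable_snd_mx p).
apply: differentiable_big => l _; apply: differentiableM; last exact: differentiable_normal_coord.
apply: (near_eq_differentiable (f := fun q : pairT => q.1 k l)).
  by apply: near_all => q; rewrite mxE.
exact: differentiable_entry (differentiable_fst_mx p).
Qed.

Lemma differentiable_homogeneous_row p k :
  differentiable (fun q : pairT => homogeneous_row q.1 k) p.
Proof.
apply: differentiable_mx => i j.
case: (split_ordP j) => l ->.
  apply: (near_eq_differentiable (f := fun q : pairT => q.1 k l)).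
    by apply: near_all => q; rewrite row_mxEl mxE.
  exact: differentiable_entry (differentiable_fst_mx p).
apply: (near_eq_differentiable (f := fun=> 1 : R)); last exact: differentiable_cst.
by apply: near_all => q; rewrite row_mxEr mxE.
Qed.

Lemma differentiable_enorm_normal p : 0 < enorm (normal_of p.2) ->
  differentiable (fun q : pairT => enorm (normal_of q.2)) p.
Proof.
move=> n0; apply: (@differentiable_comp _ _ _ _ (fun q : pairT => dot (normal_of q.2) (normal_of q.2)) Num.sqrt).
  by apply: differentiable_big => l _; apply: differentiableM; exact: differentiable_normal_coord.
apply/derivable1_diffP.
have n2 : 0 < dot (normal_of p.2) (normal_of p.2) by rewrite -sqr_enorm exprn_gt0.
by have [] := is_derive1_sqrt n2.
Qed.

Lemma continuous_enorm_normal : continuous (fun q : pairT => enorm (normal_of q.2)).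
Proof.
move=> p; apply: (@continuous_comp _ _ _ (fun q : pairT => normal_of q.2) (@enorm R)); last exact: enorm_continuous.
apply/differentiable_continuous/differentiable_mx => i l; rewrite ord1.
exact: differentiable_normal_coord.
Qed.

Lemma separating_near x z : separating t t' x z ->
  \forall p \near (x, z), separating t t' p.1 p.2.
Proof.
move=> [n1 Ht Ht'].
have c k : {for (x, z), continuous (fun q : pairT => plane_value q.1 q.2 k)}.
  exact/differentiable_continuous/differentiable_plane_value.
have H1 : \forall p \near (x, z), enorm (normal_of p.2) < 1.
  exact: (@continuous_enorm_normal (x, z)) (lt_nbhsl n1).
have H2 : \forall p \near (x, z), forall k, k \in t -> 0 < plane_value p.1 p.2 k.
  apply: near_forall => k; have [kt|kt] := boolP (k \in t); last by apply: near_all.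
  by apply: nearS (c k _ (lt_nbhsr (Ht _ kt))).
have H3 : \forall p \near (x, z), forall k, k \in t' -> plane_value p.1 p.2 k < 0.
  apply: near_forall => k; have [kt|kt] := boolP (k \in t'); last by apply: near_all.
  by apply: nearS (c k _ (lt_nbhsl (Ht' _ kt))).
by apply: nearS2 H1 (nearS2 (fun _ => @conj _ _) H2 H3) => p ? [].
Qed.

Lemma differentiable_invsqr_plane p k : plane_value p.1 p.2 k != 0 ->
  differentiable (fun q : pairT => plane_value q.1 q.2 k ^- 2) p.
Proof.
move=> s0; apply: differentiableV; last by rewrite expf_neq0.
exact: (differentiableM (differentiable_plane_value p k) (differentiable_plane_value p k)).
Qed.

Hypotheses (t0 : t != finset.set0) (t0' : t' != finset.set0).

Lemma differentiable_barrier_grad x z : separating t t' x z ->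
  differentiable (barrier_grad t t') (x, z).
Proof.
move=> sz; have r0 := separating_normal_gt0 t0 t0' sz.
have [n1 Ht Ht'] := sz.
have de := @differentiable_enorm_normal (x, z) r0.
have ds : differentiable (fun q : pairT => 1 - enorm (normal_of q.2)) (x, z).
  exact: differentiableB.
have dn : differentiable (fun q : pairT => row_mx (normal_of q.2) (const_mx 0) : 'rV[R]_(3 + 1)) (x, z).
  apply: differentiable_mx => i j; rewrite ord1.
  case: (split_ordP j) => l ->.
    apply: (near_eq_differentiable (f := fun q : pairT => normal_of q.2 0 l)).
      by apply: near_all => q; rewrite row_mxEl.
    exact: differentiable_normal_coord.
  apply: (near_eq_differentiable (f := fun=> 0 : R)); last exact: differentiable_cst.
  by apply: near_all => q; rewrite row_mxEr mxE.
apply: differentiableD; [apply: differentiableB|].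
- apply: differentiable_scalemx => //.
  apply: differentiableM => //; apply: differentiableV.
    by apply: differentiableM => //; apply: (differentiableM ds ds).
  by rewrite gt_eqF // mulr_gt0 // exprn_gt0 // subr_gt0.
- apply: differentiable_big => k kt; apply: differentiable_scalemx.
    by apply: differentiable_invsqr_plane; rewrite gt_eqF //= Ht.
  exact: differentiable_homogeneous_row.
- apply: differentiable_big => k kt; apply: differentiable_scalemx.
    by apply: differentiable_invsqr_plane; rewrite lt_eqF //= Ht'.
  exact: differentiable_homogeneous_row.
Qed.

Let plane_linear_part z k y : R := dot (row k y) (normal_of z).

Let plane_lin z k : linear (plane_linear_part z k : _ -> R^o).
Proof.
by move=> a u v; rewrite /plane_linear_part linearP dotDl dotZl.
Qed.

Let planeL z k : {linear 'M[R]_(V, 3) -> R^o} :=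
  HB.pack (plane_linear_part z k)
    (GRing.isLinear.Build _ _ _ _ (plane_linear_part z k) (plane_lin z k)).

Lemma plane_value_smooth2 z k x : smooth2 (fun y => plane_value y z k) x.
Proof.
apply: smooth2D; last exact: smooth2_cst.
exact: (@smooth2_linear _ _ (planeL z k)).
Qed.

Lemma grad_plane_value z k x i :
  row i (grad (fun y => plane_value y z k) x) = (i == k)%:R *: normal_of z.
Proof.
rewrite gradD; first last.
- exact: differentiable_cst.
- exact: (@differentiable_mx_linear _ _ _ _ (planeL z k)).
rewrite grad_cst addr0.
have -> : grad (plane_linear_part z k) x = \matrix_(i, l) plane_linear_part z k (delta_mx i l).
  exact: (@grad_linear _ _ (planeL z k)).
apply/rowP => l; rewrite !mxE /plane_linear_part /dot (bigD1 l) //= big1 => [|j jl].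
  by rewrite !mxE eqxx andbT addr0 eq_sym.
by rewrite !mxE (negPf jl) andbF mul0r.
Qed.

Lemma barrier_energy_smooth2 x z : separating t t' x z ->
  smooth2 (fun y => barrier_energy t t' y z) x.
Proof.
move=> [_ Ht Ht']; apply: smooth2D; [apply: smooth2D; first exact: smooth2_cst|].
  apply: smooth2_sum => k kt; apply: inv_smooth2; first exact: plane_value_smooth2.
  by rewrite gt_eqF // Ht.
apply: smooth2_sum => k kt; apply: inv_smooth2.
  apply: (near_eq_smooth2 (f := fun y => -1 * plane_value y z k)).
    by apply: near_all => y; rewrite mulN1r.
  by apply: smooth2M; [exact: smooth2_cst|exact: plane_value_smooth2].
by rewrite gt_eqF // oppr_gt0 Ht'.
Qed.

Lemma grad_inv (f : 'M[R]_(V, 3) -> R) x : differentiable f x -> f x != 0 ->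
  grad (fun y => (f y)^-1) x = - f x ^- 2 *: grad f x.
Proof.
move=> df fx0; have D := @is_deriveV _ id (f x) 1 1 fx0 (is_derive_id _ _).
have [_ ->] := grad_comp df D.
by rewrite /GRing.scale /= mulr1.
Qed.

Lemma row_grad_barrier_energy x z i : separating t t' x z ->
  row i (grad (fun y => barrier_energy t t' y z) x) =
  (plane_value x z i ^- 2 * ((i \in t')%:R - (i \in t)%:R)) *: normal_of z.
Proof.
move=> [_ Ht Ht'].
have dp k : differentiable (fun y => plane_value y z k) x.
  exact/smooth2_differentiable/plane_value_smooth2.
have dpN k : differentiable (fun y => - plane_value y z k) x by exact: differentiableN.
have d1 k : k \in t -> differentiable (fun y => (plane_value y z k)^-1) x.
  by move=> kt; apply: differentiableV => //; rewrite gt_eqF // Ht.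
have d2 k : k \in t' -> differentiable (fun y => (- plane_value y z k)^-1) x.
  by move=> kt; apply: differentiableV => //; rewrite gt_eqF // oppr_gt0 Ht'.
rewrite gradD; first last.
- exact: differentiable_big.
- by apply: differentiableD; [exact: differentiable_cst|exact: differentiable_big].
rewrite gradD; first last.
- exact: differentiable_big.
- exact: differentiable_cst.
rewrite (grad_cst (12 / (1 - enorm (normal_of z)))) add0r !grad_sum //.
rewrite linearD !linear_sum /=.
rewrite mulrBr scalerBl addrC; congr (_ + _).
  rewrite (eq_bigr (fun k => (plane_value x z k ^- 2 * (i == k)%:R) *: normal_of z)) => [|k kt].
    rewrite -scaler_suml; congr (_ *: _).
    have [it|it] := boolP (i \in t').
      by rewrite (bigD1 i) //= eqxx big1 ?addr0 // => k /andP[_ /negPf ki]; rewrite eq_sym ki mulr0.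
    by rewrite mulr0 big1 // => k kt; case: eqP => [ik|]; [rewrite ik kt in it|rewrite mulr0].
  rewrite grad_inv; [|exact: dpN|by rewrite gt_eqF // oppr_gt0 Ht'].
  rewrite linearZ /= sqrrN.
  have -> : grad (fun y => - plane_value y z k) x = - grad (fun y => plane_value y z k) x.
    by apply/matrixP => a b; rewrite !mxE deriveN //; exact: diff_derivable.
  by rewrite linearN /= grad_plane_value scalerN scaleNr opprK scalerA.
rewrite (eq_bigr (fun k => - ((plane_value x z k ^- 2 * (i == k)%:R) *: normal_of z))) => [|k kt].
  rewrite sumrN -scaler_suml; congr (- (_ *: _)).
  have [it|it] := boolP (i \in t).
    by rewrite (bigD1 i) //= eqxx big1 ?addr0 // => k /andP[_ /negPf ki]; rewrite eq_sym ki mulr0.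
  by rewrite mulr0 big1 // => k kt; case: eqP => [ik|]; [rewrite ik kt in it|rewrite mulr0].
rewrite grad_inv; [|exact: dp|by rewrite gt_eqF // Ht].
rewrite linearZ /= grad_plane_value.
by rewrite scaleNr scalerA.
Qed.

End separation_differentiability.

(** * Existence and stationarity of the optimal plane *)

Section minimizer.
Context {R : realType} {V : nat}.
Variables (t t' : {set 'I_V}).
Hypotheses (t0 : t != finset.set0) (t0' : t' != finset.set0).
Implicit Types (x : 'M[R]_(V, 3)) (z w : 'rV[R]_(3 + 1)) (k : 'I_V).
Local Notation pairT := ('M[R]_(V, 3) * 'rV[R]_(3 + 1))%type.
Local Notation energy := (barrier_energy t t').
Local Notation G := (barrier_grad t t').

Lemma barrier_energy_continuous_z x z : separating t t' x z ->
  {for z, continuous (barrier_energy t t' x)}.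
Proof.
move=> [n1 Ht Ht'].
have cp k : {for z, continuous (fun w => plane_value x w k)}.
  rewrite (_ : (fun w => _) = (fun q : pairT => plane_value q.1 q.2 k) \o (fun w => (x, w))) //.
  apply: continuous_comp; last exact/differentiable_continuous/differentiable_plane_value.
  by apply: (@cvg_pair _ _ _ (nbhs z) (nbhs x) (nbhs z)); [exact: cvg_cst|exact: cvg_id].
have cn : {for z, continuous (fun w => enorm (normal_of w))}.
  rewrite (_ : (fun w => _) = (fun q : pairT => enorm (normal_of q.2)) \o (fun w => (x, w))) //.
  apply: continuous_comp; last exact: continuous_enorm_normal.
  by apply: (@cvg_pair _ _ _ (nbhs z) (nbhs x) (nbhs z)); [exact: cvg_cst|exact: cvg_id].
have csum (P : pred 'I_V) (f : 'I_V -> 'rV[R]_(3 + 1) -> R) :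
    (forall k, P k -> {for z, continuous (f k)}) ->
    {for z, continuous (fun w => \sum_(k | P k) f k w)}.
  move=> H; apply: (@cvg_big _ _ +%R 0 P _ _ (nbhs z) (index_enum 'I_V) f (fun k => f k z)) => //.
  exact: add_continuous.
apply: continuousD; [apply: continuousD|].
- apply: continuousM; first exact: cst_continuous.
  apply: continuousV; first by rewrite gt_eqF // subr_gt0.
  by apply: continuousB => //; exact: cst_continuous.
- apply: csum => k kt; apply: continuousV; first by rewrite gt_eqF // Ht.
  exact: cp.
- apply: csum => k kt; apply: continuousV; first by rewrite gt_eqF // oppr_gt0 Ht'.
  by apply: continuousN; exact: cp.
Qed.

(** For positive [m] this is compact, unlike the open set of separating planes, and it contains the
    sublevel sets of the energy. *)
Definition separating_margin (m : R) x : set 'rV[R]_(3 + 1) :=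
  [set z | [/\ enorm (normal_of z) <= 1 - m, forall k, k \in t -> m <= plane_value x z k &
      forall k, k \in t' -> plane_value x z k <= - m]].

Lemma separating_margin_separating m x z : 0 < m -> separating_margin m x z ->
  separating t t' x z.
Proof.
move=> m0 [n1 Ht Ht']; split.
- by apply: le_lt_trans n1 _; rewrite ltrBlDr ltrDl.
- by move=> k /Ht; exact: lt_le_trans.
- by move=> k /Ht' H; apply: le_lt_trans H _; rewrite oppr_lt0.
Qed.

Lemma barrier_energy_terms x z : separating t t' x z ->
  [/\ 12 / (1 - enorm (normal_of z)) <= energy x z,
     forall k, k \in t -> (plane_value x z k)^-1 <= energy x z &
     forall k, k \in t' -> (- plane_value x z k)^-1 <= energy x z].
Proof.
move=> [n1 Ht Ht'].
have p0 : 0 <= 12 / (1 - enorm (normal_of z)) by rewrite divr_ge0 // subr_ge0 ltW.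
have pt k : k \in t -> 0 <= (plane_value x z k)^-1.
  by move=> kt; rewrite invr_ge0 ltW // Ht.
have pt' k : k \in t' -> 0 <= (- plane_value x z k)^-1.
  by move=> kt; rewrite invr_ge0 ltW // oppr_gt0 Ht'.
have s0 : 0 <= \sum_(k in t) (plane_value x z k)^-1 by apply: sumr_ge0.
have s0' : 0 <= \sum_(k in t') (- plane_value x z k)^-1 by apply: sumr_ge0.
split; rewrite /barrier_energy.
- by rewrite -addrA lerDl addr_ge0.
- move=> k kt; rewrite (bigD1 k) //=.
  have : 0 <= \sum_(i in t | i != k) (plane_value x z i)^-1.
    by apply: sumr_ge0 => i /andP[it _]; exact: pt.
  by move: p0 s0'; set a := 12 / _; set b := \sum_(i in t') _; set c := \sum_(i in t | _) _; lra.
- move=> k kt; rewrite [X in _ <= _ + X](bigD1 k) //=.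
  have : 0 <= \sum_(i in t' | i != k) (- plane_value x z i)^-1.
    by apply: sumr_ge0 => i /andP[it _]; exact: pt'.
  by move: p0 s0; set a := 12 / _; set b := \sum_(i in t) _; set c := \sum_(i in t' | _) _; lra.
Qed.

Lemma barrier_energy_gt0 x z : separating t t' x z -> 0 < energy x z.
Proof.
move=> sz; have [H _ _] := barrier_energy_terms sz; apply: lt_le_trans H.
by have [n1 _ _] := sz; rewrite divr_gt0 // subr_gt0.
Qed.

(** All terms are nonnegative, so each is at most [M] and each denominator at least [M^-1]; in the
    norm term the factor 12 only helps. *)
Lemma sublevel_margin x z (M : R) : separating t t' x z -> energy x z <= M ->
  separating_margin M^-1 x z.
Proof.
move=> sz EM; have [Hn Ht Ht'] := barrier_energy_terms sz; have [n1 pt pt'] := sz.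
have M0 : 0 < M by exact: lt_le_trans (barrier_energy_gt0 sz) EM.
split.
- have s0 : 0 < 1 - enorm (normal_of z) by rewrite subr_gt0.
  have := le_trans Hn EM; rewrite ler_pdivrMr // => H.
  have : M^-1 <= 1 - enorm (normal_of z).
    by rewrite -[M^-1]mul1r ler_pdivrMr //; lra.
  lra.
- move=> k kt; have := le_trans (Ht _ kt) EM.
  by rewrite -[M in _ <= M]invrK lef_pV2 // posrE ?invr_gt0 ?pt.
- move=> k kt; have := le_trans (Ht' _ kt) EM; have := pt' _ kt => pk.
  by rewrite -[M in _ <= M]invrK lef_pV2 ?posrE ?invr_gt0 ?oppr_gt0 // lerNr.
Qed.

Lemma separating_margin_closed m x : closed (separating_margin m x).
Proof.
have cp k : continuous (fun w => plane_value x w k).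
  move=> z; rewrite (_ : (fun w => _) = (fun q : pairT => plane_value q.1 q.2 k) \o (fun w => (x, w))) //.
  apply: continuous_comp; last exact/differentiable_continuous/differentiable_plane_value.
  by apply: (@cvg_pair _ _ _ (nbhs z) (nbhs x) (nbhs z)); [exact: cvg_cst|exact: cvg_id].
have cn : continuous (fun w : 'rV[R]_(3 + 1) => enorm (normal_of w)).
  move=> z; rewrite (_ : (fun w => _) = (fun q : pairT => enorm (normal_of q.2)) \o (fun w => (x, w))) //.
  apply: continuous_comp; last exact: continuous_enorm_normal.
  by apply: (@cvg_pair _ _ _ (nbhs z) (nbhs x) (nbhs z)); [exact: cvg_cst|exact: cvg_id].
have -> : separating_margin m x =
  [set z | enorm (normal_of z) <= 1 - m] `&`
  ((\bigcap_(k in [set` t]) [set z | m <= plane_value x z k]) `&`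
   (\bigcap_(k in [set` t']) [set z | plane_value x z k <= - m])).
  by apply/seteqP; split => z; [case=> ? ? ?; split|case=> ? [? ?]; split].
apply: closedI; last apply: closedI.
- apply: (@closed_comp _ _ _ [set r : R | r <= 1 - m]); last exact: closed_le.
  by move=> z _; exact: cn.
- apply: closed_bigI => k _; apply: (@closed_comp _ _ _ [set r : R | m <= r]); last exact: closed_ge.
  by move=> z _; exact: cp.
- apply: closed_bigI => k _; apply: (@closed_comp _ _ _ [set r : R | r <= - m]); last exact: closed_le.
  by move=> z _; exact: cp.
Qed.

Lemma separating_margin_bounded m x : 0 < m -> bounded_set (separating_margin m x).
Proof.
move=> m0; have /finset.set0Pn[i it] := t0; have /finset.set0Pn[j jt] := t0'.
(* The normal is shorter than 1, so the signs at [i] and [j] confine the offset between minus the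
   norm of [row i x] and the norm of [row j x]. *)
set c := 1 + enorm (row i x) + enorm (row j x).
exists c; split; first exact: num_real.
move=> M cM z /(separating_margin_separating m0)[n1 Ht Ht'] /=.
have c0 : 0 <= c by rewrite !addr_ge0 ?enorm_ge0.
apply: le_trans (ltW cM).
rewrite [leLHS]/Num.Def.normr /= mx_normrE; apply: bigmax_le => // -[a l] _ /=; rewrite ord1.
have nb k : `|dot (row k x) (normal_of z)| <= enorm (row k x).
  by apply: le_trans (cauchy_schwarz_abs _ _) _; rewrite ler_piMr ?enorm_ge0 // ltW.
case: (split_ordP l) => b ->.
  have -> : z 0 (lshift 1 b) = normal_of z 0 b by rewrite mxE.
  apply: le_trans (coord_le_enorm _ _) _; apply: le_trans (ltW n1) _.
  by rewrite /c -addrA lerDl addr_ge0 ?enorm_ge0.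
rewrite ord1 -/(offset_of z).
have := Ht _ it; have := Ht' _ jt; have := nb i; have := nb j.
rewrite /plane_value !ler_norml => /andP[a1 a2] /andP[a3 a4] a5 a6.
have := enorm_ge0 (row i x); have := enorm_ge0 (row j x); rewrite /c => b1 b2.
by apply/andP; split; lra.
Qed.

Lemma exists_minimizer x z1 : separating t t' x z1 ->
  exists2 z, separating t t' x z & forall w, separating t t' x w -> energy x z <= energy x w.
Proof.
move=> s1; set M := energy x z1.
have M0 : 0 < M by exact: barrier_energy_gt0.
have m0 : 0 < M^-1 by rewrite invr_gt0.
set K := separating_margin M^-1 x.
have K0 : K !=set0 by exists z1; exact: sublevel_margin.
have Kc : compact K.
  by apply: bounded_closed_compact; [exact: separating_margin_bounded|exact: separating_margin_closed].
have fc : {within K, continuous (barrier_energy t t' x)}.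
  apply: continuous_in_subspaceT => z; rewrite inE => /(separating_margin_separating m0).
  exact: barrier_energy_continuous_z.
have [z + zmin] := EVT_min_rV K0 Kc fc.
rewrite inE => /(separating_margin_separating m0) sz; exists z => // w sw.
(* Planes of energy above [M] are beaten by [z1], which lies in [K]. *)
have [wM|wM] := leP (energy x w) M.
  by apply: zmin; rewrite inE; exact: sublevel_margin.
apply: le_trans (ltW wM); apply: zmin; rewrite inE; exact: sublevel_margin.
Qed.

Definition is_minimizer x z : Prop :=
  separating t t' x z /\ forall w, separating t t' x w -> energy x z <= energy x w.

(** Stationarity comes from the tangent inequality at the nearby planes [z - h *: g] instead of a
    derivative at [z]; continuity of [G] then gives the limit. *)
Lemma minimizer_grad0 x z : is_minimizer x z -> G (x, z) = 0.
Proof.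
move=> [sz zmin].
have dG := differentiable_barrier_grad t0 t0' sz.
set g := G (x, z).
pose w (h : R) := z - h *: g.
have wc : w h @[h --> 0] --> z.
  rewrite -[X in _ --> X]subr0 -(scale0r g); apply: cvgB; first exact: cvg_cst.
  by apply: cvgZr_tmp; exact: cvg_id.
have pc : (x, w h) @[h --> 0] --> (x, z).
  by apply: (@cvg_pair _ _ _ _ (nbhs x) (nbhs z)); [exact: cvg_cst|exact: wc].
have Gc : G (x, w h) @[h --> 0] --> g.
  exact: (cvg_comp _ _ pc (differentiable_continuous dG)).
have sw : \forall h \near (0 : R), separating t t' x (w h).
  exact: (pc _ (separating_near sz)).
(* convexity at [w h], for small positive [h], against minimality of [z] *)
have le0 : \forall h \near 0^'+, inner (G (x, w h)) g <= 0.
  near=> h.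
  have h0 : 0 < h by near: h; exact: nbhs_right_gt.
  have swh : separating t t' x (w h) by near: h; apply: cvg_within.
  have := barrier_energy_ge t0 t0' swh sz; have := zmin _ swh.
  have -> : z - w h = h *: g by rewrite /w opprB addrCA subrr addr0.
  rewrite innerZr => H1 H2; rewrite -(pmulr_rle0 _ h0); lra.
have lim : inner (G (x, w h)) g @[h --> 0^'+] --> inner g g.
  apply: cvg_at_right_filter.
  apply: (@cvg_big _ _ +%R 0 xpredT) => [|i _]; first exact: add_continuous.
  apply: cvgMr_tmp.
  exact: (cvg_comp _ _ Gc (@coord_continuous _ _ _ _ _ _)).
apply: inner_eq0; apply/eqP; rewrite eq_le inner_ge0 andbT.
exact: cvgr_to_le lim le0.
Unshelve. all: by end_near. Qed.

End minimizer.

(** * The optimal plane and the minimum as functions of the configuration *)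

Section minimum_value.
Context {R : realType} {V : nat}.
Variables (t t' : {set 'I_V}).
Hypotheses (t0 : t != finset.set0) (t0' : t' != finset.set0).
Implicit Types (x y : 'M[R]_(V, 3)) (z w : 'rV[R]_(3 + 1)) (k : 'I_V).
Local Notation pairT := ('M[R]_(V, 3) * 'rV[R]_(3 + 1))%type.
Local Notation energy := (barrier_energy t t').
Local Notation G := (barrier_grad t t').

Definition argmin x : 'rV[R]_(3 + 1) := get [set z | is_minimizer t t' x z].

Definition separable x : Prop := exists z, separating t t' x z.

Lemma argminP x : separable x -> is_minimizer t t' x (argmin x).
Proof.
move=> [z1 /(exists_minimizer t0 t0')[z sz zmin]].
apply: (@getPex _ (fun z => is_minimizer t t' x z)).
by exists z.
Qed.

Lemma near_separating x z : separating t t' x z ->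
  \forall y \near x, separating t t' y z.
Proof.
move=> sz; have pc : (y, z) @[y --> x] --> (x, z).
  by apply: (@cvg_pair _ _ _ (nbhs x) (nbhs x) (nbhs z)); [exact: cvg_id|exact: cvg_cst].
exact: (pc _ (separating_near sz)).
Qed.

Lemma near_separable x : separable x -> \forall y \near x, separable y.
Proof. by move=> [z sz]; apply: nearS (near_separating sz) => y; exists z. Qed.

(** Origin of the constants. Let Q be the monotonicity product, N the norm of the normal of z - w, d
    its offset, a the inner product of that normal with row i, X the norm of row i, S the distance
    of the rows. Then N^2 is at most Q / 24 and (a + d)^2 at most S^3 Q, while d^2 is at most 2 (a +
    d)^2 + 2 a^2 with a^2 at most X^2 N^2. Their sum bounds N^2 + d^2. *)
Let modulus i j x : R :=
  (1 + 2 * enorm (row i x) ^+ 2) / 24 + 2 * enorm (row i x - row j x) ^+ 3.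

Lemma barrier_grad_coercive x z w i j : separating t t' x z -> separating t t' x w ->
  i \in t -> j \in t' ->
  inner (z - w) (z - w) <= modulus i j x * inner (G (x, z) - G (x, w)) (z - w).
Proof.
move=> sz sw it jt.
have := barrier_grad_monotone t0 t0' sz sw it jt.
have bz := separating_sum_bound sz it jt.
have [_ zt zt'] := sz; have zi := zt _ it; have zj := zt' _ jt.
set Q := inner (_ - _) (z - w).
rewrite innerE -sqr_enorm -expr2 /modulus.
have : `|dot (row i x) (normal_of (z - w))| <= enorm (row i x) * enorm (normal_of (z - w)).
  exact: cauchy_schwarz_abs.
rewrite /plane_value.
set N := enorm (normal_of _); set a := dot _ _; set d := offset_of _.
set X := enorm (row i x); set S := enorm (row i x - _).
move=> aX H.
have S0 : 0 < S by rewrite /S; lra.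
have S3 : 0 < S ^+ 3 by rewrite exprn_gt0.
have a2 : a ^+ 2 <= X ^+ 2 * N ^+ 2.
  rewrite -exprMn -[a ^+ 2]real_normK ?num_real // ler_pXn2r // nnegrE.
  by rewrite mulr_ge0 ?enorm_ge0.
have N2 : 0 <= N ^+ 2 by exact: sqr_ge0.
have p2 : 0 <= (a + d) ^+ 2 / S ^+ 3 by rewrite divr_ge0 ?sqr_ge0 // ltW.
have HN : N ^+ 2 <= Q / 24 by rewrite ler_pdivlMr //; lra.
have Hp : (a + d) ^+ 2 <= S ^+ 3 * Q.
  rewrite -ler_pdivrMl // mulrC; lra.
have X2 : 0 <= X ^+ 2 by exact: sqr_ge0.
have XN : X ^+ 2 * N ^+ 2 <= X ^+ 2 * (Q / 24) by rewrite ler_wpM2l.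
have d2 : d ^+ 2 <= 2 * (a + d) ^+ 2 + 2 * a ^+ 2.
  have := sqr_ge0 (2 * a + d); rewrite !expr2; lra.
rewrite mulrDl; lra.
Qed.

Lemma modulus_continuous i j : continuous (modulus i j).
Proof.
have rc k : continuous (fun x => row k x : 'rV[R]_3) by exact: mx_linear_continuous.
move=> x.
have e1 : {for x, continuous (fun x => enorm (row i x))}.
  exact: (@continuous_comp _ _ _ (fun x => row i x) (@enorm R) x (rc i x) (@enorm_continuous _ _)).
have e2 : {for x, continuous (fun x => enorm (row i x - row j x))}.
  apply: (@continuous_comp _ _ _ (fun x => row i x - row j x) (@enorm R) x _ (@enorm_continuous _ _)).
  by apply: continuousB; exact: rc.
have c1 : {for x, continuous (fun x => (1 + 2 * enorm (row i x) ^+ 2) / 24)}.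
  apply: continuousM; last exact: cst_continuous.
  apply: continuousD; first exact: cst_continuous.
  by apply: continuousM; [exact: cst_continuous|exact: (continuousM e1 e1)].
have c2 : {for x, continuous (fun x => 2 * enorm (row i x - row j x) ^+ 3)}.
  by apply: continuousM; [exact: cst_continuous|exact: (continuousM e2 (continuousM e2 e2))].
exact: (continuousD c1 c2).
Qed.

(** [modulus] is continuous, so one constant works in a whole neighbourhood, as the comparison of
    minimizers of different configurations requires. *)
Lemma near_coercive x : exists2 K : R, 0 < K & \forall y \near x,
  forall z w, separating t t' y z -> separating t t' y w ->
  inner (z - w) (z - w) <= K * inner (G (y, z) - G (y, w)) (z - w).
Proof.
have /finset.set0Pn[i it] := t0; have /finset.set0Pn[j jt] := t0'.
have M0 y : 0 <= modulus i j y.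
  rewrite /modulus addr_ge0 //.
    by rewrite divr_ge0 // addr_ge0 // mulr_ge0 // sqr_ge0.
  by rewrite mulr_ge0 // exprn_ge0 // enorm_ge0.
exists (modulus i j x + 1); first by rewrite ltr_pwDr.
have H : \forall y \near x, modulus i j y < modulus i j x + 1.
  have lt1 : modulus i j x < modulus i j x + 1 by rewrite ltrDl.
  exact: (@modulus_continuous i j x _ (lt_nbhsl lt1)).
apply: nearS H => y Hy z w sz sw.
have co := barrier_grad_coercive sz sw it jt.
apply: le_trans co _.
have [-> |zw] := eqVneq z w; first by rewrite !subrr !inner0l !mulr0.
have : 0 <= inner (G (y, z) - G (y, w)) (z - w).
  have b := barrier_grad_monotone t0 t0' sz sw it jt; apply: le_trans b.
  apply: addr_ge0; first by rewrite mulr_ge0 ?sqr_ge0.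
  by apply: divr_ge0; [exact: sqr_ge0|rewrite exprn_ge0 // enorm_ge0].
by move=> I0; apply: ler_wpM2r => //; exact: ltW.
Qed.

(** Coercivity at [y] between the old minimizer and the new one, where the gradient vanishes: the
    displacement is bounded by the gradient left at the old plane. *)
Lemma argmin_bound x : separable x -> exists2 K : R, 0 < K & \forall y \near x,
  `|argmin y - argmin x| <= K * `|G (y, argmin x)|.
Proof.
move=> sx; have [K K0 HK] := near_coercive x.
have [s0 _] := argminP sx; set z := argmin x in s0 *.
(* 4 is the dimension of the plane variable, from [inner_le_norm]. *)
exists (K * 4); first by rewrite mulr_gt0.
have near_s := nearS2 (fun _ => @conj _ _) (near_separating s0) (near_separable sx).
apply: nearS2 HK near_s => y Hy [syz /argminP my]; have [sy _] := my.
have := Hy _ _ sy syz; rewrite (minimizer_grad0 t0 t0' my) sub0r.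
set D := _ - z; set g := G _ => H.
have [D0|D0] := eqVneq `|D| 0; first by rewrite D0 mulr_ge0 // mulr_ge0 // ltW.
have Dp : 0 < `|D| by rewrite lt0r D0 normr_ge0.
rewrite -(ler_pM2r Dp) -expr2; apply: le_trans (sqr_norm_le_inner _) _.
apply: le_trans H _; rewrite -!mulrA ler_pM2l // innerNl.
by apply: le_trans (ler_norm _) _; rewrite normrN; exact: inner_le_norm.
Qed.

Lemma barrier_grad_fst_continuous x z : separating t t' x z ->
  {for x, continuous (fun y => G (y, z))}.
Proof.
move=> sz; have pc : (y, z) @[y --> x] --> (x, z).
  by apply: (@cvg_pair _ _ _ (nbhs x) (nbhs x) (nbhs z)); [exact: cvg_id|exact: cvg_cst].
exact: (cvg_comp _ _ pc (differentiable_continuous (differentiable_barrier_grad t0 t0' sz))).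
Qed.

Lemma argmin_continuous x : separable x -> {for x, continuous argmin}.
Proof.
move=> sx; have [K K0 HK] := argmin_bound sx; have mx := argminP sx.
have [s0 _] := mx.
apply/continuous_near_dist => e e0.
have e1 : 0 < e / K by rewrite divr_gt0.
have /continuous_near_dist/(_ _ e1) H := barrier_grad_fst_continuous s0.
apply: nearS2 HK H => y Hy; rewrite (minimizer_grad0 t0 t0' mx) sub0r normrN => Hg.
rewrite distrC; apply: le_trans Hy _.
by rewrite -ler_pdivlMl // mulrC.
Qed.

(** If the partial differential killed a nonzero [w], the gradient would vary by o(h) along
    [h *: w], whereas coercivity demands a variation of order h. *)
Lemma barrier_grad_injective x z w : separating t t' x z ->
  'd G (x, z) (0, w) = 0 -> w = 0.
Proof.
move=> sz dGw; have dG := differentiable_barrier_grad t0 t0' sz.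
have [K K0 /nbhs_singleton HK] := near_coercive x.
apply/eqP; rewrite -normr_eq0; apply/eqP.
apply/eqP; rewrite eq_le normr_ge0 andbT; apply: contraT; rewrite -ltNge => w0.
have hw : h *: w @[h --> (0 : R)] --> (0 : 'rV[R]_(3 + 1)).
  by rewrite -(scale0r w); apply: cvgZr_tmp; exact: cvg_id.
have hwz : h *: w + z @[h --> (0 : R)] --> z.
  by rewrite -{2}[z]add0r; apply: cvgD => //; exact: cvg_cst.
have pc : (0 : 'M[R]_(V, 3), h *: w) @[h --> (0 : R)] --> ((0, 0) : pairT).
  by apply: (@cvg_pair _ _ _ _ (nbhs (0 : 'M[R]_(V, 3))) (nbhs (0 : 'rV[R]_(3 + 1)))); first exact: cvg_cst.
have zc : (x, h *: w + z) @[h --> (0 : R)] --> (x, z).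
  by apply: (@cvg_pair _ _ _ _ (nbhs x) (nbhs z)); first exact: cvg_cst.
(* With the factor 4 of [inner_le_norm], the right side of coercivity falls to half of the squared
   norm of [h *: w], which its left side bounds from above. *)
pose e : R := (K * 8)^-1.
have e0 : 0 < e by rewrite invr_gt0 mulr_gt0.
have H1 : \forall h \near (0 : R),
    `|G ((0, h *: w) + (x, z)) - G (x, z) - 'd G (x, z) (0, h *: w)| <= e * `|(0 : 'M[R]_(V, 3), h *: w)|.
  exact: (pc _ (differentiable_near_bound dG e0)).
have H2 : \forall h \near (0 : R), separating t t' x (h *: w + z).
  exact: (zc _ (separating_near sz)).
have [h h0 [{}H1 {}H2]] := near0_pos (nearS2 (fun _ => @conj _ _) H1 H2).
move: H1.
have e1 : (0, h *: w) = h *: (0, w) :> pairT by rewrite /GRing.scale /= /scale_pair /= scaler0.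
rewrite e1 linearZZ dGw scaler0 subr0.
have -> : h *: (0, w) + (x, z) = (x, h *: w + z) :> pairT.
  by rewrite /GRing.scale /= /scale_pair /= scaler0 /GRing.add /= /add_pair /= add0r.
rewrite normrZ (gtr0_norm h0).
have -> : `|(0 : 'M[R]_(V, 3), w)| = `|w| by rewrite prod_normE normr0 max_r.
have := HK _ _ H2 sz; rewrite addrK.
have := inner_le_norm (G (x, h *: w + z) - G (x, z)) (h *: w).
have := sqr_norm_le_inner (h *: w).
set I1 := inner (h *: w) _; set I2 := inner _ _; set g := `|G _ - G _|.
rewrite normrZ (gtr0_norm h0) => B1 B2 B3 B4.
have B5 : I2 <= 4 * (e * (h * `|w|) * (h * `|w|)).
  apply: le_trans (ler_norm _) _; apply: le_trans B2 _.
  by rewrite ler_pM2l // ler_pM2r // mulr_gt0.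
have B6 : K * I2 <= 2^-1 * (h * `|w|) ^+ 2.
  apply: (@le_trans _ _ (K * (4 * (e * (h * `|w|) * (h * `|w|))))); first by rewrite ler_pM2l.
  by rewrite le_eqVlt; apply/orP; left; apply/eqP; rewrite /e; field; rewrite gt_eqF.
have B7 : 0 < (h * `|w|) ^+ 2 by rewrite exprn_gt0 // mulr_gt0.
have := le_trans B1 (le_trans B3 B6).
by rewrite -subr_ge0 -{2}[_ ^+ 2]mul1r -mulrBl pmulr_lge0 //; lra.
Qed.

Lemma argmin_differentiable x : separable x -> differentiable argmin x.
Proof.
move=> sx; have mx := argminP sx; have [s0 _] := mx.
apply: (@implicit_function_differentiable _ _ _ G).
- exact: differentiable_barrier_grad.
- exact: argmin_continuous.
- by apply: nearS (near_separable sx) => y /argminP/(minimizer_grad0 t0 t0').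
- by move=> w; exact: barrier_grad_injective.
Qed.

Definition min_energy x : R := energy x (argmin x).

Lemma min_energy_is_diff x : separable x ->
  is_diff x min_energy ('d (fun y => energy y (argmin x)) x).
Proof.
move=> sx; have mx := argminP sx; have [s0 _] := mx; set z := argmin x in mx s0 *.
have dE : differentiable (fun y => energy y z) x.
  exact/smooth2_differentiable/barrier_energy_smooth2.
have dG : differentiable (fun y => G (y, z)) x.
  apply: (@differentiable_comp _ _ _ _ (fun y => (y, z)) G); last exact: differentiable_barrier_grad.
  by apply: differentiable_pair; [exact: ex_diff|exact: differentiable_cst].
have [dEc _] := (diff_locallyP _ _).1 dE.
have [dGc _] := (diff_locallyP _ _).1 dG.
have [k k0 kP] := linear_lipschitz dGc.
apply: near_bound_diff => // e e0.
(* Chosen so that the factor 4 of [inner_le_norm], the growth bound [k + 1] of the gradient and [c]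
   multiply to [e / 2]. *)
pose c : R := (8 * (k + 1))^-1 * e.
have c0 : 0 < c by rewrite mulr_gt0 // invr_gt0 mulr_gt0 // addr_gt0.
have H1 := differentiable_near_bound dE (divr_gt0 e0 (ltr0n R 2)).
have H2 := differentiable_near_bound dG (@ltr01 R).
have H3 : \forall h \near (0 : 'M[R]_(V, 3)), `|argmin (h + x) - z| <= c.
  have /continuous_near_dist/(_ _ c0) := argmin_continuous sx.
  rewrite (near_shift 0) subr0; apply: nearS => h /=; by rewrite distrC.
have H4 : \forall h \near (0 : 'M[R]_(V, 3)), separating t t' (h + x) z /\ separable (h + x).
  have := nearS2 (fun _ => @conj _ _) (near_separating s0) (near_separable sx).
  by rewrite (near_shift 0) subr0.
have H12 := nearS2 (fun _ => @conj _ _) H1 H2.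
have H34 := nearS2 (fun _ => @conj _ _) H3 H4.
apply: nearS2 H12 H34 => h [h1 h2] [h3 [h4 /argminP m4]].
have [s4 min4] := m4.
have up := min4 _ h4.
have lo := barrier_energy_ge t0 t0' h4 s4.
have Gx0 := minimizer_grad0 t0 t0' mx.
rewrite /= Gx0 subr0 mul1r in h2.
have hG : `|G (h + x, z)| <= (k + 1) * `|h|.
  have := ler_normD (G (h + x, z) - 'd (fun y => G (y, z)) x h) ('d (fun y => G (y, z)) x h).
  by rewrite subrK; have := kP h; lra.
have hI : `|inner (G (h + x, z)) (argmin (h + x) - z)| <= e / 2 * `|h|.
  apply: le_trans (inner_le_norm _ _) _.
  have : `|G (h + x, z)| * `|argmin (h + x) - z| <= ((k + 1) * `|h|) * c by apply: ler_pM.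
  have -> : ((k + 1) * `|h|) * c = 8^-1 * (e * `|h|) by rewrite /c; field; rewrite gt_eqF // addr_gt0.
  lra.
have hv : `|min_energy (h + x) - energy (h + x) z| <= e / 2 * `|h|.
  rewrite /min_energy; move: hI; rewrite !ler_norml => /andP[i1 i2]; apply/andP; split; lra.
have -> : min_energy (h + x) - min_energy x - 'd (fun y => energy y z) x h =
  (min_energy (h + x) - energy (h + x) z) + (energy (h + x) z - energy x z - 'd (fun y => energy y z) x h).
  by rewrite -/(min_energy x); ring.
by apply: le_trans (ler_normD _ _) _; lra.
Qed.

Lemma grad_min_energy x : separable x ->
  grad min_energy x = grad (fun y => energy y (argmin x)) x.
Proof.
move=> sx; have [s0 _] := argminP sx; have [d1 d2] := min_energy_is_diff sx.
have dE : differentiable (fun y => energy y (argmin x)) x.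
  exact/smooth2_differentiable/barrier_energy_smooth2.
apply/matrixP => i l; rewrite [LHS]mxE [RHS]mxE.
apply: etrans (deriveE (delta_mx i l) d1) _; apply: etrans (esym (deriveE (delta_mx i l) dE)).
exact: (congr1 (fun L : 'M[R]_(V, 3) -> R => L (delta_mx i l)) d2).
Qed.

Lemma row_grad_min_energy x i : separable x ->
  row i (grad min_energy x) =
  (plane_value x (argmin x) i ^- 2 * ((i \in t')%:R - (i \in t)%:R)) *: normal_of (argmin x).
Proof.
move=> sx; have [s0 _] := argminP sx.
by rewrite grad_min_energy // row_grad_barrier_energy.
Qed.

(** The envelope identity holds in a neighbourhood and expresses the gradient through the values of
    [argmin], so the first derivative of [argmin] gives the second derivative of the minimum. *)
Lemma min_energy_smooth2 x : separable x -> smooth2 min_energy x.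
Proof.
move=> sx; split.
  by apply: nearS (near_separable sx) => y /min_energy_is_diff[].
have [[_ Ht Ht'] _] := argminP sx.
have dp : differentiable (fun y => (y, argmin y)) x.
  by apply: differentiable_pair; [exact: ex_diff|exact: argmin_differentiable].
apply: differentiable_mx => i l.
apply: (near_eq_differentiable (f := fun y =>
   (plane_value y (argmin y) i ^- 2 * ((i \in t')%:R - (i \in t)%:R)) * normal_of (argmin y) 0 l)).
  apply: nearS (near_separable sx) => y sy.
  have := row_grad_min_energy i sy; move=> /(congr1 (fun M : 'rV[R]_3 => M 0 l)).
  by rewrite [LHS]mxE [RHS]mxE => ->.
have dn : differentiable (fun y => normal_of (argmin y) 0 l) x.
  exact: (differentiable_comp dp (differentiable_normal_coord (x, argmin x) l)).
apply: differentiableM => //.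
(* Off both triangles the plane value may vanish and its inverse square fail to be differentiable,
   but the difference of indicators is then 0. *)
have [itt|itt] := boolP ((i \in t) || (i \in t')).
  apply: differentiableM; last exact: differentiable_cst.
  apply: (@differentiable_comp _ _ _ _ (fun y => (y, argmin y)) (fun q => plane_value q.1 q.2 i ^- 2) x dp).
  apply: differentiable_invsqr_plane => /=.
  by case/orP: itt => [/Ht|/Ht'] H; [rewrite gt_eqF|rewrite lt_eqF].
move: itt; rewrite negb_or => /andP[/negPf -> /negPf ->].
apply: (near_eq_differentiable (f := fun=> 0 : R)); last exact: differentiable_cst.
by apply: near_all => y; rewrite subrr mulr0.
Qed.

End minimum_value.

(** * Triangle potentials *)

Section triangle_potentials.
Context {R : realType} {V : nat}.
Variables (t t' : {set 'I_V}).
Hypotheses (t0 : t != finset.set0) (t0' : t' != finset.set0).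
Implicit Types (x y : 'M[R]_(V, 3)) (z : 'rV[R]_(3 + 1)) (k : 'I_V).
Local Notation energy := (barrier_energy t t').
Local Notation separable := (separable t t').

Lemma inv_pos_ge0 (s : R) : (0 <= inv_pos s)%E.
Proof. by rewrite /inv_pos; case: ifP => s0; rewrite ?lee_fin ?invr_ge0 ?ltW // leey. Qed.

Lemma sum_inv_pos (I : {set 'I_V}) (f : 'I_V -> R) : (forall k, k \in I -> 0 < f k) ->
  (\sum_(k in I) inv_pos (f k) = (\sum_(k in I) (f k)^-1)%:E)%E.
Proof. by move=> f0; rewrite -sumEFin; apply: eq_bigr => k /f0; rewrite /inv_pos => ->. Qed.

Lemma sum_inv_pos_ge0 (I : {set 'I_V}) (f : 'I_V -> R) :
  (0 <= \sum_(k in I) inv_pos (f k))%E.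
Proof. by apply: sume_ge0 => k _; exact: inv_pos_ge0. Qed.

Lemma sum_inv_pos_pinfty (I : {set 'I_V}) (f : 'I_V -> R) k : k \in I -> f k <= 0 ->
  (\sum_(k in I) inv_pos (f k) = +oo)%E.
Proof.
move=> kI fk; rewrite (bigD1 k) //= {1}/inv_pos ltNge fk /= addye //.
by rewrite -ltNye (@lt_le_trans _ _ 0%E) // sume_ge0 // => j _; exact: inv_pos_ge0.
Qed.

Let pack (nd : 'rV[R]_3 * R) : 'rV[R]_(3 + 1) := row_mx nd.1 (const_mx nd.2).

Let plane_value_pack x nd k : plane_value x (pack nd) k = dot (row k x) nd.1 + nd.2.
Proof. by rewrite /plane_value normal_row_mx offset_row_mx mxE. Qed.

Lemma separation_energy_ge0 x nd : (0 <= separation_energy t t' x nd)%E.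
Proof.
by rewrite !adde_ge0 ?sum_inv_pos_ge0 // mule_ge0 ?lee_fin // inv_pos_ge0.
Qed.

Lemma separation_energyE x z : separating t t' x z ->
  separation_energy t t' x (normal_of z, offset_of z) = (energy x z)%:E.
Proof.
move=> [n1 Ht Ht']; rewrite /separation_energy /= !sum_inv_pos.
- rewrite /inv_pos subr_gt0 n1 -EFinM -!EFinD /barrier_energy; congr (_ + _ + _)%:E.
  by apply: eq_bigr => k _; rewrite dotNr -opprD.
- by move=> k kt; rewrite dotNr -opprD oppr_gt0; exact: Ht'.
- by move=> k kt; exact: Ht.
Qed.

Lemma separation_energy_pinfty x nd : ~ separating t t' x (pack nd) ->
  separation_energy t t' x nd = +oo%E.
Proof.
move=> ns; apply/eqP/negPn/negP => fin; apply: ns.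
have a0 : (0 <= 12%:E * inv_pos (1 - enorm nd.1)%R)%E.
  by rewrite mule_ge0 ?lee_fin // inv_pos_ge0.
have nNy (e : \bar R) : (0 <= e)%E -> e != -oo%E.
  by move=> e0; rewrite -ltNye (@lt_le_trans _ _ 0%E).
split.
- rewrite normal_row_mx ltNge; apply/negP => n1; move: fin.
  rewrite /separation_energy {1}/inv_pos subr_gt0 ltNge n1 /=.
  by rewrite mulry gtr0_sg // mul1e addye ?addye ?eqxx // nNy // sum_inv_pos_ge0.
- move=> k kt; rewrite plane_value_pack ltNge; apply/negP => s0; move: fin.
  rewrite /separation_energy (sum_inv_pos_pinfty kt s0) addey ?addye ?eqxx //.
    by rewrite nNy // sum_inv_pos_ge0.
  by rewrite nNy.
- move=> k kt; rewrite plane_value_pack ltNge; apply/negP => s0; move: fin.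
  have s0' : dot (row k x) (- nd.1) - nd.2 <= 0 by rewrite dotNr -opprD oppr_le0.
  rewrite /separation_energy [X in (_ + X)%E](sum_inv_pos_pinfty kt s0') addey ?eqxx //.
  by rewrite nNy // adde_ge0 // sum_inv_pos_ge0.
Qed.

Lemma triangle_potentialE x : separable x ->
  triangle_potential t t' x = (min_energy t t' x)%:E.
Proof.
move=> sx; have [s0 zmin] := argminP t0 t0' sx.
apply/eqP; rewrite eq_le; apply/andP; split.
  apply: ereal_inf_lbound; exists (normal_of (argmin t t' x), offset_of (argmin t t' x)) => //.
  exact: separation_energyE.
apply: le_ereal_inf_tmp => _ [nd _ <-].
have [snd|nsnd] := pselect (separating t t' x (pack nd)).
  have := separation_energyE snd; rewrite /pack normal_row_mx offset_row_mx mxE -surjective_pairing => ->.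
  by rewrite lee_fin; exact: zmin.
by rewrite separation_energy_pinfty // leey.
Qed.

Lemma triangle_potential_pinfty x : ~ separable x -> triangle_potential t t' x = +oo%E.
Proof.
move=> nsx; apply/eqP; rewrite -leye_eq; apply: le_ereal_inf_tmp => _ [nd _ <-].
by rewrite separation_energy_pinfty // => s; apply: nsx; exists (pack nd).
Qed.

Lemma triangle_potential_ge0 x : (0 <= triangle_potential t t' x)%E.
Proof. by apply: le_ereal_inf_tmp => _ [nd _ <-]; exact: separation_energy_ge0. Qed.

Lemma separableP x : separable x <-> CH x t `&` CH x t' = set0.
Proof.
split=> [[z [_ Ht Ht']]|tt].
  exact: (separated_CH Ht Ht').
have [n [d [Ht Ht']]] := CH_separation t0 t0' tt.
have c0 : 0 < 1 + enorm n by rewrite ltr_wpDr // enorm_ge0.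
(* Scaling the plane by a positive factor keeps all signs and makes the normal shorter than 1. *)
pose c := (1 + enorm n)^-1.
have cp : 0 < c by rewrite invr_gt0.
exists (pack (c *: n, c * d)); split.
- rewrite normal_row_mx enormZ gtr0_norm // mulrC ltr_pdivrMr // mul1r.
  by rewrite ltrDr ltr01.
- by move=> k kt; rewrite plane_value_pack dotZr -mulrDr mulr_gt0 // Ht.
- by move=> k kt; rewrite plane_value_pack dotZr -mulrDr pmulr_rlt0 // Ht'.
Qed.

(* An energy at most [M] leaves a margin [1/M] on every inequality, which survives
   a small displacement of the vertices. *)
Lemma triangle_potential_blowup x (M : R) : ~ separable x ->
  \forall y \near x, (M%:E < triangle_potential t t' y)%E.
Proof.
move=> nsx.
wlog M0 : M / 0 < M => [H|].
  have M1 : 0 < `|M| + 1 by rewrite ltr_pwDr.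
  apply: nearS (H _ M1) => y; apply: le_lt_trans.
  by rewrite lee_fin (le_trans (ler_norm _)) // lerDl.
have H : \forall y \near x, forall k, enorm (row k y - row k x) < M^-1.
  apply: near_forall => k.
  have c : {for x, continuous (fun y : 'M[R]_(V, 3) => enorm (row k y - row k x))}.
    apply: (@continuous_comp _ _ _ (fun y : 'M[R]_(V, 3) => row k y - row k x) (@enorm R) x _ (@enorm_continuous _ _)).
    by apply: continuousB; [exact: mx_linear_continuous|exact: cst_continuous].
  have lt : enorm (row k x - row k x) < M^-1 by rewrite subrr enorm0 invr_gt0.
  exact: (c _ (lt_nbhsl lt)).
apply: nearS H => y Hy.
have [sy|nsy] := pselect (separable y); last by rewrite triangle_potential_pinfty // ltry.
rewrite triangle_potentialE // lte_fin ltNge; apply/negP => EM; apply: nsx.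
have [s0 _] := argminP t0 t0' sy.
have [_ Ht Ht'] := sublevel_margin s0 EM; have [n1 _ _] := s0.
set z := argmin t t' y in s0 n1 Ht Ht' *.
have dz k : `|plane_value y z k - plane_value x z k| < M^-1.
  rewrite /plane_value opprD addrACA subrr addr0 -dotBl.
  apply: le_lt_trans (cauchy_schwarz_abs _ _) _; apply: le_lt_trans (Hy k).
  by rewrite ler_piMr ?enorm_ge0 // ltW.
exists z; split => // k kt; have := dz k; rewrite ltr_norml => /andP[].
  by have := Ht _ kt; lra.
by have := Ht' _ kt; lra.
Qed.

Lemma triangle_grad0 x i : i \notin t :|: t' -> separable x ->
  row i (grad (min_energy t t') x) = 0.
Proof.
rewrite inE negb_or => /andP[/negPf it /negPf it'] sx.
by rewrite row_grad_min_energy // it it' subrr mulr0 scale0r.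
Qed.

Lemma argmin_normal_force x : separable x ->
  force_cone x t' t (normal_of (argmin t t' x)).
Proof.
move=> sx; have mx := argminP t0 t0' sx; have [sz _] := mx.
have G0 := minimizer_grad0 t0 t0' mx; set z := argmin t t' x in mx sz G0 *.
have [n1 Ht Ht'] := sz; have n0 := separating_normal_gt0 t0 t0' sz.
pose a k := plane_value x z k ^- 2.
have at0 k : k \in t -> 0 < a k by move=> kt; rewrite invr_gt0 exprn_gt0 // Ht.
have at0' k : k \in t' -> 0 < a k.
  by move=> kt; rewrite invr_gt0 exprn_even_gt0 //= lt_eqF // Ht'.
set S := \sum_(k in t) a k; set S' := \sum_(k in t') a k.
have S0 : 0 < S by apply: has_sumr_gt0 => //; exact: has_in_set.
(* Stationarity tested against the pure offset direction: the weights of the two triangles have the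
   same sum, so one factor normalises both means. *)
have Goff : S = S'.
  have := inner_barrier_grad t t' x z (pack (0, 1)).
  rewrite G0 inner0l /pack normal_row_mx dot0r !mulr0 sub0r => /eqP.
  have p1 k : plane_value x (row_mx 0 (const_mx 1)) k = 1.
    by rewrite (plane_value_pack x (0, 1)) dot0r add0r.
  rewrite (eq_bigr a) => [|k _]; last by rewrite p1 mulr1.
  rewrite [X in _ == _ + X](eq_bigr a) => [|k _]; last by rewrite p1 mulr1.
  by rewrite eq_sym addrC subr_eq0 => /eqP/esym.
have c0 : 0 < 12 * barrier_coef z.
  by rewrite mulr_gt0 // invr_gt0 mulr_gt0 // exprn_gt0 // subr_gt0.
have Gn : (12 * barrier_coef z) *: normal_of z =
    \sum_(k in t) a k *: row k x - \sum_(k in t') a k *: row k x.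
  have L (I : {set 'I_V}) : lsubmx (\sum_(k in I) a k *: homogeneous_row x k) =
      \sum_(k in I) a k *: row k x.
    by rewrite linear_sum; apply: eq_bigr => k _; rewrite linearZ /= row_mxKl.
  have := congr1 (@lsubmx R 1 3 1) G0; rewrite /barrier_grad /=.
  rewrite linearD linearB linear0 /= linearZ /= row_mxKl !L.
  by move=> /eqP; rewrite addr_eq0 subr_eq => /eqP ->; rewrite addrC.
exists (S / (12 * barrier_coef z)), (S^-1 *: \sum_(k in t) a k *: row k x),
  (S'^-1 *: \sum_(k in t') a k *: row k x); split.
- by rewrite divr_gt0.
- exact: CH_mean.
- exact: CH_mean.
- rewrite -Goff -scalerBr -Gn scalerA scalerA.
  move: (12 * barrier_coef z) c0 => c c0.
  by rewrite (_ : S / c * S^-1 * c = 1) ?scale1r //; field; rewrite !gt_eqF.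
Qed.

End triangle_potentials.

(** * Comparison of triangle potentials with the centered potential *)

Section three_vertices.
Context {R : realType} {V : nat}.
Variables (t t' : {set 'I_V}).
Hypotheses (t3 : #|t| = 3%N) (t3' : #|t'| = 3%N).
Implicit Types (x : 'M[R]_(V, 3)) (z : 'rV[R]_(3 + 1)).

Let sum_dot (I : {set 'I_V}) x n : #|I| = 3%N ->
  \sum_(k in I) dot (row k x) n = 3 * dot (centroid x I) n.
Proof.
move=> I3; rewrite /centroid I3 dotZl mulrA mulfV ?mul1r //.
by rewrite dot_suml.
Qed.

(** Jensen's inequality: in the sum of the tangents at the mean [p] the linear parts cancel. *)
Let mean_inv (I : {set 'I_V}) (f : 'I_V -> R) p : #|I| = 3%N ->
  (forall k, k \in I -> 0 < f k) -> 0 < p -> \sum_(k in I) f k = 3 * p ->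
  3 / p <= \sum_(k in I) (f k)^-1.
Proof.
move=> I3 f0 p0 fp.
apply: le_trans (ler_sum _ (fun k kI => inv_tangent_le (f0 k kI) p0)).
rewrite sumrB -mulr_suml sumrB fp !sumr_const I3 -[p^-1 *+ 3]mulr_natl -[p *+ 3]mulr_natl.
by rewrite subrr mul0r subr0.
Qed.

Let inv_add_le (p q : R) : 0 < p -> 0 < q -> 12 / (p + q) <= 3 / p + 3 / q.
Proof.
move=> p0 q0; have pq0 : 0 < p + q by rewrite addr_gt0.
rewrite -subr_ge0.
have -> : 3 / p + 3 / q - 12 / (p + q) = 3 * (p - q) ^+ 2 / (p * q * (p + q)).
  by field; rewrite !gt_eqF.
by apply: divr_ge0; [rewrite mulr_ge0 ?sqr_ge0|rewrite ltW // !mulr_gt0].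
Qed.

(* Minimum over [r] of the energy seen by two points at distance [u^-2]. *)
Let barrier_profile_le (r u : R) : 0 < r -> r < 1 -> 0 < u ->
  (1 + u) ^+ 2 <= 1 / (1 - r) + (u ^- 2 * r)^-1.
Proof.
move=> r0 r1 u0; rewrite -subr_ge0.
have s0 : 1 - r != 0 by rewrite gt_eqF // subr_gt0.
have -> : 1 / (1 - r) + (u ^- 2 * r)^-1 - (1 + u) ^+ 2 =
    (r - u * (1 - r)) ^+ 2 / (r * (1 - r)).
  by field; rewrite s0 !gt_eqF.
by rewrite divr_ge0 ?sqr_ge0 // mulr_ge0 // ?ltW // subr_gt0.
Qed.

(** The vertices of each triangle are replaced by their centroid, with values [p] and [- q] at the
    plane, where [p + q <= D * r] by Cauchy-Schwarz. Minimizing [12 / (1 - r) + 12 / (D * r)] over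
    [r] gives exactly the centered potential. *)
Lemma triangle_potential_ge_centered x : 0 < center_dist x t t' ->
  (centered_potential t t' x <= triangle_potential t t' x)%E.
Proof.
move=> D0.
have t0 : t != finset.set0 by rewrite -card_gt0 t3.
have t0' : t' != finset.set0 by rewrite -card_gt0 t3'.
have [sx|nsx] := pselect (separable t t' x); last first.
  by rewrite (triangle_potential_pinfty nsx) leey.
rewrite triangle_potentialE // centered_potentialE // lee_fin /min_energy.
have [sz _] := argminP t0 t0' sx; move: (argmin t t' x) sz => z sz.
have [n1 Ht Ht'] := sz; have n0 := separating_normal_gt0 t0 t0' sz.
rewrite /barrier_energy /centered_profile.
set n := normal_of z in n1 n0 *; set r := enorm n in n1 n0 *.
set p := dot (centroid x t) n + offset_of z.
set q := - (dot (centroid x t') n + offset_of z).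
have sp : \sum_(k in t) plane_value x z k = 3 * p.
  by rewrite big_split /= sum_dot // sumr_const t3 -[offset_of z *+ 3]mulr_natl -mulrDr.
have sq : \sum_(k in t') - plane_value x z k = 3 * q.
  by rewrite sumrN big_split /= sum_dot // sumr_const t3' -[offset_of z *+ 3]mulr_natl -mulrDr -mulrN.
have p0 : 0 < p.
  by rewrite -(@pmulr_rgt0 _ 3) // -sp; apply: has_sumr_gt0 => //; exact: has_in_set.
have q0 : 0 < q.
  rewrite -(@pmulr_rgt0 _ 3) // -sq; apply: has_sumr_gt0; last exact: has_in_set.
  by move=> k kt; rewrite oppr_gt0; exact: Ht'.
have hp : 3 / p <= \sum_(k in t) (plane_value x z k)^-1 by apply: mean_inv.
have hq : 3 / q <= \sum_(k in t') (- plane_value x z k)^-1.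
  by apply: mean_inv => // k kt; rewrite oppr_gt0; exact: Ht'.
have pq : p + q <= center_dist x t t' * r.
  by rewrite /p /q opprD addrACA subrr addr0 -dotBl; exact: cauchy_schwarz.
have hpq : 12 / (center_dist x t t' * r) <= 3 / p + 3 / q.
  apply: (@le_trans _ _ (12 / (p + q))).
    have h1 : 0 < p + q by rewrite addr_gt0.
    have h2 : 0 < center_dist x t t' * r by rewrite mulr_gt0.
    by rewrite ler_pM2l // lef_pV2.
  exact: inv_add_le.
set D := center_dist x t t' in D0 pq hpq *.
(* In terms of the inverse square root [u] of the distance the remaining inequality is rational. *)
have [u [u0 uE]] : exists u : R, 0 < u /\ (Num.sqrt D)^-1 = u /\ D = u ^- 2.
  exists (Num.sqrt D)^-1; rewrite invr_gt0 sqrtr_gt0 D0; split => //; split => //.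
  by rewrite exprVn invrK sqr_sqrtr // ltW.
have [-> DE] := uE.
have hr : (1 + u) ^+ 2 <= 1 / (1 - r) + (D * r)^-1.
  by rewrite DE; apply: barrier_profile_le.
have := hp; have := hq; move: hpq hr.
set a := \sum_(k in t) _; set b := \sum_(k in t') _.
rewrite -[12 / (D * r)]/(12 * (D * r)^-1) -[12 / (1 - r)]/(12 * (1 - r)^-1) mul1r.
move: ((D * r)^-1) ((1 - r)^-1) (3 / p) (3 / q) => A1 A2 A3 A4; lra.
Qed.

End three_vertices.

(** * Non-prehensile gradients and blending *)

Section nonprehensile_gradients.
Context {R : realType} {V : nat}.
Implicit Types (x : 'M[R]_(V, 3)) (I J : {set 'I_V}) (f g : 'M[R]_(V, 3) -> R).

(** The third clause is what sums need: at a vertex each term then contributes a force of the cone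
    or nothing. *)
Definition nonprehensile_grad f I J x : Prop :=
  [/\ forall i, i \in I -> force_cone x J I (- row i (grad f x)),
      forall j, j \in J -> force_cone x I J (- row j (grad f x)) &
      forall k, k \notin I :|: J -> row k (grad f x) = 0].

Lemma near_eq_nonprehensile_grad f g I J x : (\forall y \near x, f y = g y) ->
  nonprehensile_grad f I J x -> nonprehensile_grad g I J x.
Proof. by move=> /near_eq_grad E; rewrite /nonprehensile_grad E. Qed.

(** Since a cone need not contain 0, every vertex must be met by at least one summand. Disjointness
    of [I] and [J] ensures that a vertex of [I] never receives the force meant for the other
    side. *)
Lemma nonprehensile_grad_sum (T : eqType) (s : seq T) (F : T -> 'M[R]_(V, 3) -> R)
    (I_ J_ : T -> {set 'I_V}) I J x :
  fintype.disjoint (mem I) (mem J) ->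
  (forall p, p \in s -> [/\ differentiable (F p) x, nonprehensile_grad (F p) (I_ p) (J_ p) x,
     I_ p \subset I & J_ p \subset J]) ->
  (forall i, i \in I -> exists2 p, p \in s & i \in I_ p) ->
  (forall j, j \in J -> exists2 p, p \in s & j \in J_ p) ->
  nonprehensile_grad (fun y => \sum_(p <- s) F p y) I J x.
Proof.
move=> dIJ HF coverI coverJ.
have gradE : grad (fun y => \sum_(p <- s) F p y) x = \sum_(p <- s) grad (F p) x.
  rewrite [RHS]big_seq -(grad_sum _ (fun p ps => let: And4 d _ _ _ := HF p ps in d)).
  by apply: near_eq_grad; apply: near_all => y; rewrite big_seq.
have cone0 (K L : {set 'I_V}) (G : T -> 'rV[R]_3) (r : seq T) :
    (forall p, p \in r -> G p = 0 \/ force_cone x L K (G p)) ->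
    (exists2 p, p \in r & force_cone x L K (G p)) ->
    force_cone x L K (\sum_(p <- r) G p).
  elim: r => [_ [p]|q r IH HG [p]] //; rewrite big_cons inE => pr Gp.
  have HG' u : u \in r -> G u = 0 \/ force_cone x L K (G u).
    by move=> ur; apply: HG; rewrite inE ur orbT.
  have [r0|] := pselect (exists2 p, p \in r & force_cone x L K (G p)).
    have Gr := IH HG' r0.
    have [->|Gq] := HG q (mem_head _ _); first by rewrite add0r.
    exact: force_coneD.
  move=> nr.
  have -> : \sum_(j <- r) G j = 0.
    rewrite big_seq big1 // => u ur; have [//|Gu] := HG' u ur.
    by exfalso; apply: nr; exists u.
  have pq : p = q by case/orP: pr => [/eqP //|pr]; exfalso; apply: nr; exists p.
  by rewrite addr0 -pq.
split.
- move=> i iI; rewrite gradE linear_sum /= -sumrN; apply: cone0.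
    move=> p ps; have [_ [HI _ H0] sI sJ] := HF p ps.
    have [ip|ip] := boolP (i \in I_ p).
      by right; apply: force_cone_mono sI sJ _ (HI _ ip).
    left; rewrite H0 ?oppr0 // inE negb_or ip /=; apply/negP => ij.
    by move/disjointFr: dIJ => /(_ i iI); rewrite (fintype.subsetP sJ _ ij).
  have [p ps ip] := coverI i iI; exists p => //; have [_ [HI _ H0] sI sJ] := HF p ps.
  exact: force_cone_mono sI sJ _ (HI _ ip).
- move=> j jJ; rewrite gradE linear_sum /= -sumrN; apply: cone0.
    move=> p ps; have [_ [_ HJ H0] sI sJ] := HF p ps.
    have [jp|jp] := boolP (j \in J_ p).
      by right; apply: force_cone_mono sJ sI _ (HJ _ jp).
    left; rewrite H0 ?oppr0 // inE negb_or jp andbT; apply/negP => ij.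
    by move/disjointFl: dIJ => /(_ j jJ); rewrite (fintype.subsetP sI _ ij).
  have [p ps jp] := coverJ j jJ; exists p => //; have [_ [_ HJ H0] sI sJ] := HF p ps.
  exact: force_cone_mono sJ sI _ (HJ _ jp).
- move=> k; rewrite inE negb_or => /andP[kI kJ].
  rewrite gradE linear_sum /= big_seq big1 // => p ps.
  have [_ [_ _ H0] sI sJ] := HF p ps; apply: H0; rewrite inE negb_or.
  by rewrite (contra (fintype.subsetP sI k) kI) (contra (fintype.subsetP sJ k) kJ).
Qed.

Section blending.
Variables (I J : {set 'I_V}) (d1 d2 : R).
Hypotheses (d1_gt0 : 0 < d1) (d12 : d1 < d2).

Definition blend_weight x : R := smoothstep ((center_dist x I J - d1) / (d2 - d1)).

Let w_gt0 : 0 < d2 - d1. Proof. by rewrite subr_gt0. Qed.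

Let ramp (r : R) : R := smoothstep ((r - d1) / (d2 - d1)).
Let dramp (r : R) : R := dsmoothstep ((r - d1) / (d2 - d1)) / (d2 - d1).

Let is_derive_ramp (r : R) : is_derive r 1 ramp (dramp r).
Proof.
have Da : is_derive r 1 (fun r : R => (d2 - d1)^-1 * (r - d1)) ((d2 - d1)^-1 * (1 - 0)).
  have H := is_deriveZ (d2 - d1)^-1 (is_deriveB (is_derive_id r (1 : R)) (is_derive_cst d1 r 1)).
  exact: H.
have := @is_derive1_comp _ (@smoothstep R) _ r _ _ (smoothstep_is_derive _) Da.
rewrite subr0 mulr1.
rewrite (_ : _ \o _ = ramp) => [|]; last by apply/funext => s; rewrite /ramp /= mulrC.
by rewrite /dramp [_^-1 * (r - d1)]mulrC.
Qed.

Lemma blend_weight_le x : center_dist x I J <= d1 -> blend_weight x = 0.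
Proof. by move=> Dd; rewrite /blend_weight smoothstep_le0 // pmulr_lle0 ?invr_gt0 // subr_le0. Qed.

Lemma blend_weight_smooth2 x : center_dist x I J != 0 -> smooth2 blend_weight x.
Proof.
move=> D0; apply: (@smoothstep_smooth2 _ _ (fun y => (center_dist y I J - d1) / (d2 - d1))).
apply: smooth2M; last exact: smooth2_cst.
by apply: smooth2D; [exact: center_dist_smooth2|exact: smooth2_cst].
Qed.

Lemma blend_weight_continuous : continuous blend_weight.
Proof.
move=> x.
have rc : {for center_dist x I J, continuous ramp}.
  by apply/differentiable_continuous/derivable1_diffP; have [] := is_derive_ramp (center_dist x I J).
exact: (@continuous_comp _ _ _ (fun y => center_dist y I J) ramp x (@center_dist_continuous _ _ I J x) rc).
Qed.

Definition blend f x : R :=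
  (1 - blend_weight x) * f x + blend_weight x * centered_profile (center_dist x I J).

Lemma blend_smooth2 f x : smooth2 f x -> 0 < center_dist x I J -> smooth2 (blend f) x.
Proof.
move=> sf D0; have sw : smooth2 blend_weight x by apply: blend_weight_smooth2; rewrite gt_eqF.
apply: smooth2D.
  apply: smooth2M => //; apply: smooth2D; first exact: smooth2_cst.
  apply: (near_eq_smooth2 (f := fun y => -1 * blend_weight y)).
    by apply: near_all => y; rewrite mulN1r.
  by apply: smooth2M => //; exact: smooth2_cst.
by apply: smooth2M => //; exact: centered_profile_smooth2.
Qed.

Lemma row_grad_blend f x k : differentiable f x -> 0 < center_dist x I J ->
  row k (grad (blend f) x) = (1 - blend_weight x) *: row k (grad f x)
    + ((dramp (center_dist x I J) * (centered_profile (center_dist x I J) - f x)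
        + blend_weight x * centered_profile_derive (center_dist x I J))
       * (center_weight I J k / center_dist x I J)) *: (centroid x I - centroid x J).
Proof.
move=> df D0; have Dn : center_dist x I J != 0 by rewrite gt_eqF.
have dD := smooth2_differentiable (center_dist_smooth2 Dn).
move: (dramp _) (is_derive_ramp (center_dist x I J)) => a Da.
have [dw gw] := grad_comp dD Da.
have [dc gc] := grad_comp dD (is_derive_centered_profile D0).
have dw1 : is_derive (center_dist x I J) 1 (fun r : R => 1 - ramp r) (- a).
  by have := is_deriveB (is_derive_cst (1 : R) (center_dist x I J) 1) Da; rewrite sub0r.
have [dv gv] := grad_comp dD dw1.
rewrite gradD; first last.
- exact: (differentiableM dw dc).
- exact: (differentiableM dv df).
rewrite (gradM dv df) (gradM dw dc) gv gw gc.
move: (centered_profile_derive _) => c.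
have := @grad_center_dist _ _ I J x k Dn; move: (centroid x I - centroid x J) => u gu.
rewrite !linearD /= !linearZ /= gu.
rewrite -[ramp (center_dist x I J)]/(blend_weight x).
move: (blend_weight x) (centered_profile (center_dist x I J)) => b d.
move: (row k (grad f x)) => v; move: (center_weight I J k / center_dist x I J) => e.
by apply/rowP => l; rewrite !mxE; ring.
Qed.

(** The coefficient [c] of the push along the centers is nonpositive. It may vanish when the weight
    is below 1, where the force of [f] remains; at weight 1 that force is gone, and the strictly
    negative slope of the centered profile makes [c] negative. *)
Lemma blend_nonprehensile f x : I != finset.set0 -> J != finset.set0 ->
  fintype.disjoint (mem I) (mem J) -> differentiable f x -> d1 <= center_dist x I J ->
  centered_profile (center_dist x I J) <= f x ->
  nonprehensile_grad f I J x -> nonprehensile_grad (blend f) I J x.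
Proof.
move=> I0 J0 dIJ df dD Pf [HI HJ H0].
have D0 : 0 < center_dist x I J by exact: lt_le_trans dD.
set D := center_dist x I J in dD Pf D0 *.
have w0 : 0 <= blend_weight x by exact: smoothstep_ge0.
have w1 : blend_weight x <= 1 by exact: smoothstep_le1.
have dr0 : 0 <= dramp D by rewrite divr_ge0 ?dsmoothstep_ge0 // ltW.
have cd0 := centered_profile_derive_lt0 D0.
set c := dramp D * (centered_profile D - f x) + blend_weight x * centered_profile_derive D.
have c0 : c <= 0.
  rewrite /c; have : 0 <= dramp D * (f x - centered_profile D) by rewrite mulr_ge0 // subr_ge0.
  have : blend_weight x * centered_profile_derive D <= 0 by rewrite mulr_ge0_le0 // ltW.
  rewrite !mulrBr; lra.
have cw1 : blend_weight x = 1 -> c < 0.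
  move=> W; rewrite /c W mul1r; have : 0 <= dramp D * (f x - centered_profile D) by rewrite mulr_ge0 // subr_ge0.
  rewrite !mulrBr; lra.
have core (K L : {set 'I_V}) (v : 'rV[R]_3) (b : R) : K != finset.set0 -> L != finset.set0 -> 0 < b ->
    force_cone x L K (- v) ->
    force_cone x L K (- ((1 - blend_weight x) *: v + (c * b) *: (centroid x K - centroid x L))).
  move=> K0 L0 b0 Hv.
  have [W|W] := eqVneq (blend_weight x) 1.
    rewrite W subrr scale0r add0r -scaleNr; apply: centroid_force_cone => //.
    by rewrite -mulNr mulr_gt0 // oppr_gt0 cw1.
  have W1 : 0 < 1 - blend_weight x by rewrite subr_gt0 lt_neqAle W.
  have [cz|cz] := eqVneq c 0.
    by rewrite cz mul0r scale0r addr0 -scalerN; apply: force_coneZ.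
  rewrite opprD -scalerN -scaleNr; apply: force_coneD; first exact: force_coneZ.
  apply: centroid_force_cone => //.
  by rewrite -mulNr mulr_gt0 // oppr_gt0 lt_neqAle cz.
have cardV (K : {set 'I_V}) : K != finset.set0 -> 0 < (#|K|%:R^-1 : R) / D.
  by move=> K0; rewrite divr_gt0 // invr_gt0 ltr0n card_gt0.
split.
- move=> i iI; rewrite row_grad_blend // -/D -/c.
  have -> : center_weight I J i = #|I|%:R^-1 :> R.
    by rewrite /center_weight iI (disjointFr dIJ iI) /=; ring.
  by apply: core => //; [exact: cardV|exact: HI].
- move=> j jJ; rewrite row_grad_blend // -/D -/c.
  have -> : center_weight I J j = - #|J|%:R^-1 :> R.
    by rewrite /center_weight jJ (disjointFl dIJ jJ) /=; ring.
  rewrite mulNr mulrN scaleNr -scalerN opprB.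
  by apply: core => //; [exact: cardV|exact: HJ].
- move=> k kIJ; rewrite row_grad_blend // H0 // scaler0 add0r.
  move: kIJ; rewrite inE negb_or => /andP[/negPf kI /negPf kJ].
  by rewrite /center_weight kI kJ !mulr0 subrr mul0r mulr0 scale0r.
Qed.

End blending.

Lemma triangle_nonprehensile_grad (t t' : {set 'I_V}) x :
  t != finset.set0 -> t' != finset.set0 -> fintype.disjoint (mem t) (mem t') -> separable t t' x ->
  nonprehensile_grad (min_energy t t') t t' x.
Proof.
move=> t0 t0' dtt sx; have [sz _] := argminP t0 t0' sx.
have nf := argmin_normal_force t0 t0' sx; have [_ Ht Ht'] := sz.
split; last by move=> k kt; exact: triangle_grad0.
- move=> i it; rewrite row_grad_min_energy // it (disjointFr dtt it) sub0r mulrN1 scaleNr opprK.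
  by apply: force_coneZ => //; rewrite invr_gt0 exprn_gt0 // Ht.
- move=> j jt; rewrite row_grad_min_energy // jt (disjointFl dtt jt) subr0 mulr1.
  have [al [a [b [al0 ta tb ->]]]] := nf.
  rewrite scalerA -scalerN opprB; eexists; exists b, a; split; [|exact: tb|exact: ta|reflexivity].
  by rewrite mulr_gt0 // invr_gt0 exprn_even_gt0 //= lt_eqF // Ht'.
Qed.

End nonprehensile_gradients.

(** * Bounding sphere hierarchies *)

Local Notation radius := Defs.radius.

(** A classical equality on trees, for membership in sequences of nodes. *)
HB.instance Definition _ (R : realType) (V : nat) := gen_eqMixin (bsh R V).

Section bsh_structure.
Context {R : realType} {V : nat}.
Implicit Types (x : 'M[R]_(V, 3)) (h : bsh R V).

Definition child_pairs h h' : seq (bsh R V * bsh R V) :=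
  [seq (c, c') | c <- children h, c' <- children h'].

Definition core_potential (eps : R) h h' : 'M[R]_(V, 3) -> \bar R :=
  if is_leaf h && is_leaf h' then triangle_potential (vertices h) (vertices h')
  else fun x => (\sum_(p <- child_pairs h h') bsh_potential eps p.1 p.2 x)%E.

Lemma bsh_potential_blendE eps h h' :
  bsh_potential eps h h' = node_blend eps h h' (core_potential eps h h').
Proof.
rewrite bsh_potentialE /core_potential; case: ifP => // _; congr node_blend.
by apply/funext => x; rewrite big_allpairs_dep.
Qed.

Lemma child_pairsP h h' p : reflect (p.1 \in children h /\ p.2 \in children h')
  (p \in child_pairs h h').
Proof.
case: p => c c' /=; apply: (iffP idP) => [/allpairsP[[a b] /= [ha hb [-> ->]]] //|[hc hc']].
by apply/allpairsP; exists (c, c').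
Qed.

(** A leaf is its own child, so in a mixed pair only one of the two nodes shrinks; the nested
    structural inductions cover each case. *)
Lemma bsh_pair_ind (P : bsh R V -> bsh R V -> Prop) :
  (forall h h', is_leaf h && is_leaf h' -> P h h') ->
  (forall h h', ~~ (is_leaf h && is_leaf h') ->
    (forall p, p \in child_pairs h h' -> P p.1 p.2) -> P h h') ->
  forall h h', P h h'.
Proof.
move=> HL HN; elim=> [t r|hl IHl hr IHr r]; elim=> [t' r'|hl' IHl' hr' IHr' r'].
- exact: HL.
- apply: HN => // -[c c'] /child_pairsP /= [].
  by rewrite mem_seq1 mem_seq2 => /eqP -> /orP[] /eqP ->.
- apply: HN => // -[c c'] /child_pairsP /= [].
  by rewrite mem_seq1 mem_seq2 => /orP[] /eqP -> /eqP ->; [exact: IHl|exact: IHr].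
- apply: HN => // -[c c'] /child_pairsP /= [].
  by rewrite !mem_seq2 => /orP[] /eqP -> /orP[] /eqP ->; by [exact: IHl|exact: IHr].
Qed.

Lemma mem_vertices h i : reflect (exists2 t, t \in leaves h & i \in t) (i \in vertices h).
Proof.
elim: h => [t r|hl IHl hr IHr r] /=.
  by apply: (iffP idP) => [it|[u]]; [exists t; rewrite ?inE|rewrite inE => /eqP ->].
rewrite inE; apply: (iffP orP) => [[/IHl|/IHr] [t tl it]|[t]].
- by exists t => //; rewrite mem_cat tl.
- by exists t => //; rewrite mem_cat tl orbT.
- by rewrite mem_cat => /orP[tl|tr] it; [left; apply/IHl|right; apply/IHr]; exists t.
Qed.

Lemma leaf_sub_vertices h t : t \in leaves h -> t \subset vertices h.
Proof. by move=> tl; apply/fintype.subsetP => i it; apply/mem_vertices; exists t. Qed.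

Lemma leaves_child h c t : c \in children h -> t \in leaves c -> t \in leaves h.
Proof.
case: h => [u r|hl hr r] /=; first by rewrite mem_seq1 => /eqP ->.
by rewrite mem_seq2 => /orP[] /eqP -> tc; rewrite mem_cat tc ?orbT.
Qed.

Lemma leaf_in_child h t : t \in leaves h -> exists2 c, c \in children h & t \in leaves c.
Proof.
case: h => [u r|hl hr r] tl; first by exists (Leaf u r); rewrite ?mem_head.
by move: tl; rewrite /= mem_cat => /orP[] tl; [exists hl|exists hr]; rewrite // !inE eqxx ?orbT.
Qed.

Lemma vertices_child h c : c \in children h -> vertices c \subset vertices h.
Proof.
move=> ch; apply/fintype.subsetP => i /mem_vertices[t tc it].
by apply/mem_vertices; exists t => //; exact: leaves_child tc.
Qed.

Lemma vertex_in_child h i : i \in vertices h -> exists2 c, c \in children h & i \in vertices c.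
Proof.
move=> /mem_vertices[t tl it]; have [c ch tc] := leaf_in_child tl.
by exists c => //; apply/mem_vertices; exists t.
Qed.

Lemma leaf_pair_in_child h h' t t' : t \in leaves h -> t' \in leaves h' ->
  exists2 p, p \in child_pairs h h' & t \in leaves p.1 /\ t' \in leaves p.2.
Proof.
move=> /leaf_in_child[c ch tc] /leaf_in_child[c' ch' tc'].
by exists (c, c') => //; apply/child_pairsP.
Qed.

Lemma leaves_leaf h : is_leaf h -> leaves h = [:: vertices h].
Proof. by case: h. Qed.

Lemma children_neq0 h : exists c, c \in children h.
Proof. by case: h => [t r|hl hr r]; [exists (Leaf t r)|exists hl]; rewrite inE eqxx. Qed.

(* The constraints on the radii at a single configuration, with the containment
   of balls expressed through centers and radii. *)
Fixpoint nested_balls x h : Prop :=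
  match h with
  | Leaf t r => [/\ 0 < r, #|t| = 3%N & forall k, k \in t -> enorm (row k x - centroid x t) <= r]
  | Node hl hr r =>
      [/\ nested_balls x hl, nested_balls x hr,
          enorm (centroid x (vertices hl :|: vertices hr) - centroid x (vertices hl)) + radius hl <= r &
          enorm (centroid x (vertices hl :|: vertices hr) - centroid x (vertices hr)) + radius hr <= r]
  end.

Lemma nested_radius_gt0 x h : nested_balls x h -> 0 < radius h.
Proof.
elim: h => [t r [] //|hl IHl hr IHr r /= [/IHl hl0 _ H _]].
by apply: lt_le_trans H; rewrite ltr_wpDl // enorm_ge0.
Qed.

Lemma nested_child x h c : nested_balls x h -> c \in children h -> nested_balls x c.
Proof.
case: h => [t r|hl hr r] H /=; first by rewrite mem_seq1 => /eqP ->.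
by case: H => ? ? _ _; rewrite mem_seq2 => /orP[] /eqP ->.
Qed.

Lemma nested_child_center x h c : nested_balls x h -> c \in children h ->
  enorm (centroid x (vertices h) - centroid x (vertices c)) + radius c <= radius h.
Proof.
case: h => [t r|hl hr r] H /=.
  by rewrite mem_seq1 => /eqP ->; rewrite subrr enorm0 add0r.
by case: H => _ _ Hl Hr; rewrite mem_seq2 => /orP[] /eqP ->.
Qed.

Lemma nested_vertex x h i : nested_balls x h -> i \in vertices h ->
  enorm (row i x - centroid x (vertices h)) <= radius h.
Proof.
elim: h => [t r [_ _ H] /H //|hl IHl hr IHr r /= [Hl Hr cl cr]].
rewrite inE => /orP[/(IHl Hl)|/(IHr Hr)] H.
  apply: le_trans (enorm_triangle _ (centroid x (vertices hl)) _) _.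
  by apply: le_trans cl; rewrite addrC (enormB (centroid x (vertices hl))) lerD2l.
apply: le_trans (enorm_triangle _ (centroid x (vertices hr)) _) _.
by apply: le_trans cr; rewrite addrC (enormB (centroid x (vertices hr))) lerD2l.
Qed.

Lemma nested_vertices_neq0 x h : nested_balls x h -> vertices h != finset.set0.
Proof.
elim: h => [t r [_ t3 _]|hl IHl hr IHr r /= [/IHl + _ _ _]] /=.
  by rewrite -card_gt0 t3.
case/finset.set0Pn => i il; apply/finset.set0Pn; exists i.
by rewrite inE il.
Qed.

Lemma nested_leaf_card x h t : nested_balls x h -> t \in leaves h -> #|t| = 3%N.
Proof.
elim: h => [u r [_ u3 _]|hl IHl hr IHr r /= [Hl Hr _ _]]; first by rewrite inE => /eqP ->.
by rewrite mem_cat => /orP[/(IHl Hl)|/(IHr Hr)].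
Qed.

(** The inclusion is tested on the point of the inner ball farthest from [c], on the ray from [c]
    through [c']. *)
Lemma ball_inclusion (c c' : 'rV[R]_3) (r r' : R) : 0 <= r' ->
  closed_eball c' r' `<=` closed_eball c r -> enorm (c - c') + r' <= r.
Proof.
move=> r0 H; rewrite enormB; have [cc|cc] := eqVneq c' c.
  rewrite cc subrr enorm0 add0r.
  (* With equal centers any unit vector will do. *)
  pose e : 'rV[R]_3 := \row_(k < 3) (k == 0)%:R.
  have e1 : enorm e = 1 by rewrite /enorm dotE !mxE /= mulr1 !mulr0 !addr0 sqrtr1.
  have := H (c' + r' *: e); rewrite /closed_eball /= cc addrAC subrr add0r enormZ e1 mulr1 ger0_norm //.
  exact.
have n0 : 0 < enorm (c' - c) by rewrite enorm_gt0 subr_eq0.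
have := H (c' + (r' / enorm (c' - c)) *: (c' - c)); rewrite /closed_eball /=.
rewrite addrAC subrr add0r enormZ ger0_norm ?divr_ge0 ?enorm_ge0 // divfK ?gt_eqF // => /(_ (lexx _)).
have -> : c' + (r' / enorm (c' - c)) *: (c' - c) - c =
    ((enorm (c' - c) + r') / enorm (c' - c)) *: (c' - c).
  by apply/rowP => k; rewrite !mxE; field; rewrite gt_eqF.
by rewrite enormZ ger0_norm ?divr_ge0 ?addr_ge0 ?enorm_ge0 // divfK // gt_eqF.
Qed.

Lemma valid_radii_nested (C : set 'M[R]_(V, 3)) x h : C x -> valid_radii C h ->
  (forall t, t \in leaves h -> #|t| = 3%N) -> nested_balls x h.
Proof.
move=> Cx; elim: h => [t r [r0 H] t3|hl IHl hr IHr r [Hl Hr Hs] t3].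
  split=> // [|k kt]; first by rewrite t3 // mem_head.
  by rewrite enormB; exact: H.
have nl : nested_balls x hl by apply: IHl => // t tl; rewrite t3 //= mem_cat tl.
have nr : nested_balls x hr by apply: IHr => // t tr; rewrite t3 //= mem_cat tr orbT.
have [sub _] := Hs _ Cx.
split=> //; apply: ball_inclusion.
- exact/ltW/(nested_radius_gt0 nl).
- by move=> p pl; apply: sub; left.
- exact/ltW/(nested_radius_gt0 nr).
- by move=> p pr; apply: sub; right.
Qed.

Lemma child_center_dist x h h' p : nested_balls x h -> nested_balls x h' ->
  p \in child_pairs h h' ->
  `|center_dist x (vertices p.1) (vertices p.2) - center_dist x (vertices h) (vertices h')|
    <= (radius h - radius p.1) + (radius h' - radius p.2).
Proof.
move=> nh nh' /child_pairsP[c1 c2].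
have := nested_child_center nh c1; have := nested_child_center nh' c2.
rewrite /center_dist.
set a := centroid x (vertices h); set b := centroid x (vertices h').
set a' := centroid x (vertices p.1); set b' := centroid x (vertices p.2).
have t1 := enorm_triangle a' a b'; have t2 := enorm_triangle a b b'.
have t3 := enorm_triangle a a' b; have t4 := enorm_triangle a' b' b.
rewrite (enormB a' a) in t1; rewrite (enormB b' b) in t4.
by move=> H1 H2; rewrite ler_norml; apply/andP; split; lra.
Qed.

(** The centers approach by no more than the radii shrink, which keeps the child balls apart; they
    recede by less than the sum of the parent radii, itself at most the distance, hence the factor
    2. *)
Lemma child_far x h h' p : nested_balls x h -> nested_balls x h' ->
  p \in child_pairs h h' ->
  radius h + radius h' <= center_dist x (vertices h) (vertices h') ->
  radius p.1 + radius p.2 <= center_dist x (vertices p.1) (vertices p.2) /\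
  center_dist x (vertices p.1) (vertices p.2) <= 2 * center_dist x (vertices h) (vertices h').
Proof.
move=> nh nh' ph far; have := child_center_dist nh nh' ph.
have /child_pairsP[/(nested_child nh)/nested_radius_gt0 r1 /(nested_child nh')/nested_radius_gt0 r2] := ph.
by rewrite ler_norml => /andP[]; split; lra.
Qed.

End bsh_structure.

(** * Lower bounds, regularity and blow-up along the recursion *)

Section bsh_potentials.
Context {R : realType} {V : nat}.
Variable eps : R.
Hypothesis eps_gt0 : 0 < eps.
Implicit Types (x y : 'M[R]_(V, 3)) (h : bsh R V).

Local Notation bshP := (bsh_potential eps).
Local Notation coreP := (core_potential eps).
Local Notation D h h' x := (center_dist x (vertices h) (vertices h')).
Local Notation d1 h h' := (radius h + radius h').
Local Notation weight h h' := (blend_weight (vertices h) (vertices h') (d1 h h') ((1 + eps) * (d1 h h'))).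

Lemma bsh_potential_blendedE h h' x : bshP h h' x =
  ((1 - weight h h' x)%:E * coreP h h' x
   + (weight h h' x)%:E * centered_potential (vertices h) (vertices h') x)%E.
Proof. by rewrite bsh_potential_blendE. Qed.

Lemma weight_ge0 h h' x : 0 <= weight h h' x.
Proof. exact: smoothstep_ge0. Qed.

Lemma weight_le1 h h' x : weight h h' x <= 1.
Proof. exact: smoothstep_le1. Qed.

Lemma centered_potential_ge0 (I J : {set 'I_V}) x : (0 <= centered_potential I J x)%E.
Proof.
have := center_dist_ge0 x I J; rewrite le_eqVlt => /orP[/eqP D0|D0].
  by rewrite centered_potential_pinfty // leey.
by rewrite centered_potentialE // lee_fin centered_profile_ge0.
Qed.

Lemma bsh_core_ge0 h h' x : (0 <= bshP h h' x)%E /\ (0 <= coreP h h' x)%E.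
Proof.
move: h h'; apply: bsh_pair_ind => h h' hl; rewrite bsh_potential_blendedE /core_potential.
  rewrite hl; split; last exact: triangle_potential_ge0.
  by rewrite adde_ge0 // mule_ge0 ?lee_fin ?weight_ge0 ?subr_ge0 ?weight_le1 ?triangle_potential_ge0 ?centered_potential_ge0.
move=> IH; rewrite (negPf hl).
have s0 : (0 <= \sum_(p <- child_pairs h h') bshP p.1 p.2 x)%E.
  by rewrite big_seq; apply: sume_ge0 => p /IH[].
by split=> //; rewrite adde_ge0 // mule_ge0 ?lee_fin ?weight_ge0 ?subr_ge0 ?weight_le1 ?centered_potential_ge0.
Qed.

Lemma bsh_potential_ge0 h h' x : (0 <= bshP h h' x)%E.
Proof. by have [] := bsh_core_ge0 h h' x. Qed.

Lemma bsh_potential_depends h h' : depends_only_on (bshP h h') (vertices h :|: vertices h').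
Proof.
move: h h'; apply: bsh_pair_ind => [h h' hl|h h' hl IH] y z yz.
all: have Ih i : i \in vertices h -> row i y = row i z by (move=> ih; apply: yz; rewrite inE ih).
all: have Ih' i : i \in vertices h' -> row i y = row i z by (move=> ih; apply: yz; rewrite inE ih orbT).
all: have De : D h h' y = D h h' z by
  rewrite /center_dist /centroid (eq_bigr (fun i => row i z)) // [X in _ - _ *: X](eq_bigr (fun i => row i z)).
all: rewrite !bsh_potential_blendedE /blend_weight /centered_potential De; congr (_ * _ + _)%E; rewrite /core_potential.
- rewrite hl /triangle_potential.
  suff -> : separation_energy (vertices h) (vertices h') y = separation_energy (vertices h) (vertices h') z by [].
  apply/funext => nd; rewrite /separation_energy; congr (_ + _ + _)%E; apply: eq_bigr => k kt.
    by rewrite Ih.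
  by rewrite Ih'.
- rewrite (negPf hl) big_seq [RHS]big_seq; apply: eq_bigr => p ph; apply: IH => // i.
  have /child_pairsP[/vertices_child/fintype.subsetP s1 /vertices_child/fintype.subsetP s2] := ph.
  by rewrite inE => /orP[/s1/Ih|/s2/Ih'].
Qed.

Section at_configuration.
Variable x : 'M[R]_(V, 3).

Lemma blend_radii h h' : nested_balls x h -> nested_balls x h' ->
  0 < d1 h h' /\ d1 h h' < (1 + eps) * d1 h h'.
Proof.
move=> nh nh'; have d0 : 0 < d1 h h' by rewrite addr_gt0 // (@nested_radius_gt0 _ _ x).
by split=> //; rewrite ltr_pMl // ltrDl.
Qed.

Lemma bsh_potential_near h h' y : nested_balls x h -> nested_balls x h' ->
  D h h' y <= d1 h h' -> bshP h h' y = coreP h h' y.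
Proof.
move=> nh nh' Dd; have [d0 dd] := blend_radii nh nh'.
by rewrite bsh_potential_blendedE blend_weight_le // subr0 mul1e mul0e adde0.
Qed.

(** Both bounds go through the induction together: the blended one is what the parent sums, and it
    follows from the other because a blend is a convex combination. *)
Lemma core_ge_centered h h' : nested_balls x h -> nested_balls x h' ->
  d1 h h' <= D h h' x ->
  (centered_potential (vertices h) (vertices h') x <= coreP h h' x)%E /\
  (centered_potential (vertices h) (vertices h') x <= bshP h h' x)%E.
Proof.
move: h h'; apply: bsh_pair_ind => h h' hl; last move=> IH; move=> nh nh' far.
all: have [d0 dd] := blend_radii nh nh'; have D0 : 0 < D h h' x by exact: lt_le_trans far.
all: suff H : (centered_potential (vertices h) (vertices h') x <= coreP h h' x)%E.
  1, 3: split=> //; rewrite bsh_potential_blendedE.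
  (* The centered potential is written as a blend of itself with itself and compared termwise. *)
  1, 2: rewrite -[X in (X <= _)%E]mul1e -[1%E in X in (X <= _)%E]/(1%:E) -[1 in X in (X <= _)%E](subrK (weight h h' x)).
  1, 2: rewrite EFinD ge0_muleDl ?lee_fin ?subr_ge0 ?weight_ge0 ?weight_le1 //.
  1, 2: by apply: leeD => //; apply: lee_wpmul2l; rewrite // lee_fin subr_ge0 weight_le1.
- rewrite /core_potential hl; apply: triangle_potential_ge_centered => //.
    by case/andP: hl => /leaves_leaf lh _; apply: (nested_leaf_card nh); rewrite lh mem_head.
  by case/andP: hl => _ /leaves_leaf lh; apply: (nested_leaf_card nh'); rewrite lh mem_head.
- rewrite /core_potential (negPf hl) centered_potentialE //.
  have child p : p \in child_pairs h h' ->
      ((centered_profile (2 * D h h' x))%:E <= bshP p.1 p.2 x)%E.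
    move=> ph; have [far' D2] := child_far nh nh' ph far.
    have /child_pairsP[c1 c2] := ph.
    have n1 := nested_child nh c1; have n2 := nested_child nh' c2.
    have [dp0 _] := blend_radii n1 n2; have Dp0 : 0 < D p.1 p.2 x by exact: lt_le_trans far'.
    have [_ H] := IH p ph n1 n2 far'; apply: le_trans H.
    by rewrite centered_potentialE // lee_fin; exact: centered_profile_le.
  (* One of the nodes is internal, so there are at least two child pairs; any further ones are
     nonnegative. *)
  have [p [q [s E]]] : exists p q s, child_pairs h h' = p :: q :: s.
    move: hl; rewrite /child_pairs; clear; case: h => [t r|a b r]; case: h' => [t' r'|a' b' r'] //= _;
    by do 3 eexists.
  rewrite E !big_cons.
  have sp := child p; have sq := child q; rewrite E in sp sq.
  have {}sp := sp (mem_head _ _); have {}sq : _ := sq ltac:(by rewrite !inE eqxx orbT).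
  apply: (@le_trans _ _ ((centered_profile (2 * D h h' x))%:E + (centered_profile (2 * D h h' x))%:E)%E).
    by rewrite -EFinD lee_fin; have := centered_profile_double D0; lra.
  apply: leeD => //; apply: (le_trans sq); apply: leeDl.
  by apply: sume_ge0 => u _; exact: bsh_potential_ge0.
Qed.

Definition separable_leaves h h' : Prop :=
  forall t t', t \in leaves h -> t' \in leaves h' -> separable t t' x.

Lemma separable_leaves_child h h' p : separable_leaves h h' ->
  p \in child_pairs h h' -> separable_leaves p.1 p.2.
Proof.
move=> sl /child_pairsP[c1 c2] t t' tp tp'.
by apply: sl; [exact: leaves_child c1 tp|exact: leaves_child c2 tp'].
Qed.

Lemma vertices_child_disjoint h h' p : fintype.disjoint (mem (vertices h)) (mem (vertices h')) ->
  p \in child_pairs h h' -> fintype.disjoint (mem (vertices p.1)) (mem (vertices p.2)).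
Proof.
move=> dh /child_pairsP[/vertices_child s1 /vertices_child s2].
exact: disjointWl s1 (disjointWr s2 dh).
Qed.

Lemma leaf_neq0 h t : nested_balls x h -> t \in leaves h -> t != finset.set0.
Proof. by move=> nh tl; rewrite -card_gt0 (nested_leaf_card nh tl). Qed.

Lemma sum_locally_finite (T : eqType) (s : seq T) (P : T -> 'M[R]_(V, 3) -> \bar R)
    (F : T -> 'M[R]_(V, 3) -> R) :
  (forall p, p \in s -> \forall y \near x, P p y = (F p y)%:E) ->
  \forall y \near x, (\sum_(p <- s) P p y)%E = (\sum_(p <- s) F p y)%:E.
Proof.
elim: s => [_|p s IH H]; first by apply: near_all => y; rewrite !big_nil.
have Hs : forall q, q \in s -> \forall y \near x, P q y = (F q y)%:E.
  by move=> q qs; apply: H; rewrite inE qs orbT.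
by apply: nearS2 (H p (mem_head _ _)) (IH Hs) => y; rewrite !big_cons => -> ->; rewrite EFinD.
Qed.

(* Closer than [d1] the potential is the sum over the children and need not be
   non-prehensile for this pair of nodes. *)
Definition regular_at h h' (P : 'M[R]_(V, 3) -> \bar R) (f : 'M[R]_(V, 3) -> R) : Prop :=
  [/\ \forall y \near x, P y = (f y)%:E, smooth2 f x &
      is_leaf h && is_leaf h' \/ d1 h h' <= D h h' x ->
      nonprehensile_grad f (vertices h) (vertices h') x].

(** When [D < d1], an open condition, the node agrees locally with its core. When [d1 <= D] it is a
    blend, and at equality the blend formula holds on both sides because the weight vanishes below
    [d1], so the transition is as smooth as the weight. *)
Lemma bsh_potential_regular h h' : nested_balls x h -> nested_balls x h' ->
  fintype.disjoint (mem (vertices h)) (mem (vertices h')) -> separable_leaves h h' ->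
  exists f, regular_at h h' (bshP h h') f.
Proof.
move: h h'; apply: bsh_pair_ind => h h' hl; last move=> IH; move=> nh nh' dh sl.
all: have [d0 dd] := blend_radii nh nh'.
all: have V0 := nested_vertices_neq0 nh; have V0' := nested_vertices_neq0 nh'.
all: suff [f [Pf sf npf]] : exists f, regular_at h h' (coreP h h') f.
  1, 3: have [near_|far] := ltP (D h h' x) (d1 h h').
  1, 3: exists f; split => //; have near_D : \forall y \near x, D h h' y < d1 h h'
      by exact: (@center_dist_continuous _ _ _ _ x _ (lt_nbhsl near_)).
  1, 2: by apply: nearS2 Pf near_D => y <- /ltW; exact: bsh_potential_near.
  1, 2: have D0 : 0 < D h h' x by exact: lt_le_trans far.
  1, 2: exists (blend (vertices h) (vertices h') (d1 h h') ((1 + eps) * (d1 h h')) f); split.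
  1, 4: have near_D : \forall y \near x, 0 < D h h' y
      by exact: (@center_dist_continuous _ _ _ _ x _ (lt_nbhsr D0)).
  1, 2: by apply: nearS2 Pf near_D => y Py Dy; rewrite bsh_potential_blendedE Py centered_potentialE.
  1, 3: exact: blend_smooth2.
  1, 2: move=> _; apply: blend_nonprehensile => //; [exact: smooth2_differentiable|
      |by apply: npf; right].
  1, 2: rewrite -lee_fin -(nbhs_singleton Pf) -centered_potentialE //.
  1, 2: by have [] := core_ge_centered nh nh' far.
- case/andP: (hl) => /leaves_leaf lh /leaves_leaf lh'.
  have sx : separable (vertices h) (vertices h') x by apply: sl; rewrite ?lh ?lh' mem_head.
  exists (min_energy (vertices h) (vertices h')); split.
  + by apply: nearS (near_separable sx) => y sy; rewrite /core_potential hl triangle_potentialE.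
  + exact: min_energy_smooth2.
  + by move=> _; exact: triangle_nonprehensile_grad.
- have /choice[F HF] p : exists f,
      p \in child_pairs h h' -> regular_at p.1 p.2 (bshP p.1 p.2) f.
    have [ph|ph] := pselect (p \in child_pairs h h'); last by exists (fun=> 0).
    have /child_pairsP[c1 c2] := ph.
    have [f Hf] := IH p ph (nested_child nh c1) (nested_child nh' c2)
      (vertices_child_disjoint dh ph) (separable_leaves_child sl ph).
    by exists f.
  exists (fun y => \sum_(p <- child_pairs h h') F p y); split.
  + have H : \forall y \near x, (\sum_(p <- child_pairs h h') bshP p.1 p.2 y)%E =
        (\sum_(p <- child_pairs h h') F p y)%:E.
      by apply: sum_locally_finite => p /HF[].
    by apply: nearS H => y <-; rewrite /core_potential (negPf hl).
  + apply: (near_eq_smooth2 (f := fun y => \sum_(p <- child_pairs h h' | p \in child_pairs h h') F p y)).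
      by apply: near_all => y; rewrite -big_seq.
    by apply: smooth2_sum => p /HF[].
  + move=> [|far]; first by rewrite (negPf hl).
    apply: (@nonprehensile_grad_sum _ _ _ _ _ (fun p => vertices p.1) (fun p => vertices p.2)) => //.
    * move=> p ph; have [_ sp np] := HF p ph; have /child_pairsP[c1 c2] := ph.
      split; [exact: smooth2_differentiable| |exact: vertices_child|exact: vertices_child].
      by apply: np; right; have [] := child_far nh nh' ph far.
    * move=> i /vertex_in_child[c ch ic]; have [c' ch'] := children_neq0 h'.
      by exists (c, c') => //; apply/child_pairsP.
    * move=> i /vertex_in_child[c' ch' ic]; have [c ch] := children_neq0 h.
      by exists (c, c') => //; apply/child_pairsP.
Qed.

(** Disjoint enclosing balls would separate the two triangles. Hence every pair of nodes above a
    non-separable pair of leaves has weight 0 at [x], and blending never hides the collision. *)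
Lemma nonseparable_near h h' t t' : nested_balls x h -> nested_balls x h' ->
  t \in leaves h -> t' \in leaves h' -> ~ separable t t' x -> D h h' x <= d1 h h'.
Proof.
move=> nh nh' tl tl' ns; rewrite leNgt; apply/negP => far; apply: ns.
apply/separableP; [exact: leaf_neq0 tl|exact: leaf_neq0 tl'|].
apply: far_balls_CH far => i it; apply: nested_vertex => //.
  exact: (fintype.subsetP (leaf_sub_vertices tl)).
exact: (fintype.subsetP (leaf_sub_vertices tl')).
Qed.

(** The weight is 0 at [x], but when [D = d1] it can be positive arbitrarily near. Continuity keeps
    it below 1/2, at the price of a factor 2 in the bound for each level of the recursion. *)
Lemma core_blowup_bsh h h' (M : R) : nested_balls x h -> nested_balls x h' ->
  D h h' x <= d1 h h' -> 0 < M ->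
  (\forall y \near x, ((2 * M)%:E < coreP h h' y)%E) -> \forall y \near x, (M%:E < bshP h h' y)%E.
Proof.
move=> nh nh' Dd M0 H; have [d0 dd] := blend_radii nh nh'.
have W : \forall y \near x, weight h h' y < 2^-1.
  have W0 : weight h h' x < 2^-1 by rewrite blend_weight_le // invr_gt0.
  exact: (@blend_weight_continuous _ _ _ _ _ _ x _ (lt_nbhsl W0)).
apply: nearS2 H W => y Hy Wy; rewrite bsh_potential_blendedE.
have w1 : 2^-1 < 1 - weight h h' y by lra.
apply: (@lt_le_trans _ _ ((1 - weight h h' y)%:E * coreP h h' y)%E); last first.
  by apply: leeDl; rewrite mule_ge0 ?lee_fin ?weight_ge0 ?centered_potential_ge0.
apply: (@lt_le_trans _ _ ((2^-1)%:E * coreP h h' y)%E); last first.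
  by apply: lee_wpmul2r; [have [] := bsh_core_ge0 h h' y|rewrite lee_fin ltW].
have -> : M = 2^-1 * (2 * M) by rewrite mulrA mulVf ?mul1r.
by rewrite EFinM lte_pmul2l // lte_fin invr_gt0.
Qed.

Lemma bsh_potential_blowup h h' t t' (M : R) : nested_balls x h -> nested_balls x h' ->
  t \in leaves h -> t' \in leaves h' -> ~ separable t t' x ->
  0 < M -> \forall y \near x, (M%:E < bshP h h' y)%E.
Proof.
move: h h' M; apply: bsh_pair_ind => h h' hl; last move=> IH; move=> M nh nh' tl tl' ns M0.
all: have Dd := nonseparable_near nh nh' tl tl' ns; apply: core_blowup_bsh => //.
- case/andP: (hl) => /leaves_leaf lh /leaves_leaf lh'.
  move: tl tl' ns; rewrite lh lh' !mem_seq1 => /eqP -> /eqP -> ns.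
  rewrite /core_potential hl; apply: triangle_potential_blowup => //.
    exact: nested_vertices_neq0 nh.
  exact: nested_vertices_neq0 nh'.
- have [p ph [tp tp']] := leaf_pair_in_child tl tl'; have /child_pairsP[c1 c2] := ph.
  have M2 : 0 < 2 * M by rewrite mulr_gt0.
  have H := IH p ph _ (nested_child nh c1) (nested_child nh' c2) tp tp' ns M2.
  apply: nearS H => y; rewrite /core_potential (negPf hl) => /lt_le_trans; apply.
  rewrite (big_rem p) //=; apply: leeDl; apply: sume_ge0 => q _.
  exact: bsh_potential_ge0.
Qed.

Lemma bsh_potential_pinfty h h' t t' : nested_balls x h -> nested_balls x h' ->
  t \in leaves h -> t' \in leaves h' -> ~ separable t t' x -> bshP h h' x = +oo%E.
Proof.
move=> nh nh' tl tl' ns; apply: eq_infty => M.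
have M0 : 0 < `|M| + 1 by rewrite ltr_pwDr.
have := nbhs_singleton (bsh_potential_blowup nh nh' tl tl' ns M0).
by move=> /ltW; apply: le_trans; rewrite lee_fin (le_trans (ler_norm _)) // lerDl.
Qed.

(** In the tangent case the common vertex position belongs to one triangle of each node, whose hulls
    then meet, contrary to [separable_leaves]. *)
Lemma touching_disjoint h h' : nested_balls x h -> nested_balls x h' ->
  separable_leaves h h' -> is_leaf h && is_leaf h' \/ d1 h h' <= D h h' x ->
  CH x (vertices h) `&` CH x (vertices h') = set0.
Proof.
move=> nh nh' sl [/andP[/leaves_leaf lh /leaves_leaf lh']|].
  apply/separableP; [exact: nested_vertices_neq0 nh|exact: nested_vertices_neq0 nh'|].
  by apply: sl; rewrite ?lh ?lh' mem_head.
have b1 i : i \in vertices h -> _ := @nested_vertex _ _ x h i nh.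
have b2 i : i \in vertices h' -> _ := @nested_vertex _ _ x h' i nh'.
rewrite le_eqVlt => /orP[/eqP touch|]; last exact: far_balls_CH.
have [//|/set0P ne] := eqVneq (CH x (vertices h) `&` CH x (vertices h')) set0.
have r0 := nested_radius_gt0 nh; have r0' := nested_radius_gt0 nh'.
have [i [j [ih jh ij]]] := touching_balls_CH (ltW r0) (ltW r0') (addr_gt0 r0 r0') b1 b2 (esym touch) ne.
have /mem_vertices[t tl it] := ih; have /mem_vertices[t' tl' jt'] := jh.
have /separableP := sl t t' tl tl'.
move=> /(_ (leaf_neq0 nh tl) (leaf_neq0 nh' tl')) E.
have : (CH x t `&` CH x t') (row i x).
  by split; [exact: CH_row|rewrite ij; exact: CH_row].
by rewrite E.
Qed.

Definition active_pair h h' (p : bsh R V * bsh R V) : Prop :=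
  [/\ vertices p.1 \subset vertices h, vertices p.2 \subset vertices h',
      CH x (vertices p.1) `&` CH x (vertices p.2) = set0 &
      exists f, [/\ \forall y \near x, bshP p.1 p.2 y = (f y)%:E, smooth2 f x &
        nonprehensile_grad f (vertices p.1) (vertices p.2) x]].

(** The recursion descends only where [D < d1] strictly. This is open, so the node equals the sum
    over its children in a whole neighbourhood and the decomposition can be differentiated. *)
Lemma bsh_active_pairs h h' : nested_balls x h -> nested_balls x h' ->
  fintype.disjoint (mem (vertices h)) (mem (vertices h')) -> separable_leaves h h' ->
  exists s : seq (bsh R V * bsh R V),
    [/\ forall p, p \in s -> active_pair h h' p,
        \forall y \near x, bshP h h' y = (\sum_(p <- s) bshP p.1 p.2 y)%E &
        forall t t', t \in leaves h -> t' \in leaves h' ->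
          exists2 p, p \in s & t \subset vertices p.1 /\ t' \subset vertices p.2].
Proof.
move: h h'; apply: bsh_pair_ind => h h' hl; last move=> IH; move=> nh nh' dh sl.
all: have stop : is_leaf h && is_leaf h' \/ d1 h h' <= D h h' x ->
    exists s : seq (bsh R V * bsh R V),
    [/\ forall p, p \in s -> active_pair h h' p,
        \forall y \near x, bshP h h' y = (\sum_(p <- s) bshP p.1 p.2 y)%E &
        forall t t', t \in leaves h -> t' \in leaves h' ->
          exists2 p, p \in s & t \subset vertices p.1 /\ t' \subset vertices p.2].
  1, 3: move=> st; exists [:: (h, h')]; split.
  1, 4: move=> p; rewrite mem_seq1 => /eqP ->; split => //=; first exact: touching_disjoint.
  1, 2: by have [f [f1 f2 f3]] := bsh_potential_regular nh nh' dh sl; exists f; split=> //; exact: f3.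
  1, 3: by apply: near_all => y; rewrite big_seq1.
  1, 2: move=> t t' tl tl'; exists (h, h'); rewrite ?mem_head //=.
  1, 2: by split; exact: leaf_sub_vertices.
- by apply: stop; left.
- have [near_|far] := ltP (D h h' x) (d1 h h'); last by apply: stop; right.
  pose Q (p : bsh R V * bsh R V) (s : seq (bsh R V * bsh R V)) :=
    [/\ forall q, q \in s -> active_pair h h' q,
        \forall y \near x, bshP p.1 p.2 y = (\sum_(q <- s) bshP q.1 q.2 y)%E &
        forall t t', t \in leaves p.1 -> t' \in leaves p.2 ->
          exists2 q, q \in s & t \subset vertices q.1 /\ t' \subset vertices q.2].
  have /choice[S HS] p : exists s, p \in child_pairs h h' -> Q p s.
    have [ph|ph] := pselect (p \in child_pairs h h'); last by exists [::].
    have /child_pairsP[c1 c2] := ph.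
    have [s [s1 s2 s3]] := IH p ph (nested_child nh c1) (nested_child nh' c2)
      (vertices_child_disjoint dh ph) (separable_leaves_child sl ph).
    exists s => _; split => // q /s1[v1 v2 ? ?]; split => //.
      by apply: (fintype.subset_trans v1); exact: vertices_child.
    by apply: (fintype.subset_trans v2); exact: vertices_child.
  exists (flatten [seq S p | p <- child_pairs h h']); split.
  + by move=> q /flatten_mapP[p /HS[H _ _]] /H.
  + have near_D : \forall y \near x, D h h' y < d1 h h'.
      exact: (@center_dist_continuous _ _ _ _ x _ (lt_nbhsl near_)).
    have H : \forall y \near x, (\sum_(p <- child_pairs h h') bshP p.1 p.2 y)%E =
        (\sum_(p <- flatten [seq S p | p <- child_pairs h h']) bshP p.1 p.2 y)%E.
      have : forall p, p \in child_pairs h h' ->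
          \forall y \near x, bshP p.1 p.2 y = (\sum_(q <- S p) bshP q.1 q.2 y)%E by move=> p /HS[].
      elim: (child_pairs h h') => [_|p r IHr Hr]; first by apply: near_all => y; rewrite !big_nil.
      have Hr' q : q \in r -> \forall y \near x, bshP q.1 q.2 y = (\sum_(q <- S q) bshP q.1 q.2 y)%E.
        by move=> qr; apply: Hr; rewrite inE qr orbT.
      by apply: nearS2 (Hr p (mem_head _ _)) (IHr Hr') => y E1 E2; rewrite big_cons /= big_cat -E2 E1.
    apply: nearS2 near_D H => y Dy <-.
    by rewrite bsh_potential_near ?(ltW Dy) // /core_potential (negPf hl).
  + move=> t t' tl tl'; have [p ph [tp tp']] := leaf_pair_in_child tl tl'.
    have [_ _ H] := HS p ph; have [q qs tq] := H _ _ tp tp'.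
    by exists q => //; apply/flatten_mapP; exists p.
Qed.

End at_configuration.

End bsh_potentials.

Lemma blowup_continuous (R : realType) (W : normedModType R) (P : W -> \bar R) (x : W) : P x = +oo%E ->
  (forall M : R, 0 < M -> \forall y \near x, (M%:E < P y)%E) -> {for x, continuous P}.
Proof.
move=> Px H; apply: (@cvg_trans _ (nbhs +oo%E)); last by rewrite Px.
apply/cvgeyPgt => M.
have M0 : 0 < `|M| + 1 by rewrite ltr_pwDr.
apply: filterS (H _ M0) => y; apply: le_lt_trans.
by rewrite lee_fin (le_trans (ler_norm _)) // lerDl.
Qed.

(** * From real representatives to extended-valued potentials *)

Section transfer.
Context {R : realType} {V : nat}.
Implicit Types (x : 'M[R]_(V, 3)) (P : 'M[R]_(V, 3) -> \bar R) (f : 'M[R]_(V, 3) -> R).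

Lemma near_fine P f x : (\forall y \near x, P y = (f y)%:E) ->
  \forall y \near x, f y = (fine \o P) y.
Proof. by apply: nearS => y /= ->. Qed.

Lemma near_finite P f x : (\forall y \near x, P y = (f y)%:E) -> finite_near P x.
Proof. by apply: nearS => y ->. Qed.

Lemma smooth2_twice_differentiable P f x :
  (\forall y \near x, P y = (f y)%:E) -> smooth2 f x -> twice_differentiable P x.
Proof.
move=> Pf sf; have [d dd] := near_eq_smooth2 (near_fine Pf) sf.
by split=> //; exact: near_finite Pf.
Qed.

Lemma nonprehensile_gradW P f (I J : {set 'I_V}) x :
  (\forall y \near x, P y = (f y)%:E) -> smooth2 f x ->
  nonprehensile_grad f I J x -> nonprehensile P I J x.
Proof.
move=> Pf sf npf; have s := near_eq_smooth2 (near_fine Pf) sf.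
have [HI HJ _] := near_eq_nonprehensile_grad (near_fine Pf) npf.
by split=> //; [exact: near_finite Pf|exact: smooth2_differentiable].
Qed.

Lemma finite_continuous P f x :
  (\forall y \near x, P y = (f y)%:E) -> smooth2 f x -> {for x, continuous P}.
Proof.
move=> Pf sf; have fc := smooth2_continuous sf.
move=> A; rewrite (nbhs_singleton Pf) => PA.
have fA : \forall y \near x, A (f y)%:E by exact: fc PA.
by apply: nearS2 Pf fA => y /= ->.
Qed.

End transfer.

(** * The total potential *)

Section total.
Context (R : realType) (V B : nat) (body : 'I_V -> 'I_B)
    (T : {set {set 'I_V}}) (C : set 'M[R]_(V, 3)) (h : 'I_B -> bsh R V) (eps : R).
Hypotheses (T_triangles : triangulation body T)
  (h_bsh : forall b, is_bsh C (body_triangles body T b) (h b)) (eps_gt0 : 0 < eps).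
Implicit Types (x y : 'M[R]_(V, 3)).

Local Notation bshP b b' := (bsh_potential eps (h b) (h b')).
Local Notation totalP := (total_potential eps h).

Lemma mem_leaves b t : (t \in leaves (h b)) = (t \in T) && on_body body b t.
Proof.
have [/perm_mem lT _] := h_bsh b.
by rewrite lT mem_enum inE.
Qed.

Lemma on_bodyP b (t : {set 'I_V}) : reflect (forall i, i \in t -> body i = b) (on_body body b t).
Proof.
apply: (iffP forall_inP) => [H i it|H i it]; first exact/eqP/H.
exact/eqP/H.
Qed.

Lemma nested_body x b : C x -> nested_balls x (h b).
Proof.
move=> Cx; have [_ vr] := h_bsh b; apply: (valid_radii_nested Cx vr) => t.
by rewrite mem_leaves => /andP[/T_triangles[]].
Qed.

Lemma vertices_body b i : i \in vertices (h b) -> body i = b.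
Proof.
by move=> /mem_vertices[t]; rewrite mem_leaves => /andP[_ /on_bodyP H] /H.
Qed.

Lemma body_disjoint b b' : b != b' ->
  fintype.disjoint (mem (vertices (h b))) (mem (vertices (h b'))).
Proof.
move=> bb; rewrite disjoint_subset; apply/fintype.subsetP => i /vertices_body ib.
by rewrite inE; apply/negP => /vertices_body ib'; rewrite -ib -ib' eqxx in bb.
Qed.

Lemma free_separable x b b' : C_free body T C x -> b != b' ->
  separable_leaves x (h b) (h b').
Proof.
move=> [Cx nobs] bb t t'; rewrite !mem_leaves => /andP[tT tb] /andP[tT' tb'].
have [t3 _] := T_triangles tT; have [t3' _] := T_triangles tT'.
have t0 : t != finset.set0 by rewrite -card_gt0 t3.
have t0' : t' != finset.set0 by rewrite -card_gt0 t3'.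
apply/separableP => //; have [//|/set0P ne] := eqVneq (CH x t `&` CH x t') set0.
exfalso; apply: nobs; split=> //; exists t, t'; split => //; last by exists b, b'.
(* [C_obs] asks for distinct triangles: a nonempty triangle cannot lie on two bodies. *)
apply/eqP => tt; move: tb'; rewrite -tt => /on_bodyP H'.
have /finset.set0Pn[i it] := t0; move: tb => /on_bodyP H.
by move: bb; rewrite -(H i it) -(H' i it) eqxx.
Qed.

Lemma ltn_neq_ord (b b' : 'I_B) : (b < b')%N -> b != b'.
Proof. by rewrite ltn_neqAle => /andP[]. Qed.

Lemma obs_pair x : C_obs body T C x -> exists (b b' : 'I_B) t t',
  [/\ (b < b')%N, t \in leaves (h b), t' \in leaves (h b') & ~ separable t t' x].
Proof.
move=> [Cx [t [t' [tT tT' _ [b [b' [bb tb tb']]] ne]]]].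
have [t3 _] := T_triangles tT; have [t3' _] := T_triangles tT'.
have t0 : t != finset.set0 by rewrite -card_gt0 t3.
have t0' : t' != finset.set0 by rewrite -card_gt0 t3'.
have [lt|lt|/val_inj E] := ltngtP b b'; last by rewrite E eqxx in bb.
- exists b, b', t, t'; rewrite !mem_leaves tT tT' tb tb'; split=> //.
  by move=> /(separableP t0 t0' x).1 E; move: ne; rewrite E => -[].
- exists b', b, t', t; rewrite !mem_leaves tT tT' tb tb'; split=> //.
  by move=> /(separableP t0' t0 x).1 E; move: ne; rewrite setIC E => -[].
Qed.

Definition body_pairs : seq ('I_B * 'I_B) :=
  [seq p : 'I_B * 'I_B <- index_enum _ | (p.1 < p.2)%N].

Lemma mem_body_pairs (p : 'I_B * 'I_B) : (p \in body_pairs) = (p.1 < p.2)%N.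
Proof. by rewrite mem_filter mem_index_enum andbT. Qed.

Lemma total_potentialE x : totalP x = (\sum_(p <- body_pairs) bshP p.1 p.2 x)%E.
Proof. by rewrite /total_potential pair_big_dep /= big_filter. Qed.

Lemma total_ge0 x : (0 <= totalP x)%E.
Proof. by rewrite total_potentialE; apply: sume_ge0 => p _; exact: bsh_potential_ge0. Qed.

Lemma total_ge_pair x (b b' : 'I_B) : (b < b')%N -> (bshP b b' x <= totalP x)%E.
Proof.
move=> bb; rewrite total_potentialE (big_rem (b, b')) ?mem_body_pairs //=.
by apply: leeDl; apply: sume_ge0 => p _; exact: bsh_potential_ge0.
Qed.

Lemma total_regular x : C_free body T C x ->
  exists f, (\forall y \near x, totalP y = (f y)%:E) /\ smooth2 f x.
Proof.
move=> fx; have [Cx _] := fx.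
have /choice[F HF] p : exists f, p \in body_pairs ->
    (\forall y \near x, bshP p.1 p.2 y = (f y)%:E) /\ smooth2 f x.
  have [pb|pb] := pselect (p \in body_pairs); last by exists (fun=> 0).
  have bb : p.1 != p.2 by apply: ltn_neq_ord; rewrite -mem_body_pairs.
  have [f [f1 f2 _]] := bsh_potential_regular eps_gt0 (nested_body p.1 Cx) (nested_body p.2 Cx)
    (body_disjoint bb) (free_separable fx bb).
  by exists f.
exists (fun y => \sum_(p <- body_pairs) F p y); split.
  have H := sum_locally_finite (x := x) (fun p pb => (HF p pb).1).
  by apply: nearS H => y <-; rewrite total_potentialE.
apply: (near_eq_smooth2 (f := fun y => \sum_(p <- body_pairs | p \in body_pairs) F p y)).
  by apply: near_all => y; rewrite -big_seq.
by apply: smooth2_sum => p /HF[].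
Qed.

Lemma total_obs x : C_obs body T C x ->
  totalP x = +oo%E /\ forall M : R, 0 < M -> \forall y \near x, (M%:E < totalP y)%E.
Proof.
move=> ox; have [Cx _] := ox; have [b [b' [t [t' [bb tl tl' ns]]]]] := obs_pair ox.
have nb := nested_body b Cx; have nb' := nested_body b' Cx; split.
  apply/eqP; rewrite -leye_eq -(bsh_potential_pinfty eps_gt0 nb nb' tl tl' ns).
  exact: total_ge_pair.
move=> M M0; have H := bsh_potential_blowup eps_gt0 nb nb' tl tl' ns M0.
by apply: nearS H => y /lt_le_trans; apply; exact: total_ge_pair.
Qed.

(** Continuity is proved in the whole space at each point of [C]: by blow-up at obstacles, by a real
    representative elsewhere. *)
Lemma total_log_barrier : log_barrier C (C_obs body T C) totalP.
Proof.
split; first by move=> x _; exact: total_ge0.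
- apply: continuous_in_subspaceT => x; rewrite inE => Cx.
  have [/total_obs[Px H]|nobs] := pselect (C_obs body T C x).
    exact: blowup_continuous.
  have [f [Pf sf]] := @total_regular x (conj Cx nobs).
  exact: finite_continuous Pf sf.
- move=> x Cx; split=> [Px|/total_obs[] //].
  apply: contrapT => nobs; have [f [/nbhs_singleton Pf _]] := @total_regular x (conj Cx nobs).
  by rewrite Pf in Px.
Qed.

Lemma total_smooth : smooth_on (C_free body T C) totalP.
Proof.
move=> x /total_regular[f [Pf sf]]; exact: smooth2_twice_differentiable Pf sf.
Qed.

Lemma total_nonprehensile :
  nonprehensile_nonvanishing body T (C_free body T C) totalP.
Proof.
move=> x fx; have [Cx _] := fx.
pose good p (s : seq (bsh R V * bsh R V)) :=
  [/\ forall q, q \in s -> active_pair eps x (h p.1) (h p.2) q,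
      \forall y \near x, bshP p.1 p.2 y = (\sum_(q <- s) bsh_potential eps q.1 q.2 y)%E &
      forall t t', t \in leaves (h p.1) -> t' \in leaves (h p.2) ->
        exists2 q, q \in s & t \subset vertices q.1 /\ t' \subset vertices q.2].
have /choice[S HS] p : exists s, p \in body_pairs -> good p s.
  have [pb|pb] := pselect (p \in body_pairs); last by exists [::].
  have bb : p.1 != p.2 by apply: ltn_neq_ord; rewrite -mem_body_pairs.
  have [s Hs] := bsh_active_pairs eps_gt0 (nested_body p.1 Cx) (nested_body p.2 Cx)
    (body_disjoint bb) (free_separable fx bb).
  by exists s.
pose s := flatten [seq S p | p <- body_pairs].
pose key (q : bsh R V * bsh R V) := (vertices q.1, vertices q.2).
pose A := [set v | v \in [seq key q | q <- s]]%SET.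
(* Distinct pairs of nodes may have the same vertex sets: their potentials are added. *)
pose Q I J y := (\sum_(q <- s | key q == (I, J)) bsh_potential eps q.1 q.2 y)%E.
have s_active q : q \in s -> exists b b', b != b' /\ active_pair eps x (h b) (h b') q.
  move=> /flatten_mapP[p pb /(let: And3 H _ _ := HS p pb in H) aq].
  by exists p.1, p.2; split => //; apply: ltn_neq_ord; rewrite -mem_body_pairs.
have totalE : \forall y \near x, totalP y = (\sum_(q <- s) bsh_potential eps q.1 q.2 y)%E.
  have H : \forall y \near x, (\sum_(p <- body_pairs) bshP p.1 p.2 y)%E =
      (\sum_(q <- s) bsh_potential eps q.1 q.2 y)%E.
    have : forall p, p \in body_pairs -> \forall y \near x, bshP p.1 p.2 y =
        (\sum_(q <- S p) bsh_potential eps q.1 q.2 y)%E by move=> p /HS[].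
    rewrite /s; elim: body_pairs => [_|p r IHr Hr]; first by apply: near_all => y; rewrite !big_nil.
    have Hr' q : q \in r -> \forall y \near x, bshP q.1 q.2 y =
        (\sum_(u <- S q) bsh_potential eps u.1 u.2 y)%E.
      by move=> qr; apply: Hr; rewrite inE qr orbT.
    by apply: nearS2 (Hr p (mem_head _ _)) (IHr Hr') => y E1 E2; rewrite big_cons /= big_cat -E2 E1.
  by apply: nearS H => y <-; rewrite total_potentialE.
have /choice[F HF] q : exists f, q \in s ->
    [/\ \forall y \near x, bsh_potential eps q.1 q.2 y = (f y)%:E, smooth2 f x &
        nonprehensile_grad f (vertices q.1) (vertices q.2) x].
  have [qs|qs] := pselect (q \in s); last by exists (fun=> 0).
  by have [b [b' [_ [_ _ _ [f Hf]]]]] := s_active q qs; exists f.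
exists A, Q; split.
- move=> I J; rewrite inE => /mapP[q0 q0s [EI EJ]].
  have [b [b' [bb [sI sJ dis _]]]] := s_active q0 q0s.
  have dIJ : fintype.disjoint (mem I) (mem J).
    by rewrite EI EJ; exact: disjointWl sI (disjointWr sJ (body_disjoint bb)).
  split.
  + by apply: finset.disjoint_setI0.
  + by rewrite EI EJ.
  + move=> y z yz; apply: eq_bigr => q /eqP [E1 E2].
    by apply: bsh_potential_depends => i; rewrite E1 E2; exact: yz.
  + pose s' := [seq q <- s | key q == (I, J)].
    have s'P q : q \in s' -> [/\ q \in s, vertices q.1 = I & vertices q.2 = J].
      by rewrite mem_filter => /andP[/eqP [E1 E2] qs].
    have Qf : \forall y \near x, Q I J y = (\sum_(q <- s') F q y)%:E.
      have H : \forall y \near x, (\sum_(q <- s') bsh_potential eps q.1 q.2 y)%E = (\sum_(q <- s') F q y)%:E.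
        by apply: sum_locally_finite => q /s'P[/HF[]].
      by apply: nearS H => y <-; rewrite /Q big_filter.
    have sQ : smooth2 (fun y => \sum_(q <- s') F q y) x.
      apply: (near_eq_smooth2 (f := fun y => \sum_(q <- s' | q \in s') F q y)).
        by apply: near_all => y; rewrite -big_seq.
      by apply: smooth2_sum => q /s'P[/HF[]].
    apply: (nonprehensile_gradW Qf sQ).
    have q0s' : q0 \in s' by rewrite mem_filter q0s /key EI EJ eqxx.
    apply: (@nonprehensile_grad_sum _ _ _ s' F (fun q => vertices q.1) (fun q => vertices q.2)) => //.
    * move=> q /s'P[qs <- <-]; have [_ sq nq] := HF q qs.
      by split=> //; exact: smooth2_differentiable.
    * by move=> i iI; exists q0; rewrite -?EI.
    * by move=> j jJ; exists q0; rewrite -?EJ.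
- apply: nearS totalE => y ->; rewrite big_seq.
  have keyA q : q \in s -> key q \in A by move=> qs; rewrite inE; apply/mapP; exists q.
  rewrite (partition_big key (fun v => v \in A)) //.
  apply: eq_bigr => -[I J] _; rewrite /Q [RHS]big_seq_cond.
  by apply: eq_bigl => q.
- move=> t t' tT tT' [b [b' [bb tb tb']]].
  have tl : t \in leaves (h b) by rewrite mem_leaves tT.
  have tl' : t' \in leaves (h b') by rewrite mem_leaves tT'.
  have cover p u u' : p \in body_pairs -> u \in leaves (h p.1) -> u' \in leaves (h p.2) ->
      exists I J, (I, J) \in A /\ u :|: u' \subset I :|: J.
    move=> pb ul ul'; have [_ _ H] := HS p pb; have [q qs [uq uq']] := H _ _ ul ul'.
    exists (vertices q.1), (vertices q.2); split; last exact: finset.setUSS.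
    by rewrite inE; apply/mapP; exists q => //; apply/flatten_mapP; exists p.
  (* Only ordered pairs of bodies are summed; in the opposite order the triangles exchange roles and
     the union is unchanged. *)
  have [lt|lt|/val_inj E] := ltngtP b b'; last by rewrite E eqxx in bb.
    by apply: (cover (b, b')); rewrite ?mem_body_pairs.
  by rewrite finset.setUC; apply: (cover (b', b)); rewrite ?mem_body_pairs.
Qed.

End total.

Theorem theorem5p4 (R : realType) (V B : nat) (body : 'I_V -> 'I_B)
    (T : {set {set 'I_V}}) (C : set 'M[R]_(V, 3)) (h : 'I_B -> bsh R V)
    (eps : R)
    (T_triangles : triangulation body T)
    (C_rigid : moves_rigidly body C)
    (h_bsh : forall b, is_bsh C (body_triangles body T b) (h b))
    (eps_gt0 : 0 < eps) :
  [/\ log_barrier C (C_obs body T C) (total_potential eps h),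
      smooth_on (C_free body T C) (total_potential eps h) &
      nonprehensile_nonvanishing body T (C_free body T C)
        (total_potential eps h)].
Proof.
split.
- exact: total_log_barrier.
- exact: total_smooth.
- exact: total_nonprehensile.
Qed.
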